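(* Let $\Omega\subset\mathbb{R}^2$ be a convex polygonal domain, let $(\mathcal{T}_h)_{0<h\le h_0}$ be a regular family of admissible triangulations of $\Omega$, and let $\varepsilon>0$. Then there exists a uniformly elliptic $A\in L^\infty(\Omega;\mathcal{M}_2(\mathbb{R}))$ (i.e. for some $c>0$, $A(x)\xi\cdot\xi\ge c|\xi|^2$ for a.e. $x\in\Omega$ and all $\xi\in\mathbb{R}^2$) with the following property: for all $p>2+\varepsilon$ there exists $f\in W^{-1,p}(\Omega)$ such that, if $u_h\in V^1_0(\mathcal{T}_h)$ denotes the unique element of $V^1_0(\mathcal{T}_h)$ with $$\int_\Omega A(x)\nabla u_h(x)\cdot\nabla v(x)\,dx=-\langle f,v\rangle\qquad\text{for all } v\in V^1_0(\mathcal{T}_h),$$ then the family $(u_h)_{0<h\le h_0}$ is not uniformly bounded in $W^{1,p}(\Omega)$.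
   Context: A triangulation of the polygonal domain $\Omega$ is a finite family $\mathcal{T}$ of closed triangles with $\overline\Omega=\bigcup_{T\in\mathcal{T}}T$. It is admissible if for all distinct $T,T'\in\mathcal{T}$ the set $T\cap T'$ is empty, or a vertex, or a common side. For a triangle $T$, $h_T$ is its diameter and $\rho_T$ is the diameter of the largest ball included in $T$. The family $(\mathcal{T}_h)_{0<h\le h_0}$ consists of admissible triangulations of $\Omega$ with $\sup_{T\in\mathcal{T}_h}h_T=h$; it is regular if there exists $\sigma>0$ with $h_T/\rho_T\le\sigma$ for all $T\in\mathcal{T}_h$ and all $h$. $V^1(\mathcal{T})$ is the space of continuous functions on $\overline\Omega$ whose restriction to each $T\in\mathcal{T}$ is a polynomial of degree at most $1$, and $V^1_0(\mathcal{T})$ is the subspace of those vanishing on $\partial\Omega$; $V^1_0(\mathcal{T})\subset W^{1,2}_0(\Omega)$. $W^{-1,p}(\Omega)$ is the dual of $W^{1,p'}_0(\Omega)$, $\frac1p+\frac1{p'}=1$. *)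

(* Defs.v *)
From HB Require Import structures.
From mathcomp Require Import all_boot all_order all_algebra.
From mathcomp Require Import all_classical all_reals all_analysis.
Set Implicit Arguments.
Unset Strict Implicit.
Unset Printing Implicit Defensive.
Import Order.TTheory GRing.Theory Num.Theory.
Import numFieldNormedType.Exports.
Local Open Scope classical_set_scope.
Local Open Scope ring_scope.

(* The library norm of [R * R] is the max norm: it is used only through the
   topology it induces.  Lengths and diameters use the Euclidean [enorm]. *)
Notation plane R := (R * R)%type.

Definition dotp (R : realType) (x y : plane R) : R := x.1 * y.1 + x.2 * y.2.

Definition enorm (R : realType) (x : plane R) : R := Num.sqrt (dotp x x).

Definition mx_app (R : realType) (M : 'M[R]_2) (x : plane R) : plane R :=
  (M ord0 ord0 * x.1 + M ord0 ord_max * x.2,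
   M ord_max ord0 * x.1 + M ord_max ord_max * x.2).

Definition leb2 (R : realType) :
    {measure set (measurableTypeR R * measurableTypeR R) -> \bar R} :=
  (@lebesgue_measure R \x @lebesgue_measure R)%E.

Definition frontier (R : realType) (E : set (plane R)) : set (plane R) :=
  closure E `\` interior E.

Definition seg (R : realType) (a b : plane R) : set (plane R) :=
  [set x | exists s t : R, [/\ 0 <= s, 0 <= t, s + t = 1
                              & x = s *: a + t *: b]].

Definition polygonal_domain (R : realType) (Omega : set (plane R)) : Prop :=
  [/\ open Omega, connected Omega, Omega !=set0, bounded_set Omega
    & exists s : seq (plane R * plane R),
        frontier Omega = \bigcup_(ab in [set` s]) seg ab.1 ab.2].

Definition hull3 (R : realType) (a b c : plane R) : set (plane R) :=
  [set x | exists r s t : R, [/\ 0 <= r, 0 <= s, 0 <= t, r + s + t = 1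
                                & x = r *: a + s *: b + t *: c]].

Definition is_triangle (R : realType) (T : set (plane R)) (a b c : plane R) :
    Prop :=
  (b.1 - a.1) * (c.2 - a.2) - (b.2 - a.2) * (c.1 - a.1) != 0 /\
  T = hull3 a b c.

Definition triangle (R : realType) (T : set (plane R)) : Prop :=
  exists a b c, is_triangle T a b c.

Definition vertex (R : realType) (T : set (plane R)) (x : plane R) : Prop :=
  exists b c, is_triangle T x b c.

Definition side (R : realType) (T S : set (plane R)) : Prop :=
  exists a b c, is_triangle T a b c /\ S = seg a b.

Definition triangulation (R : realType) (Omega : set (plane R))
    (Tau : set (set (plane R))) : Prop :=
  [/\ finite_set Tau, (forall T, Tau T -> triangle T)
    & closure Omega = \bigcup_(T in Tau) T].

Definition admissible (R : realType) (Tau : set (set (plane R))) : Prop :=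
  forall T T', Tau T -> Tau T' -> T <> T' ->
    [\/ T `&` T' = set0,
        (exists x, [/\ vertex T x, vertex T' x & T `&` T' = [set x]])
      | (exists S, [/\ side T S, side T' S & T `&` T' = S])].

Definition diam (R : realType) (T : set (plane R)) : R :=
  sup [set r | exists x y, [/\ T x, T y & r = enorm (x - y)]].

Definition indiam (R : realType) (T : set (plane R)) : R :=
  sup [set d | exists (c : plane R) (r : R),
    [/\ 0 <= r, [set x | enorm (x - c) <= r] `<=` T & d = 2 * r]].

Definition regular_family (R : realType) (h0 : R)
    (Tau : R -> set (set (plane R))) : Prop :=
  exists sigma : R, 0 < sigma /\
    forall h : R, 0 < h <= h0 -> forall T, Tau h T -> diam T / indiam T <= sigma.

Fixpoint Ck (R : realType) (k : nat) (f : plane R -> R) : Prop :=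
  if k is k'.+1 then
    [/\ continuous f,
        (forall x, derivable f x (1, 0)) /\ (forall x, derivable f x (0, 1)),
        Ck k' (fun x => 'D_(1, 0) f x) & Ck k' (fun x => 'D_(0, 1) f x)]
  else continuous f.

Definition test_fun (R : realType) (Omega : set (plane R)) (f : plane R -> R) :
    Prop :=
  [/\ forall k, Ck k f, compact (closure [set x | f x != 0])
    & closure [set x | f x != 0] `<=` Omega].

Definition loc_integrable (R : realType) (Omega : set (plane R))
    (f : plane R -> R) : Prop :=
  forall K, compact K -> K `<=` Omega -> (leb2 R).-integrable K (EFin \o f).

Definition weak_grad (R : realType) (Omega : set (plane R)) (u : plane R -> R)
    (g : plane R -> plane R) : Prop :=
  [/\ loc_integrable Omega u,
      loc_integrable Omega (fun x => (g x).1),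
      loc_integrable Omega (fun x => (g x).2)
    & forall phi, test_fun Omega phi ->
        (\int[leb2 R]_(x in Omega) (u x * 'D_(1, 0) phi x)%:E =
           - \int[leb2 R]_(x in Omega) ((g x).1 * phi x)%:E)%E /\
        (\int[leb2 R]_(x in Omega) (u x * 'D_(0, 1) phi x)%:E =
           - \int[leb2 R]_(x in Omega) ((g x).2 * phi x)%:E)%E].

(* A weak gradient is unique up to a null set; [grad] selects a representative
   (and is the junk value 0 when there is no weak gradient). *)
Definition grad (R : realType) (Omega : set (plane R)) (u : plane R -> R) :
    plane R -> plane R :=
  xget (fun=> (0, 0)) [set g | weak_grad Omega u g].

Definition Lp_norm (R : realType) (Omega : set (plane R)) (p : \bar R)
    (f : plane R -> R) : \bar R :=
  Lnorm (leb2 R) p (EFin \o (f \_ Omega)).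

(* The type argument makes the sigma-algebra the same canonical instance as that
   of [leb2]; the default instance on [R * R] is only convertible to it. *)
Definition Lp (R : realType) (Omega : set (plane R)) (p : \bar R)
    (f : plane R -> R) : Prop :=
  @measurable_fun _ _ (measurableTypeR R * measurableTypeR R)%type R Omega f /\
  (Lp_norm Omega p f < +oo)%E.

(* Elements of Sobolev and finite element spaces are represented by total
   functions on the plane; only their values on [Omega] (resp. on
   [closure Omega]) are relevant. *)
Definition W1 (R : realType) (Omega : set (plane R)) (p : \bar R)
    (u : plane R -> R) : Prop :=
  Lp Omega p u /\
  exists g, [/\ weak_grad Omega u g, Lp Omega p (fun x => (g x).1)
              & Lp Omega p (fun x => (g x).2)].

Definition W1_norm (R : realType) (Omega : set (plane R)) (p : \bar R)
    (u : plane R -> R) : \bar R :=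
  (Lp_norm Omega p u + Lp_norm Omega p (fun x => enorm (grad Omega u x)))%E.

Definition W10 (R : realType) (Omega : set (plane R)) (p : \bar R)
    (v : plane R -> R) : Prop :=
  W1 Omega p v /\
  forall e : R, 0 < e -> exists phi, test_fun Omega phi /\
    (W1_norm Omega p (fun x => v x - phi x)%R < e%:E)%E.

(* [f] is a bounded linear form on W^{1,p'}_0; boundedness makes it constant on
   classes of almost everywhere equal functions. *)
Definition Wm1 (R : realType) (Omega : set (plane R)) (p : \bar R)
    (f : (plane R -> R) -> R) : Prop :=
  (forall (a : R) (v w : plane R -> R),
     W10 Omega (hoelder_conjugate p) v -> W10 Omega (hoelder_conjugate p) w ->
     f (fun x => a * v x + w x) = a * f v + f w) /\
  exists C : R, forall v, W10 Omega (hoelder_conjugate p) v ->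
    (`|f v|%:E <= C%:E * W1_norm Omega (hoelder_conjugate p) v)%E.

Definition V1 (R : realType) (Omega : set (plane R))
    (Tau : set (set (plane R))) (v : plane R -> R) : Prop :=
  {within closure Omega, continuous v} /\
  forall T, Tau T -> exists a b c : R,
    forall x, T x -> v x = a + b * x.1 + c * x.2.

Definition V10 (R : realType) (Omega : set (plane R))
    (Tau : set (set (plane R))) (v : plane R -> R) : Prop :=
  V1 Omega Tau v /\ forall x, frontier Omega x -> v x = 0.

Definition Linfty_mx (R : realType) (Omega : set (plane R))
    (A : plane R -> 'M[R]_2) : Prop :=
  forall i j, Lp Omega +oo%E (fun x => A x i j).

Definition uniformly_elliptic (R : realType) (Omega : set (plane R))
    (A : plane R -> 'M[R]_2) : Prop :=
  exists2 c : R, 0 < c & {ae leb2 R, forall x, Omega x ->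
    forall xi : plane R, c * enorm xi ^+ 2 <= dotp (mx_app (A x) xi) xi}.

Definition galerkin (R : realType) (Omega : set (plane R))
    (Tau : set (set (plane R))) (A : plane R -> 'M[R]_2)
    (f : (plane R -> R) -> R) (u : plane R -> R) : Prop :=
  V10 Omega Tau u /\
  forall v, V10 Omega Tau v ->
    (\int[leb2 R]_(x in Omega)
       (dotp (mx_app (A x) (grad Omega u x)) (grad Omega v x))%:E
     = (- f v)%:E)%E.

(* Main.v *)
(* Meyers' example.  Put m = -1/(2 + eps), lam = 2m + 1, and let A have
   eigenvalues 1 (radial) and lam^2 (tangential) around a point z of Omega.
   With y = x - z, the function y_1 |y|^(2m) solves div (A grad w) = 0 and its
   gradient, of size |y|^(2m), is in L^p near z only for p < 2 + eps.  After a
   cut-off, A grad w is the sum of a rotated gradient, which is orthogonal to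
   all gradients, and of a bounded field G; so w solves the problem with right
   hand side f = - int G . grad, which is in W^(-1,p) for every p.

   Regularize w at distance sqrt D from z into a C^(1,1) function w_D, and let v
   be its Lagrange interpolant: by ellipticity the L^2 norm of grad (u_h - v) is
   at most a constant times that of the strong residual of v, which is as small
   as desired if D and then h are small.  On the box z + [r, 2r]^2, grad w_D is
   at least N ~ r^(2m), hence so is grad u_h up to an arbitrarily small L^2
   error, and t <= N + N^(1-p) t^p turns a bound of u_h in W^(1,p) into a bound
   of r^(2(mp + 1)) as r -> 0, whereas mp + 1 < 0. *)

Require Import Defs.
From HB Require Import structures.
From mathcomp Require Import all_boot all_order all_algebra.
From mathcomp Require Import all_classical all_reals all_analysis.
From mathcomp Require Import measurable_realfun.
From mathcomp Require Import ring lra.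
Import Order.TTheory GRing.Theory Num.Theory.
Import numFieldNormedType.Exports.
Local Open Scope classical_set_scope.
Local Open Scope ring_scope.
Set Implicit Arguments.
Unset Strict Implicit.
Unset Printing Implicit Defensive.

(** In polar coordinates around z the operator is r^-1 d_r (r d_r) + lam^2 r^-2 d_theta^2, so r^lam
    cos theta is a solution; with lam = 2m + 1 it is y_1 |y|^(2m), and eps > 0 gives lam > 0, that
    is, ellipticity. The gradient of this solution is unbounded, so it cannot be interpolated with a
    uniform error; this is what forces the regularization. The defect of w_D is of order D^m on a
    set of area of order D: its squared L^2 norm is of order D^(2m + 1), small because m > -1/2. The
    interpolation error is of order h with a constant depending on D. No convergence of u_h is
    invoked: for each r a single well-chosen h yields an inequality between r and the supposed
    bound, and only then does r tend to 0. The main obstacle is the orthogonality of rotated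
    gradients to gradients of finite element functions: formally it uses second derivatives, whereas
    these functions are only Lipschitz. It is obtained for difference quotients, by translation of
    integrals, and then passed to the limit; likewise smoothness of w_D is expressed by a Taylor
    bound with quadratic remainder. *)

Notation plane_mt R := (measurableTypeR R * measurableTypeR R)%type.
Notation measurable_plane D f :=
  (@measurable_fun _ _ (measurableTypeR _ * measurableTypeR _)%type _ D f).

(** * Lebesgue measure of the plane *)

Section PlaneMeasure.
Variable R : realType.
Implicit Types (U : set (plane R)) (x y z : plane R).

Definition obox (Q : plane R * plane R) : set (plane R) :=
  [set x | Q.1.1 < x.1 < Q.2.1 /\ Q.1.2 < x.2 < Q.2.2].

Definition cbox (Q : plane R * plane R) : set (plane R) :=
  [set x | Q.1.1 <= x.1 <= Q.2.1 /\ Q.1.2 <= x.2 <= Q.2.2].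

Lemma oboxE Q : obox Q = `]Q.1.1, Q.2.1[ `*` `]Q.1.2, Q.2.2[.
Proof. by apply/seteqP; split=> x; rewrite /obox /= !in_itv. Qed.

Lemma cboxE Q : cbox Q = `[Q.1.1, Q.2.1] `*` `[Q.1.2, Q.2.2].
Proof. by apply/seteqP; split=> x; rewrite /cbox /= !in_itv. Qed.

Lemma obox_cbox Q : obox Q `<=` cbox Q.
Proof. by move=> x [/andP[? ?] /andP[? ?]]; split; rewrite !ltW. Qed.

Lemma measurable_obox Q : measurable (obox Q : set (plane_mt R)).
Proof. by rewrite oboxE; apply: measurableX; exact: measurable_itv. Qed.

Lemma measurable_cbox Q : measurable (cbox Q : set (plane_mt R)).
Proof. by rewrite cboxE; apply: measurableX; exact: measurable_itv. Qed.

Lemma compact_cbox Q : compact (cbox Q).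
Proof. by rewrite cboxE; apply: compact_setX; exact: segment_compact. Qed.

Lemma leb2_cbox Q : Q.1.1 <= Q.2.1 -> Q.1.2 <= Q.2.2 ->
  leb2 R (cbox Q) = ((Q.2.1 - Q.1.1) * (Q.2.2 - Q.1.2))%:E.
Proof.
move=> h1 h2; rewrite cboxE [LHS]product_measure1E; [|exact: measurable_itv..].
have L (a b : R) : a <= b -> lebesgue_measure `[a, b]%classic = (b - a)%:E.
  move=> ab; rewrite lebesgue_measure_itv /= lte_fin; case: ltP => //.
  by move=> ba; rewrite (_ : b - a = 0)//; lra.
by rewrite [X in (X * _)%E]L// [X in (_ * X)%E]L// -EFinM.
Qed.

Lemma leb2_cbox_fin Q : (leb2 R (cbox Q) < +oo)%E.
Proof.
rewrite cboxE [X in (X < _)%E]product_measure1E; [|exact: measurable_itv..].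
have L (a b : R) : exists r : R, lebesgue_measure `[a, b]%classic = r%:E.
  by rewrite lebesgue_measure_itv /=; case: ifP; eexists.
have [r rE] := L Q.1.1 Q.2.1; have [s sE] := L Q.1.2 Q.2.2.
by rewrite [X in (X * _)%E]rE [X in (_ * X)%E]sE -EFinM ltry.
Qed.

Lemma normp_lt x (r : R) : (`|x| < r) = (`|x.1| < r) && (`|x.2| < r).
Proof. by rewrite prod_normE gt_max. Qed.

Lemma normp_le x (r : R) : (`|x| <= r) = (`|x.1| <= r) && (`|x.2| <= r).
Proof. by rewrite prod_normE ge_max. Qed.

Lemma openP U x : open U -> U x ->
  exists2 e : R, 0 < e & forall y, `|y - x| < e -> U y.
Proof.
move=> oU Ux; have /nbhs_ballP[e e0 he] : nbhs x U by exact: open_nbhs_nbhs.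
exists e => // y yx; apply: he; rewrite -ball_normE /=.
by rewrite distrC.
Qed.

(** Boxes with rational centres and radii 1/(n+1). Keeping the closed boxes inside U reduces
    measurability of open sets to that of boxes, and almost everywhere statements on U to compact
    subsets. *)
Lemma open_bigcup_obox U : open U -> exists Q : nat -> plane R * plane R,
  (forall k, cbox (Q k) `<=` U) /\ U = \bigcup_k obox (Q k).
Proof.
move=> oU.
pose bx (pqn : rat * rat * nat) : plane R * plane R :=
  let r := pqn.2.+1%:R^-1 in
  ((ratr pqn.1.1 - r, ratr pqn.1.2 - r), (ratr pqn.1.1 + r, ratr pqn.1.2 + r)).
(* Indices that code no box inside U are sent to a box with its corners in the wrong order, hence
   empty. *)
pose Q k := if unpickle k is Some pqn then
   if `[< cbox (bx pqn) `<=` U >] then bx pqn else ((1, 1), (0, 0))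
   else ((1, 1), (0, 0)) : plane R * plane R.
have E0 : cbox ((1, 1), (0, 0)) = set0.
  by apply/seteqP; split=> x // [/= /andP[h1 h2] _]; lra.
have QU k : cbox (Q k) `<=` U.
  rewrite /Q; case: (unpickle k) => [pqn|]; last by rewrite E0.
  by case: ifPn => [/asboolP//|_]; rewrite E0.
exists Q; split => //.
apply/seteqP; split; last by move=> x [k _ /obox_cbox]; exact: QU.
move=> x Ux; have [e e0 he] := openP oU Ux.
have e20 : 0 < e / 2 by lra.
have [n hn] : exists n, n.+1%:R^-1 < e / 2.
  by have /filter_ex[n hn] := near_infty_natSinv_lt (PosNum e20); exists n.
set r : R := n.+1%:R^-1 in hn; have r0 : 0 < r by rewrite /r invr_gt0.
have rat_near (t : R) : exists q : rat, ratr q - r < t < ratr q + r.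
  have [|q] := @rat_in_itvoo R (t - r) (t + r); first by lra.
  by rewrite in_itv /= => /andP[h1 h2]; exists q; lra.
have [p hp] := rat_near x.1; have [q hq] := rat_near x.2.
have sU : cbox (bx (p, q, n)) `<=` U.
  move=> y [/= /andP[y1 y2] /andP[y3 y4]]; apply: he; rewrite normp_lt /=.
  move: hp hq; rewrite -!/r in y1 y2 y3 y4 *.
  by rewrite !ltr_norml; lra.
exists (pickle (p, q, n)) => //; rewrite /Q pickleK.
by have -> : `[< cbox (bx (p, q, n)) `<=` U >] by exact/asboolP.
Qed.

Lemma open_measurable_plane U : open U -> measurable (U : set (plane_mt R)).
Proof.
move=> /open_bigcup_obox[Q [_ ->]].
by apply: bigcup_measurable => k _; exact: measurable_obox.
Qed.

Lemma closed_measurable_plane U : closed U -> measurable (U : set (plane_mt R)).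
Proof.
move=> cU; rewrite -(setCK U); apply: measurableC.
by apply: open_measurable_plane; exact: closed_openC.
Qed.

Lemma compact_measurable_plane U : compact U -> measurable (U : set (plane_mt R)).
Proof.
move=> cU; apply: closed_measurable_plane; apply: compact_closed => //.
Qed.

Lemma continuous_measurable_plane (f : plane R -> R) : continuous f ->
  measurable_plane setT f.
Proof.
move=> cf mT; apply: (measurability _ (RGenOpens.measurableE R)) => //.
move=> _ [_ [a [b ->] <-]]; rewrite setTI; apply: open_measurable_plane.
apply: open_comp; first by move=> x _; exact: cf.
exact: interval_open.
Qed.


(** The pushforward by a translation agrees with Lebesgue measure on half-open intervals, which
    determine it. *)
Lemma lebesgue_measure_shift (t : R) (A : set (measurableTypeR R)) :
  measurable A -> lebesgue_measure ((fun s => s + t) @^-1` A) = lebesgue_measure A.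
Proof.
have mt : @measurable_fun _ _ (measurableTypeR R) (measurableTypeR R) setT
    (fun s => s + t).
  apply: measurable_realfun.continuous_measurable_fun => s.
  by apply: cvgD; [exact: cvg_id|exact: cvg_cst].
move=> mA; apply: esym.
apply: (lebesgue_measure_unique (mu := pushforward lebesgue_measure
   (fun s => s + t : measurableTypeR R))) => //.
move=> _ [[a b] _ <-] /=; rewrite /pushforward.
have -> : (fun s => s + t) @^-1` `]a, b]%classic = `]a - t, b - t]%classic :> set R.
  by apply/seteqP; split=> s /=; rewrite !in_itv /= => /andP[h1 h2]; apply/andP; split; lra.
rewrite !lebesgue_measure_itv /= !lte_fin ltrD2r; case: ifP => // _.
by rewrite -!EFinB; congr EFin; lra.
Qed.

Lemma measurable_shift_plane (z : plane R) :
  @measurable_fun _ _ (plane_mt R) (plane_mt R) setT (fun x => x + z).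
Proof.
apply: (@measurable_fun_pair _ _ _ (plane_mt R) (measurableTypeR R) (measurableTypeR R)
  (fun x => x.1 + z.1) (fun x => x.2 + z.2)).
  apply: (continuous_measurable_plane (f := fun x => x.1 + z.1)) => x.
  by apply: cvgD; [exact: cvg_fst|exact: cvg_cst].
apply: (continuous_measurable_plane (f := fun x => x.2 + z.2)) => x.
by apply: cvgD; [exact: cvg_snd|exact: cvg_cst].
Qed.

Lemma leb2_shift (z : plane R) (A : set (plane R)) :
  measurable (A : set (plane_mt R)) -> leb2 R ((fun x => x + z) @^-1` A) = leb2 R A.
Proof.
move=> mA; apply: esym; have mz := measurable_shift_plane z.
apply: (@product_measure_unique _ _ _ _ _ lebesgue_measure lebesgue_measure
  (pushforward (leb2 R) (fun x => x + z : plane_mt R))) => //= B C mB mC.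
rewrite /pushforward.
have -> : (fun x => x + z) @^-1` (B `*` C) =
   ((fun s => s + z.1) @^-1` B) `*` ((fun s => s + z.2) @^-1` C).
  by apply/seteqP; split=> x.
have ms (t : R) (D : set (measurableTypeR R)) : measurable D ->
   measurable ((fun s => s + t) @^-1` D : set (measurableTypeR R)).
  move=> mD; rewrite -[X in measurable X]setTI.
  suff : @measurable_fun _ _ (measurableTypeR R) (measurableTypeR R) setT
    (fun s => s + t) by exact.
  apply: measurable_realfun.continuous_measurable_fun => s.
  by apply: cvgD; [exact: cvg_id|exact: cvg_cst].
rewrite [LHS]product_measure1E; [|exact: ms..].
by rewrite [X in (X * _)%E]lebesgue_measure_shift// [X in (_ * X)%E]lebesgue_measure_shift.
Qed.

Lemma integral_shift (z : plane R) (f : plane R -> \bar R) :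
  @measurable_fun _ _ (plane_mt R) _ setT f ->
  (leb2 R).-integrable setT (fun x : plane R => f (x + z)) ->
  (\int[leb2 R]_x f ((x : plane R) + z)%R = \int[leb2 R]_x f x)%E.
Proof.
move=> mf intf; have mz := measurable_shift_plane z.
have := @integral_pushforward _ _ (plane_mt R) (plane_mt R) R (fun x => x + z) mz
   (leb2 R) setT f mf intf measurableT.
rewrite preimage_setT => <-.
apply: eq_measure_integral => A mA _.
by rewrite /= /pushforward leb2_shift.
Qed.

Lemma leb2_line (a b c : R) : (a != 0) || (b != 0) ->
  leb2 R [set x | a * x.1 + b * x.2 = c] = 0.
Proof.
move=> ab; have [b0|b0] := eqVneq b 0.
  move: ab; rewrite b0 eqxx orbF => a0.
  have -> : [set x : plane R | a * x.1 + 0 * x.2 = c] = [set c / a] `*` setT.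
    apply/seteqP; split=> -[x y] /=; rewrite mul0r addr0.
      by move=> <-; split => //; rewrite mulrC mulKf.
    by move=> [-> _]; rewrite mulrC divfK.
  rewrite [LHS]product_measure1E//.
  by rewrite [X in (X * _)%E]lebesgue_measure_set1 mul0e.
(* The product measure unfolds to the integral of the measures of the vertical sections, here single
   points. *)
apply: integral0_eq => x _ /=.
have -> : xsection [set x0 : plane R | a * x0.1 + b * x0.2 = c] x = [set (c - a * x) / b].
  apply/seteqP; split=> y; rewrite xsectionE /=.
    by move=> <-; rewrite addrAC subrr add0r mulrC mulKf.
  by move=> ->; field; rewrite b0.
exact: lebesgue_measure_set1.
Qed.

Lemma measurable_line (a b c : R) :
  measurable ([set x | a * x.1 + b * x.2 = c] : set (plane_mt R)).
Proof.
apply: closed_measurable_plane.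
apply: (closed_comp (f := fun x : plane R => a * x.1 + b * x.2) (D := [set c])) => //.
move=> x _; apply: cvgD; apply: cvgM;
  by [exact: cvg_cst|exact: cvg_fst|exact: cvg_snd].
Qed.

Lemma ae_imply (P Q : plane R -> Prop) : (forall x, P x -> Q x) ->
  {ae leb2 R, forall x, P x} -> {ae leb2 R, forall x, Q x}.
Proof.
move=> PQ; apply: negligibleS => x /= nQ Px; exact/nQ/PQ.
Qed.

Lemma ae_and (P Q : plane R -> Prop) : {ae leb2 R, forall x, P x} ->
  {ae leb2 R, forall x, Q x} -> {ae leb2 R, forall x, P x /\ Q x}.
Proof.
move=> nP nQ; apply: (negligibleS _ (negligibleU nP nQ)) => x /= /not_andP[h|h].
  by left.
by right.
Qed.

Lemma ae_all (P : plane R -> Prop) : (forall x, P x) -> {ae leb2 R, forall x, P x}.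
Proof.
move=> hP; apply: (negligibleS _ (@negligible_set0 _ _ _ (leb2 R))) => x /=; exact.
Qed.

End PlaneMeasure.

(** * Smooth bump functions of one variable *)

Section Smooth1.
Variable R : realType.
Implicit Types (f g : R -> R) (x t : R) (k n : nat).

Lemma cvg_is_derive (f : R -> R) (x d : R) :
  h^-1 * (f (h + x) - f x) @[h --> 0^'] --> d -> is_derive x 1 f d.
Proof.
move=> cf; have E : (fun h : R => h^-1 *: ((f \o shift x) (h *: (1:R)) - f x)) =
   (fun h => h^-1 * (f (h + x) - f x)).
  by apply/funext => h; rewrite /= /GRing.scale /= mulr1.
split; first by apply/cvg_ex; exists d; rewrite E.
by rewrite /derive E; exact: cvg_lim.
Qed.

Lemma is_derive_cont (f : R -> R) (x d : R) : is_derive x 1 f d -> {for x, continuous f}.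
Proof.
move=> [df _]; apply: differentiable_continuous.
exact/derivable1_diffP.
Qed.

(** C^k regularity with an existential derivative at each order, so that closure under sums,
    products and affine substitutions follows by induction on k. *)
Fixpoint smooth1 k f : Prop := if k is k'.+1 then
    exists2 f', (forall x, is_derive x 1 f (f' x)) & smooth1 k' f'
  else continuous f.

Lemma smooth1_cont k f : smooth1 k f -> continuous f.
Proof.
case: k => //= k [f' df _] x; exact: is_derive_cont (df x).
Qed.

Lemma smooth1W k f : smooth1 k.+1 f -> smooth1 k f.
Proof.
elim: k f => [f /smooth1_cont//|k IH f [f' df sf]].
by exists f' => //; exact: IH.
Qed.

Lemma smooth1D k f g : smooth1 k f -> smooth1 k g -> smooth1 k (fun x => f x + g x).
Proof.
elim: k f g => [|k IH] f g; first by move=> cf cg x; apply: cvgD; [exact: cf|exact: cg].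
move=> [f' df sf] [g' dg sg]; exists (fun x => f' x + g' x); last exact: IH.
by move=> x; exact: is_deriveD.
Qed.

Lemma smooth1M k f g : smooth1 k f -> smooth1 k g -> smooth1 k (fun x => f x * g x).
Proof.
elim: k f g => [|k IH] f g; first by move=> cf cg x; apply: cvgM; [exact: cf|exact: cg].
move=> sf sg; have [sfk sgk] := (smooth1W sf, smooth1W sg).
case: sf sg => f' df sf [g' dg sg].
exists (fun x => f x * g' x + g x * f' x); last by apply: smooth1D; exact: IH.
by move=> x; exact: is_deriveM.
Qed.

Lemma smooth1_cst k (a : R) : smooth1 k (fun=> a).
Proof.
elim: k a => [|k IH] a /=; first by move=> x; exact: cvg_cst.
by exists (fun=> 0) => // x; exact: is_derive_cst.
Qed.

Lemma smooth1_affine k f (a b : R) : smooth1 k f -> smooth1 k (fun x => f (a * x + b)).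
Proof.
elim: k f => [|k IH] f /=.
  move=> cf x; apply: (cvg_comp (fun x => a * x + b) f); last exact: cf.
  by apply: cvgD; [apply: cvgM; [exact: cvg_cst|exact: cvg_id]|exact: cvg_cst].
move=> [f' df sf]; exists (fun x => f' (a * x + b) * a).
  move=> x; apply: (@is_derive1_comp _ f (fun x => a * x + b)).
  apply: cvg_is_derive; apply: (cvg_near_cst); near=> h.
  have h0 : h != 0 by near: h; exact: nbhs_dnbhs_neq.
  by field.
by apply: smooth1M; [exact: IH|exact: smooth1_cst].
Unshelve. all: by end_near. Qed.

(** For n = 0 this is the classical exp(-1/x) extended by 0; the powers of 1/x make the family
    stable under differentiation, up to linear combinations. *)
Definition flat n (x : R) : R := if x <= 0 then 0 else x^-1 ^+ n * expR (- x^-1).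

(** exp x is the n-th power of exp(x/n), which is at least x/n. *)
Lemma exprn_le_expR n x : 0 <= x -> x ^+ n <= n%:R ^+ n * expR x.
Proof.
move=> x0; case: n => [|n]; first by rewrite !expr0 mul1r; have := expR_ge1Dx x; lra.
have n0 : (0 : R) < n.+1%:R by rewrite ltr0n.
have -> : expR x = expR (x / n.+1%:R) ^+ n.+1.
  by rewrite -expRM_natl; congr expR; rewrite mulrC divfK// gt_eqF.
rewrite -exprMn; apply: lerXn2r; rewrite ?nnegrE//.
rewrite -ler_pdivrMl// mulrC; apply: le_trans (expR_ge1Dx _).
by rewrite lerDr ler01.
Qed.

(** The factor [x ^+ 2] makes the difference quotient at 0 of order x, so that [flat n] has
    derivative 0 there. *)
Lemma flat_le n x : 0 < x -> 0 <= flat n x <= n.+2%:R ^+ n.+2 * x ^+ 2.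
Proof.
move=> x0; rewrite /flat (leNgt x) x0 /=.
have x'0 : 0 < x^-1 by rewrite invr_gt0.
apply/andP; split; first by rewrite mulr_ge0 ?expR_ge0 ?exprn_ge0 ?ltW.
rewrite expRN -ler_pdivrMr ?exprn_gt0// -exprVn mulrAC -exprD addn2.
rewrite ler_pdivrMr ?expR_gt0//; exact: exprn_le_expR (ltW x'0).
Qed.

Lemma is_derive_flat n x : is_derive x 1 (flat n) (- n%:R * flat n.+1 x + flat n.+2 x).
Proof.
have [x0|x0|->] := ltgtP x 0.
- rewrite /flat (ltW x0) mulr0 addr0.
  apply: (@near_eq_is_derive _ _ _ (fun=> 0)).
  near=> y; rewrite ifT//; apply: ltW; near: y; exact: lt_nbhsl.
- have xn0 : x != 0 by rewrite gt_eqF.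
  have dV : is_derive x 1 (fun y : R => y^-1) (- x ^- 2).
    apply: is_derive_eq; first exact: (@is_deriveV _ id).
    by rewrite /GRing.scale /= mulr1.
  have dE : is_derive x 1 (fun y : R => expR (- y^-1)) (expR (- x^-1) * x ^- 2).
    apply: (@is_derive1_comp _ expR (fun y => - y^-1)).
    by apply: is_derive_eq; rewrite opprK.
  have dX : is_derive x 1 (fun y : R => y^-1 ^+ n)
      ((n%:R * x^-1 ^+ n.-1) *: (- x ^- 2)).
    have -> : (fun y : R => y^-1 ^+ n) = (fun y : R => y^-1) ^+ n.
      by apply/funext => y; rewrite exprfctE.
    exact: (is_deriveX n dV).
  have D : is_derive x 1 (fun y : R => y^-1 ^+ n * expR (- y^-1))
      (- n%:R * flat n.+1 x + flat n.+2 x).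
    apply: (is_derive_eq (is_deriveM dX dE)).
    rewrite /GRing.scale /= /flat (leNgt x) x0 /=.
    case: n {dX} => [|n]; rewrite /=; first by field.
    by rewrite !exprS; field.
  apply: near_eq_is_derive D.
  near=> y; rewrite /flat ifF//; apply/negbTE; rewrite -ltNge; near: y.
  by apply: (@cvgr_gt _ _ (nbhs x) _ idfun x) => //; exact: cvg_id.
- rewrite /flat lexx mulr0 addr0; apply: cvg_is_derive.
  rewrite lexx.
  apply/cvgr0Pnorm_le => e e0.
  set C : R := n.+2%:R ^+ n.+2.
  have C0 : 0 < C by rewrite exprn_gt0 // ltr0n.
  near=> h.
  rewrite addr0 subr0; case: ifPn => h0; first by rewrite mulr0 normr0 ltW.
  rewrite -ltNge in h0.
  have := flat_le n h0; rewrite /flat (leNgt h) h0 /= => /andP[f0 fC].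
  rewrite normrM ger0_norm ?invr_ge0 ?(ltW h0)// ger0_norm//.
  rewrite ler_pdivrMl//; apply: le_trans fC _; apply: ltW.
  have he : h < e / C.
    by apply: le_lt_trans (ler_norm _) _; near: h; apply: dnbhs0_lt; rewrite divr_gt0.
  by rewrite -/C expr2 mulrCA ltr_pM2l// mulrC -ltr_pdivlMr.
Unshelve. all: by end_near. Qed.

Lemma smooth1_flat k n : smooth1 k (flat n).
Proof.
elim: k n => [|k IH] n /=; first by move=> x; exact: is_derive_cont (is_derive_flat n x).
exists (fun x => - n%:R * flat n.+1 x + flat n.+2 x); first exact: is_derive_flat.
by apply: smooth1D => //; apply: smooth1M => //; exact: smooth1_cst.
Qed.

(** The dilation by n+1 makes these functions, which vanish outside ]a,
    b[, tend to the indicator of ]a, b[ as n grows. *)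
Definition bump1 (a b : R) n (t : R) : R :=
  flat 0 (n.+1%:R * t + - (n.+1%:R * a)) * flat 0 (- n.+1%:R * t + n.+1%:R * b).

Lemma smooth1_bump k a b n : smooth1 k (bump1 a b n).
Proof. by apply: smooth1M; apply: smooth1_affine; exact: smooth1_flat. Qed.

Lemma flat0_01 t : 0 <= flat 0 t <= 1.
Proof.
rewrite /flat; case: ifPn => [_|]; first by rewrite lexx ler01.
rewrite -ltNge expr0 mul1r => t0; rewrite expR_ge0 /= -[leRHS]expR0 ler_expR.
by rewrite oppr_le0 invr_ge0 ltW.
Qed.

Lemma bump1_01 a b n t : 0 <= bump1 a b n t <= 1.
Proof.
rewrite /bump1; have /andP[? ?] := flat0_01 (n.+1%:R * t + - (n.+1%:R * a)).
have /andP[? ?] := flat0_01 (- n.+1%:R * t + n.+1%:R * b).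
by rewrite mulr_ge0//= mulr_ile1.
Qed.

Lemma bump1_out a b n t : ~~ (a < t < b) -> bump1 a b n t = 0.
Proof.
have n0 : (0 : R) < n.+1%:R by rewrite ltr0n.
rewrite negb_and -!leNgt => /orP[ta|bt]; rewrite /bump1 /flat.
  by rewrite ifT ?mul0r// -mulrBr pmulr_rle0// subr_le0.
by rewrite [X in _ * X]ifT ?mulr0// mulNr addrC -mulrBr pmulr_rle0// subr_le0.
Qed.

Lemma cvg_flat0 s : 0 < s -> flat 0 (n.+1%:R * s) @[n --> \oo] --> (1 : R).
Proof.
move=> s0; have -> : (fun n => flat 0 (n.+1%:R * s)) =
    (fun n => expR (- (n.+1%:R^-1 * s^-1))).
  apply/funext => n; rewrite /flat ifF; first by rewrite expr0 mul1r invfM.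
  by apply/negbTE; rewrite -ltNge mulr_gt0// ltr0n.
rewrite -[X in _ --> X]expR0; apply: continuous_cvg; first exact: continuous_expR.
rewrite -oppr0 -[X in - X](mul0r s^-1); apply: cvgN; apply: cvgM; last exact: cvg_cst.
exact: cvg_harmonic.
Qed.

Lemma cvg_bump1 a b t : a < t < b -> bump1 a b n t @[n --> \oo] --> (1 : R).
Proof.
move=> /andP[ta tb]; rewrite -(mulr1 (1 : R)); apply: cvgM.
  under eq_fun do rewrite -mulrBr; apply: cvg_flat0; lra.
under eq_fun do rewrite mulNr addrC -mulrBr; apply: cvg_flat0; lra.
Qed.

End Smooth1.

(** * Test functions and the fundamental lemma *)

Section TestFunctions.
Variable R : realType.
Implicit Types (U Omega : set (plane R)) (x y z : plane R) (f g : plane R -> R).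
Let mu := leb2 R.

Lemma quot10E f x : (fun h : R => h^-1 *: ((f \o shift x) (h *: (1, 0)) - f x)) =
  (fun h : R => h^-1 *: (((fun t => f (t, x.2)) \o shift x.1) (h *: 1) - f (x.1, x.2))).
Proof.
apply/funext => h /=; congr (_ *: (f _ - f _)); last by case: x.
by apply/eqP; rewrite xpair_eqE /=; apply/andP; split=> //; rewrite /GRing.scale /= mulr0 add0r.
Qed.

Lemma quot01E f x : (fun h : R => h^-1 *: ((f \o shift x) (h *: (0, 1)) - f x)) =
  (fun h : R => h^-1 *: (((fun t => f (x.1, t)) \o shift x.2) (h *: 1) - f (x.1, x.2))).
Proof.
apply/funext => h /=; congr (_ *: (f _ - f _)); last by case: x.
by apply/eqP; rewrite xpair_eqE /=; apply/andP; split=> //; rewrite /GRing.scale /= mulr0 add0r.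
Qed.

Lemma derivable10E f x : derivable f x (1, 0) = derivable (fun t => f (t, x.2)) x.1 1.
Proof. by rewrite /derivable quot10E. Qed.

Lemma derivable01E f x : derivable f x (0, 1) = derivable (fun t => f (x.1, t)) x.2 1.
Proof. by rewrite /derivable quot01E. Qed.

Lemma derive10E f x : 'D_(1, 0) f x = 'D_1 (fun t => f (t, x.2)) x.1.
Proof. by rewrite /derive quot10E. Qed.

Lemma derive01E f x : 'D_(0, 1) f x = 'D_1 (fun t => f (x.1, t)) x.2.
Proof. by rewrite /derive quot01E. Qed.

Lemma Ck_prod k (a b : R -> R) : (forall j, smooth1 j a) -> (forall j, smooth1 j b) ->
  Ck k (fun x => a x.1 * b x.2).
Proof.
have cc (c d : R -> R) : (forall j, smooth1 j c) -> (forall j, smooth1 j d) ->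
    continuous (fun x : plane R => c x.1 * d x.2).
  move=> sc sd x; apply: cvgM.
    apply: (cvg_comp (fun x : plane R => x.1) c); first exact: cvg_fst.
    exact: (smooth1_cont (sc 0%N)).
  apply: (cvg_comp (fun x : plane R => x.2) d); first exact: cvg_snd.
  exact: (smooth1_cont (sd 0%N)).
(* The derivative supplied by [smooth1] depends a priori on the order; uniqueness of derivatives
   makes one function serve all orders. *)
have der (c : R -> R) : (forall j, smooth1 j c) ->
    exists2 c' : R -> R, (forall t : R, is_derive t 1 c (c' t)) & forall j, smooth1 j c'.
  move=> sc; have [c' dc _] := sc 1%N; exists c' => // j.
  have [c'' dc'' sc''] := sc j.+1; suff -> : c' = c'' by [].
  by apply/funext => t; rewrite -(@derive_val _ _ _ _ _ _ _ (dc t)) -(@derive_val _ _ _ _ _ _ _ (dc'' t)).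
elim: k a b => [|k IH] a b sa sb; first exact: cc.
have [a' da sa'] := der _ sa; have [b' db sb'] := der _ sb.
have d1 x : is_derive x.1 1 (fun t => a t * b x.2) (a' x.1 * b x.2).
  apply: (is_derive_eq (is_deriveM (da x.1) (is_derive_cst (b x.2) x.1 1))).
  by rewrite /GRing.scale /= mulr0 add0r mulrC.
have d2 x : is_derive x.2 1 (fun t => a x.1 * b t) (a x.1 * b' x.2).
  apply: (is_derive_eq (is_deriveM (is_derive_cst (a x.1) x.2 1) (db x.2))).
  by rewrite /GRing.scale /= mulr0 addr0.
split; first exact: cc.
- split=> x; first by rewrite derivable10E; have [] := d1 x.
  by rewrite derivable01E; have [] := d2 x.
- have -> : (fun x => 'D_(1, 0) (fun x0 : plane R => a x0.1 * b x0.2) x) =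
     (fun x => a' x.1 * b x.2).
    by apply/funext => x; rewrite derive10E; have [] := d1 x.
  exact: IH.
- have -> : (fun x => 'D_(0, 1) (fun x0 : plane R => a x0.1 * b x0.2) x) =
     (fun x => a x.1 * b' x.2).
    by apply/funext => x; rewrite derive01E; have [] := d2 x.
  exact: IH.
Qed.

Definition bump2 (Q : plane R * plane R) n x :=
  bump1 Q.1.1 Q.2.1 n x.1 * bump1 Q.1.2 Q.2.2 n x.2.

Lemma bump2_out Q n x : ~ obox Q x -> bump2 Q n x = 0.
Proof.
move=> nx; have [h1|h1] := boolP (Q.1.1 < x.1 < Q.2.1); last first.
  by rewrite /bump2 (bump1_out _ h1) mul0r.
have [h2|h2] := boolP (Q.1.2 < x.2 < Q.2.2); first by exfalso; apply: nx.
by rewrite /bump2 (bump1_out _ h2) mulr0.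
Qed.

Lemma bump2_01 Q n x : 0 <= bump2 Q n x <= 1.
Proof.
rewrite /bump2; have /andP[? ?] := bump1_01 Q.1.1 Q.2.1 n x.1.
have /andP[? ?] := bump1_01 Q.1.2 Q.2.2 n x.2.
by rewrite mulr_ge0//= mulr_ile1.
Qed.

Lemma cvg_bump2 Q x : bump2 Q n x @[n --> \oo] --> (\1_(obox Q) x : R).
Proof.
have [xQ|xQ] := pselect (obox Q x).
  rewrite indicE mem_set//; case: (xQ) => h1 h2.
  by rewrite -(mulr1 1); apply: cvgM; exact: cvg_bump1.
rewrite indicE memNset// /=; under eq_fun do rewrite bump2_out//.
exact: cvg_cst.
Qed.

Lemma closed_cbox Q : closed (cbox Q : set (plane R)).
Proof. by apply: compact_closed; [exact: norm_hausdorff|exact: compact_cbox]. Qed.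

Lemma test_fun_bump Omega Q n : cbox Q `<=` Omega -> test_fun Omega (bump2 Q n).
Proof.
move=> QO.
have sQ : closure [set x | bump2 Q n x != 0] `<=` cbox Q.
  rewrite closureE; apply: smallest_sub; first exact: closed_cbox.
  move=> x /= x0; apply: obox_cbox; apply: contrapT => nx.
  by move: x0; rewrite bump2_out// eqxx.
split; last exact: subset_trans sQ QO.
  by move=> k; apply: Ck_prod => j; exact: smooth1_bump.
apply: subclosed_compact sQ; first exact: closed_closure.
exact: compact_cbox.
Qed.

Lemma test_fun_cont Omega f : test_fun Omega f -> continuous f.
Proof. by case=> /(_ 0%N). Qed.

Definition supp f : set (plane R) := closure [set x | f x != 0].

Lemma supp0 f x : ~ supp f x -> f x = 0.
Proof.
move=> nx; apply: contrapT => /eqP fx; apply: nx.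
by apply: subset_closure.
Qed.

Lemma cont_bounded (K : set (plane R)) f : compact K -> continuous f ->
  exists2 M : R, 0 < M & forall x, K x -> `|f x| <= M.
Proof.
move=> cK cf; have : compact (f @` K).
  by apply: continuous_compact => //; exact: continuous_subspaceT.
move=> /compact_bounded[M [Mr hM]].
exists (`|M| + 1); first by have := normr_ge0 M; lra.
move=> x Kx; apply: (hM (`|M| + 1)); last by exists x.
by have := ler_norm M; lra.
Qed.

Lemma integrable_measurable_plane (D : set (plane R)) f :
  mu.-integrable D (EFin \o f) -> measurable_plane D f.
Proof. by move=> /integrableP[/measurable_EFinP]. Qed.

(** Trades the integrals over [Omega] in the definition of weak gradients for integrals over the
    plane, on which translations act. *)
Lemma loc_integrable_mul Omega K g f : open Omega -> compact K -> K `<=` Omega ->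
  loc_integrable Omega g -> continuous f -> (forall x, ~ K x -> f x = 0) ->
  mu.-integrable setT (EFin \o (fun x => g x * f x)) /\
  mu.-integrable Omega (EFin \o (fun x => g x * f x)) /\
  (\int[mu]_(x in Omega) (g x * f x)%:E = \int[mu]_x (g x * f x)%:E)%E.
Proof.
move=> oO cK KO lg cf fK; have mK := compact_measurable_plane cK.
have mO := open_measurable_plane oO.
have iK : mu.-integrable K (EFin \o (fun x => g x * f x)).
  have [M M0 hM] := cont_bounded cK cf.
  have gi := lg K cK KO.
  have mf : measurable_plane K f.
    by apply: measurable_funS (continuous_measurable_plane cf).
  apply: (le_integrable mK _ _ (integrableZr mK M gi)).
    apply/measurable_EFinP; apply: measurable_realfun.measurable_funM => //.
    exact: integrable_measurable_plane gi.
  move=> x Kx /=; rewrite lee_fin !normrM ler_wpM2l//.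
  by rewrite (le_trans (hM _ Kx))// ler_norm.
have E D : K `<=` D -> (EFin \o (fun x => g x * f x)) \_ K = (EFin \o (fun x => g x * f x)) \_ D.
  move=> KD; apply/funext => x; rewrite /patch.
  have [xK|xK] := boolP (x \in K).
    by rewrite ifT//; move: xK; rewrite !inE; exact: KD.
  case: ifPn => // xD; rewrite /= fK ?mulr0//.
  by move: xK; rewrite notin_setE.
have iT : mu.-integrable setT ((EFin \o (fun x => g x * f x)) \_ K).
  exact/(integrable_mkcond _ mK).
split; first by rewrite (E setT) ?patch_setT// in iT.
split; first by rewrite (E Omega)// in iT; apply/(integrable_mkcond _ mO).
have -> : (fun x => (g x * f x)%:E) = EFin \o (fun x => g x * f x) by [].
by rewrite [LHS]integral_mkcond -(E _ KO) (E setT)// patch_setT.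
Qed.

(** Both coordinate maps are measurable for the sigma-algebra generated by boxes, since a strip is a
    countable union of boxes. *)
Lemma sigma_obox : @measurable _ (plane_mt R) =
  <<s [set A | exists Q, A = obox Q] >>.
Proof.
set G : set (set (plane R)) := [set A | exists Q, A = obox Q].
apply/seteqP; split; last first.
  apply: smallest_sub; first exact: sigma_algebra_measurable.
  by move=> _ [Q ->]; exact: measurable_obox.
pose GT := g_sigma_algebraType G.
have mb Q : measurable (obox Q : set GT) by apply: sub_sigma_algebra; exists Q.
have arch (t : R) : exists n : nat, - n%:R < t < n%:R.
  have [n hn] : exists n : nat, `|t| < n%:R.
    by exists (Num.bound `|t|); apply: archi_boundP; rewrite normr_ge0.
  by exists n; move: hn; rewrite ltr_norml.
have m1 : @measurable_fun _ _ GT (measurableTypeR R) setT (fun x : plane R => x.1).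
  move=> mT; apply: (measurability _ (RGenOpens.measurableE R)) => //.
  move=> _ [_ [a [b ->] <-]]; rewrite setTI.
  have -> : (fun x : plane R => x.1) @^-1` `]a, b[ =
      \bigcup_n obox ((a, - n%:R), (b, n%:R)).
    apply/seteqP; split=> x /=; rewrite in_itv /=.
      by move=> xab; have [n hn] := arch x.2; exists n.
    by move=> [n _ []].
  by apply: bigcup_measurable => n _; exact: mb.
have m2 : @measurable_fun _ _ GT (measurableTypeR R) setT (fun x : plane R => x.2).
  move=> mT; apply: (measurability _ (RGenOpens.measurableE R)) => //.
  move=> _ [_ [a [b ->] <-]]; rewrite setTI.
  have -> : (fun x : plane R => x.2) @^-1` `]a, b[ =
      \bigcup_n obox ((- n%:R, a), (n%:R, b)).
    apply/seteqP; split=> x /=; rewrite in_itv /=.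
      by move=> xab; have [n hn] := arch x.1; exists n.
    by move=> [n _ []].
  by apply: bigcup_measurable => n _; exact: mb.
have := measurable_fun_pair m1 m2 => m12 A mA.
have := m12 measurableT A mA; rewrite setTI.
by congr (measurable _); apply/seteqP; split=> -[].
Qed.

(** The sets on which h integrates to 0 form a Dynkin class: it is closed under complement because
    the total integral, carried by [Q0], is 0. Boxes form a pi-system that generates the
    sigma-algebra. *)
Lemma integral0_obox (h : plane R -> R) Q0 : mu.-integrable setT (EFin \o h) ->
  (forall x, ~ obox Q0 x -> h x = 0) ->
  (forall Q, \int[mu]_(x in obox Q) (h x)%:E = 0)%E ->
  ae_eq mu setT (EFin \o h) (cst 0%E).
Proof.
move=> ih h0 hQ.
have int0 : (\int[mu]_x (h x)%:E = 0)%E.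
  rewrite -(hQ Q0) [RHS]integral_mkcond; apply: eq_integral => x _.
  by rewrite /patch; case: ifPn => //; rewrite notin_setE => xQ; rewrite h0.
have iS (S : set (plane_mt R)) : measurable S -> mu.-integrable S (EFin \o h).
  by move=> mS; apply: integrableS ih.
have HP : forall S : set (plane_mt R), measurable S -> (\int[mu]_(x in S) (h x)%:E = 0)%E.
  move=> S; rewrite sigma_obox.
  apply: (dynkin_induction (P := fun S => (\int[mu]_(x in S) (h x)%:E = 0)%E)) S => //.
  - exact: sigma_obox.
  - move=> _ _ [Q1 ->] [Q2 ->].
    exists ((Num.max Q1.1.1 Q2.1.1, Num.max Q1.1.2 Q2.1.2),
            (Num.min Q1.2.1 Q2.2.1, Num.min Q1.2.2 Q2.2.2)).
    apply/seteqP; split=> x; rewrite /obox /= !gt_max !lt_min.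
      by move=> [[/andP[-> ->] /andP[-> ->]] [/andP[-> ->] /andP[-> ->]]].
    by move=> [/andP[/andP[-> ->] /andP[-> ->]] /andP[/andP[-> ->] /andP[-> ->]]].
  - by move=> _ [Q ->]; exact: hQ.
  - move=> S mS S0; have mh : measurable_plane setT h.
      exact: integrable_measurable_plane ih.
    have := int0; rewrite -(setUv S) integral_setU//.
    + by rewrite S0 add0e.
    + exact: measurableC.
    + by rewrite setUv; exact/measurable_EFinP.
    + by apply/disj_set2P; rewrite setICr.
  - move=> F mF tF F0; rewrite integral_bigcup//.
      by apply: eseries0 => i _ _; rewrite F0.
    by apply: iS; exact: bigcup_measurable.
apply: integral_ae_eq => // E _ mE.
by rewrite HP// integral0_eq.
Qed.

(** The bumps on a box are dominated by 1 and tend to its indicator, so g has zero integral on every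
    box whose closure lies in [Omega]; [integral0_obox] applies on each box of a countable cover. *)
Lemma fundamental_lemma Omega g : open Omega -> loc_integrable Omega g ->
  (forall phi, test_fun Omega phi -> (\int[mu]_(x in Omega) (g x * phi x)%:E = 0)%E) ->
  {ae mu, forall x, Omega x -> g x = 0}.
Proof.
move=> oO lg hg.
have box0 Q : cbox Q `<=` Omega -> (\int[mu]_(x in obox Q) (g x)%:E = 0)%E.
  move=> QO; have iQ := lg _ (@compact_cbox _ Q) QO.
  have mg : measurable_plane (cbox Q) g by exact: integrable_measurable_plane iQ.
  have cb n : continuous (bump2 Q n) := test_fun_cont (test_fun_bump n QO).
  have zero n : (\int[mu]_(x in cbox Q) (g x * bump2 Q n x)%:E = 0)%E.
    rewrite -(hg _ (test_fun_bump n QO)) integral_mkcond [RHS]integral_mkcond.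
    apply: eq_integral => x _; rewrite /patch.
    have [xQ|xQ] := boolP (x \in cbox Q).
      by rewrite ifT//; move: xQ; rewrite !inE; exact: QO.
    case: ifPn => // xD; rewrite bump2_out ?mulr0// => /obox_cbox.
    by move: xQ; rewrite notin_setE.
  have := @dominated_cvg _ _ _ mu _ (@measurable_cbox _ Q)
    (fun n x => (g x * bump2 Q n x)%:E) (fun x => (g x * \1_(obox Q) x)%:E)
    (fun x => `|(g x)%:E|%E).
  have -> : (fun n => \int[mu]_(x in cbox Q) (g x * bump2 Q n x)%:E)%E = fun=> 0%E.
    by apply/funext => n; rewrite zero.
  move=> H; have {H} L : (fun _ : nat => 0%E : \bar R) @ \oo -->
      (\int[mu]_(x in cbox Q) (g x * \1_(obox Q) x)%:E)%E.
    apply: H => //.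
    - move=> n; apply/measurable_EFinP; apply: measurable_realfun.measurable_funM => //.
      by apply: measurable_funS (continuous_measurable_plane (cb n)).
    - move=> x _; apply: cvg_EFin; first exact: nearW.
      by apply: cvgM; [exact: cvg_cst|exact: cvg_bump2].
    - exact: integrable_abse.
    - move=> n x _; rewrite lee_fin normrM ler_piMr//.
      by have /andP[b0 b1] := bump2_01 Q n x; rewrite ger0_norm.
  have <- : (\int[mu]_(x in cbox Q) (g x * \1_(obox Q) x)%:E = 0)%E.
    by apply: (cvg_unique _ L) => //; exact: cvg_cst.
  rewrite integral_mkcond [RHS]integral_mkcond; apply: eq_integral => x _.
  rewrite /patch indicE; case: ifPn => [xQ|xQ].
    by rewrite ifT ?mulr1//; move: xQ; rewrite !inE; exact: obox_cbox.
  by rewrite mulr0; case: ifP.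
have [Q [QO OE]] := open_bigcup_obox oO.
have aeQ k : {ae mu, forall x, obox (Q k) x -> g x = 0}.
  pose h := g \_ (obox (Q k)).
  have iQ : mu.-integrable (obox (Q k)) (EFin \o g).
    apply: integrableS (lg _ (@compact_cbox _ (Q k)) (QO k)).
    - exact: measurable_cbox.
    - exact: measurable_obox.
    - exact: obox_cbox.
  have ih : mu.-integrable setT (EFin \o h).
    by rewrite /h -restrict_EFin; apply/(integrable_mkcond _ (@measurable_obox _ (Q k))).
  have := @integral0_obox h (Q k) ih.
  have h0 x : ~ obox (Q k) x -> h x = 0 by move=> xQ; rewrite /h /patch memNset.
  move=> /(_ h0) H; have {}H : ae_eq mu setT (EFin \o h) (cst 0%E).
    (* The part of an arbitrary box inside [Q k] is again a box with closure in [Omega]. *)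
    apply: H => Q'; rewrite integral_mkcond.
    pose Q2 := ((Num.max (Q k).1.1 Q'.1.1, Num.max (Q k).1.2 Q'.1.2),
            (Num.min (Q k).2.1 Q'.2.1, Num.min (Q k).2.2 Q'.2.2)).
    have E2 : obox Q2 = obox (Q k) `&` obox Q'.
      apply/seteqP; split=> x; rewrite /obox /= !gt_max !lt_min.
        by move=> [/andP[/andP[-> ->] /andP[-> ->]] /andP[/andP[-> ->] /andP[-> ->]]].
      by move=> [[/andP[-> ->] /andP[-> ->]] [/andP[-> ->] /andP[-> ->]]].
    have Q2O : cbox Q2 `<=` Omega.
      apply: subset_trans (QO k) => x [/= ]; rewrite !ge_max !le_min.
      by move=> /andP[/andP[h1 _] /andP[h2 _]] /andP[/andP[h3 _] /andP[h4 _]];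
         split; rewrite ?h1 ?h2 ?h3 ?h4.
    rewrite -[RHS](box0 Q2 Q2O) [RHS]integral_mkcond.
    apply: eq_integral => x _; rewrite E2 /patch /h /patch.
    have -> : (x \in obox (Q k) `&` obox Q') = (x \in obox (Q k)) && (x \in obox Q').
      exact: in_setI.
    by case: (x \in obox Q') => /=; rewrite ?andbT ?andbF//; case: (x \in obox (Q k)).
  apply: ae_imply H => x /= /(_ I) [hx] xQ; move: hx; rewrite /h /patch mem_set//.
have aeA : {ae mu, forall x, forall k, obox (Q k) x -> g x = 0}.
  apply: (negligibleS _ (negligible_bigcup aeQ)) => x /= /existsNP[k hk].
  by exists k.
by apply: ae_imply aeA => x hx; rewrite OE => -[k _ /hx].
Qed.

End TestFunctions.

(** * Integration by parts through difference quotients *)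

Section DiffQuot.
Variable R : realType.
Implicit Types (U Omega : set (plane R)) (x y z e : plane R) (u v f phi : plane R -> R)
  (g k : plane R -> plane R) (n : nat) (M : R).
Let mu := leb2 R.

Notation "'\I' f" := (Rintegral mu setT f) (at level 10).

(** One constant for the values and for the support: a sequence sharing it is dominated by a
    multiple of the indicator of a fixed box. *)
Definition bounded_supp M f :=
  [/\ measurable_plane setT f, forall x, `|f x| <= M & forall x, M < `|x| -> f x = 0].

Lemma integrable_bounded_supp M f : bounded_supp M f -> mu.-integrable setT (EFin \o f).
Proof.
move=> [mf fM f0]; pose Q : plane R * plane R := ((- M, - M), (M, M)).
have mQ := measurable_cbox Q.
have fQ : EFin \o f = (EFin \o f) \_ (cbox Q).
  apply/funext => x; rewrite /patch; case: ifPn => //; rewrite notin_setE => xQ /=.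
  rewrite f0// ltNge; apply/negP; rewrite normp_le => /andP[h1 h2]; apply: xQ.
  by rewrite /cbox /= -!ler_norml.
rewrite fQ; apply/(integrable_mkcond _ mQ).
apply: measurable_bounded_integrable => //; first exact: leb2_cbox_fin.
  exact: measurable_funS mf.
exists M; split; first exact: num_real.
by move=> N MN x _; exact: le_trans (fM x) (ltW MN).
Qed.

Lemma Rintegral_shift z f M : bounded_supp M f ->
  \I (fun x => f (x + z)) = \I f.
Proof.
move=> bf; have [mf fM f0] := bf.
rewrite /Rintegral; congr fine.
apply: (integral_shift (f := EFin \o f)); first exact/measurable_EFinP.
apply: (@integrable_bounded_supp (M + `|z|) (fun x => f (x + z))); split.
- exact: (measurableT_comp mf (measurable_shift_plane z)).
- by move=> x; apply: le_trans (fM _) _; rewrite lerDl.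
- move=> x hx; apply: f0; have := lerB_normD x z; lra.
Qed.

Lemma bounded_suppM M N f (h : plane R -> R) : bounded_supp M f -> measurable_plane setT h ->
  (forall x, `|h x| <= N) -> bounded_supp (Num.max M (M * N)) (fun x => f x * h x).
Proof.
move=> [mf fM f0] mh hN; split; first exact: measurable_realfun.measurable_funM.
- by move=> x; rewrite normrM le_max; apply/orP; right; apply: ler_pM.
- by move=> x; rewrite gt_max => /andP[h1 _]; rewrite f0 ?mul0r.
Qed.

Lemma bounded_suppW M N f : M <= N -> bounded_supp M f -> bounded_supp N f.
Proof.
move=> MN [mf fM f0]; split=> // x; first exact: le_trans (fM x) MN.
by move=> Nx; apply: f0; exact: le_lt_trans Nx.
Qed.

Lemma bounded_supp_shift z M f : bounded_supp M f -> bounded_supp (M + `|z|) (fun x => f (x + z)).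
Proof.
move=> [mf fM f0]; split.
- exact: (measurableT_comp mf (measurable_shift_plane z)).
- by move=> x; apply: le_trans (fM _) _; rewrite lerDl.
- move=> x hx; apply: f0; have := lerB_normD x z; lra.
Qed.

Lemma Rintegral_cvg M (f_ : nat -> plane R -> R) f : (forall n, bounded_supp M (f_ n)) ->
  measurable_plane setT f ->
  {ae mu, forall x, f_ n x @[n --> \oo] --> f x} ->
  \I (f_ n) @[n --> \oo] --> \I f.
Proof.
move=> bf mf cf.
pose Q : plane R * plane R := ((- M, - M), (M, M)).
have out n x : ~ cbox Q x -> f_ n x = 0.
  move=> xQ; have [_ _ f0] := bf n; apply: f0; rewrite ltNge; apply/negP.
  by rewrite normp_le => /andP[h1 h2]; apply: xQ; rewrite /cbox /= -!ler_norml.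
have mQ := measurable_cbox Q.
pose h x := M * \1_(cbox Q) x.
have ih : mu.-integrable setT (EFin \o h).
  apply: (@integrable_bounded_supp `|M|); split.
  - by apply: measurable_realfun.measurable_funM => //; exact: measurable_indic.
  - move=> x; rewrite /h indicE normrM; case: (x \in _); rewrite ?normr1 ?mulr1//.
    by rewrite normr0 mulr0.
  - move=> x Mx; rewrite /h indicE memNset ?mulr0// => -[]; rewrite -!ler_norml => h1 h2.
    have : `|x| <= M by rewrite normp_le h1 h2.
    by move=> /(lt_le_trans Mx); have := ler_norm M; lra.
have mE n : @measurable_fun _ _ (plane_mt R) _ setT (EFin \o f_ n).
  by apply/measurable_EFinP; have [] := bf n.
have mEf : @measurable_fun _ _ (plane_mt R) _ setT (EFin \o f) by exact/measurable_EFinP.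
have cE : {ae mu, forall x : plane R, setT x -> EFin (f_ n x) @[n --> \oo] --> (f x)%:E}.
  by apply: ae_imply cf => x cx _; apply: cvg_EFin => //; exact: nearW.
have dE : {ae mu, forall x : plane R, forall n, setT x -> (`|(f_ n x)%:E| <= (h x)%:E)%E}.
  apply: ae_all => x n _; rewrite /= lee_fin /h indicE.
  have [xQ|xQ] := boolP (x \in cbox Q); first by rewrite mulr1; have [_ + _] := bf n; apply.
  by rewrite out ?normr0 ?mulr0//; move: xQ; rewrite notin_setE.
have [i1 _ i2] := @dominated_convergence _ _ _ mu setT measurableT (fun n => EFin \o f_ n)
  (EFin \o f) (EFin \o h) mE mEf cE ih dE.
apply: fine_cvg; rewrite fineK//.
exact: integrable_fin_num.
Qed.

(** Steps are taken along the sequence 1/(n+1), to suit dominated convergence for sequences. *)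
Definition dq e n u x := (u (x + n.+1%:R^-1 *: e) - u x) * n.+1%:R.

Lemma bounded_supp_dq e n M u : bounded_supp M u ->
  bounded_supp (Num.max (M + `|n.+1%:R^-1 *: e|) ((M + M) * n.+1%:R)) (dq e n u).
Proof.
move=> bu; have [mf fM f0] := bu.
have [mf' _ f0'] := bounded_supp_shift (n.+1%:R^-1 *: e) bu.
split.
- by apply: measurable_realfun.measurable_funM => //; exact: measurable_realfun.measurable_funB.
- move=> x; rewrite /dq le_max normrM normr_nat ler_wpM2r ?orbT//.
  by rewrite (le_trans (ler_normB _ _))// lerD.
- move=> x; rewrite gt_max => /andP[h _]; rewrite /dq f0' ?f0 ?subrr ?mul0r//.
  by apply: le_lt_trans h; rewrite lerDl.
Qed.

Lemma bsI M f : bounded_supp M f -> mu.-integrable setT (EFin \o f).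
Proof. exact: integrable_bounded_supp. Qed.

(** Discrete integration by parts: translating the term that contains the shifted u moves the shift
    to v, in the opposite direction. *)
Lemma dq_adjoint e n M u v : bounded_supp M u -> bounded_supp M v ->
  \I (fun x => dq e n u x * v x) = \I (fun x => u x * dq (- e) n v x).
Proof.
move=> bu bv; have [mv vM v0] := bv; have [um uM u0] := bu.
set z := n.+1%:R^-1 *: e; set N : R := n.+1%:R.
have bp a b : exists K, bounded_supp K (fun x => u (x + a) * v (x + b)).
  have [mv' vM' _] := bounded_supp_shift b bv.
  by eexists; exact: (bounded_suppM (bounded_supp_shift a bu) mv' vM').
have E1 a b c : \I (fun x => u (x + (a + c)) * v (x + (b + c))) =
                \I (fun x => u (x + a) * v (x + b)).
  have [K bK] := bp a b; rewrite -(Rintegral_shift c bK); congr Rintegral.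
  by apply/funext => x; rewrite -!addrA (addrC c a) (addrC c b).
have ip a b : mu.-integrable setT (EFin \o (fun x => u (x + a) * v (x + b))).
  by have [K bK] := bp a b; exact: bsI bK.
have L : (fun x => dq e n u x * v x) =
   (fun x => N * (u (x + z) * v (x + 0) - u (x + 0) * v (x + 0))).
  by apply/funext => x; rewrite /dq -/z -/N !addr0; ring.
have Rr : (fun x => u x * dq (- e) n v x) =
   (fun x => N * (u (x + 0) * v (x - z) - u (x + 0) * v (x + 0))).
  by apply/funext => x; rewrite /dq scalerN -/z -/N !addr0; ring.
rewrite L Rr !RintegralZl//; try by
  have := @integrableB _ _ _ mu setT measurableT _ _ (ip _ _) (ip _ _); apply.
rewrite !RintegralB//; try exact: ip.
by rewrite -(E1 0 (- z) z) add0r addNr.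
Qed.

(** Both sides expand into four correlations of u and v. With z and z' the steps along e and e',
    translations by z + z', z and z' carry the terms on the right to those on the left, the two
    mixed terms trading places. *)
Lemma dq_cross e e' n M u v : bounded_supp M u -> bounded_supp M v ->
  \I (fun x => dq e' n u x * dq e n v x) = \I (fun x => dq (- e) n u x * dq (- e') n v x).
Proof.
move=> bu bv; have [mv vM v0] := bv; have [um uM u0] := bu.
set z := n.+1%:R^-1 *: e; set z' := n.+1%:R^-1 *: e'; set N : R := n.+1%:R.
have bp a b : exists K, bounded_supp K (fun x => u (x + a) * v (x + b)).
  have [mv' vM' _] := bounded_supp_shift b bv.
  by eexists; exact: (bounded_suppM (bounded_supp_shift a bu) mv' vM').
have E1 a b c : \I (fun x => u (x + (a + c)) * v (x + (b + c))) =
                \I (fun x => u (x + a) * v (x + b)).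
  have [K bK] := bp a b; rewrite -(Rintegral_shift c bK); congr Rintegral.
  by apply/funext => x; rewrite -!addrA (addrC c a) (addrC c b).
have ip a b : mu.-integrable setT (EFin \o (fun x => u (x + a) * v (x + b))).
  by have [K bK] := bp a b; exact: bsI bK.
have ipB a b c d : mu.-integrable setT (EFin \o (fun x => u (x + a) * v (x + b)
    - u (x + c) * v (x + d))).
  by have := @integrableB _ _ _ mu setT measurableT _ _ (ip a b) (ip c d); apply.
have EE a b : (fun x => dq a n u x * dq b n v x) =
   (fun x => (N * N) * ((u (x + n.+1%:R^-1 *: a) * v (x + n.+1%:R^-1 *: b)
             - u (x + n.+1%:R^-1 *: a) * v (x + 0))
             - (u (x + 0) * v (x + n.+1%:R^-1 *: b) - u (x + 0) * v (x + 0)))).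
  by apply/funext => x; rewrite /dq -/N !addr0; ring.
have IE a b : \I (fun x => dq a n u x * dq b n v x) =
  N * N * ((\I (fun x => u (x + n.+1%:R^-1 *: a) * v (x + n.+1%:R^-1 *: b))
    - \I (fun x => u (x + n.+1%:R^-1 *: a) * v (x + 0)))
    - (\I (fun x => u (x + 0) * v (x + n.+1%:R^-1 *: b))
       - \I (fun x => u (x + 0) * v (x + 0)))).
  rewrite EE RintegralZl//; last first.
    by have := @integrableB _ _ _ mu setT measurableT _ _ (ipB _ _ _ _) (ipB _ _ _ _); apply.
  by rewrite RintegralB// !RintegralB.
rewrite !IE !scalerN -/z -/z'; congr (_ * _).
rewrite -(E1 (- z) (- z') (z + z')) -(E1 (- z) 0 z) -(E1 0 (- z') z').
rewrite !addNr !add0r addKr [- z' + _]addrC addrK; ring.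
Qed.

(** Both signs are included because [dq_adjoint] and [dq_cross] reverse directions. *)
Definition coord_dir e := [\/ e = (1, 0), e = (0, 1), e = (-1, 0) | e = (0, -1)].

(* The bound on all difference quotients makes dominated convergence available:
   this is how the gradients of Lipschitz functions are handled here. *)
Definition has_aegrad u g :=
  (exists M, [/\ bounded_supp M u, bounded_supp M (fun x => (g x).1),
      bounded_supp M (fun x => (g x).2)
    & forall e n x, coord_dir e -> `|dq e n u x| <= M]) /\
  {ae mu, forall x, forall e, coord_dir e -> dq e n u x @[n --> \oo] --> dotp (g x) e}.

Lemma dq_supp e n M u x : coord_dir e -> bounded_supp M u -> M + 1 < `|x| -> dq e n u x = 0.
Proof.
move=> ce [_ _ u0] xM; rewrite /dq [u x]u0 ?[u (_ + _)]u0 ?subrr ?mul0r//; last by lra.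
have ze : `|n.+1%:R^-1 *: e| <= 1.
  rewrite normrZ ger0_norm ?invr_ge0//.
  have -> : `|e| = 1.
    by rewrite prod_normE; case: ce => -> /=; rewrite ?normrN normr1 normr0 ;
       [rewrite max_l|rewrite max_r|rewrite max_l|rewrite max_r]; rewrite ?ler01.
  by rewrite mulr1 invf_le1 ?ltr0n// ler1n.
have := lerB_normD x (n.+1%:R^-1 *: e); lra.
Qed.

Lemma bounded_supp_dq1 e n M u : coord_dir e -> bounded_supp M u ->
  (forall x, `|dq e n u x| <= M) -> bounded_supp (M + 1) (dq e n u).
Proof.
move=> ce bu dM; have [md _ _] := bounded_supp_dq e n bu.
split=> // x; first by apply: le_trans (dM x) _; rewrite lerDl.
by move=> xM; exact: dq_supp xM.
Qed.

Lemma coord_dirN e : coord_dir e -> coord_dir (- e).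
Proof.
by case=> ->; [apply: Or43|apply: Or44|apply: Or41|apply: Or42];
  apply/eqP; rewrite xpair_eqE /= ?opprK ?oppr0 !eqxx.
Qed.

Lemma dotpN x e : dotp x (- e) = - dotp x e.
Proof. by rewrite /dotp /=; ring. Qed.

Lemma measurable_dotp g e : measurable_plane setT (fun x => (g x).1) ->
  measurable_plane setT (fun x => (g x).2) -> measurable_plane setT (fun x => dotp (g x) e).
Proof.
move=> m1 m2; apply: measurable_realfun.measurable_funD;
  by apply: measurable_realfun.measurable_funM.
Qed.


Lemma bounded_supp_dotp M g e : coord_dir e -> bounded_supp M (fun x => (g x).1) ->
  bounded_supp M (fun x => (g x).2) -> bounded_supp M (fun x => dotp (g x) e).
Proof.
move=> ce [m1 b1 z1] [m2 b2 z2]; split; first exact: measurable_dotp.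
  move=> x; have {b1 b2}[b1 b2] := (b1 x, b2 x); rewrite /dotp.
  by case: ce => -> /=; rewrite ?mulr1 ?mulr0 ?addr0 ?add0r ?mulrN1 ?normrN.
by move=> x xM; rewrite /dotp z1 ?z2 // !mul0r addr0.
Qed.

(** Limit of [dq_adjoint] by dominated convergence. *)
Lemma aegrad_ibp u g v k e : coord_dir e -> has_aegrad u g -> has_aegrad v k ->
  \I (fun x => dotp (g x) e * v x) = - \I (fun x => u x * dotp (k x) e).
Proof.
move=> ce [[M [bu bg1 bg2 dM]] cu] [[N [bv bk1 bk2 dN]] cv].
have bge := bounded_supp_dotp ce bg1 bg2; have bke := bounded_supp_dotp ce bk1 bk2.
have [mu' uM u0] := bu; have [mv vN v0] := bv.
have [mge _ _] := bge; have [mke keN _] := bke.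
pose L := Num.max M N; have bu' : bounded_supp L u by apply: bounded_suppW bu; rewrite le_max lexx.
have bv' : bounded_supp L v by apply: bounded_suppW bv; rewrite le_max lexx orbT.
have c1 : \I (fun x => dq e n u x * v x) @[n --> \oo] --> \I (fun x => dotp (g x) e * v x).
  apply: Rintegral_cvg => [n||].
  - by apply: (bounded_suppM (bounded_supp_dq1 ce bu _) mv vN) => x; exact: dM.
  - by apply: measurable_realfun.measurable_funM.
  - by apply: ae_imply cu => x cx; apply: cvgM; [exact: cx|exact: cvg_cst].
have c2 : \I (fun x => u x * dq (- e) n v x) @[n --> \oo] --> \I (fun x => u x * - dotp (k x) e).
  apply: (@Rintegral_cvg (Num.max M (M * N))) => [n||].
  - have [md _ _] := bounded_supp_dq (- e) n bv.
    by apply: (bounded_suppM bu md) => x; apply: dN; exact: coord_dirN.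
  - apply: measurable_realfun.measurable_funM => //.
    exact: measurableT_comp.
  - apply: ae_imply cv => x cx; apply: cvgM; first exact: cvg_cst.
    by rewrite -dotpN; apply: cx; exact: coord_dirN.
have -> : \I (fun x => dotp (g x) e * v x) = \I (fun x => u x * - dotp (k x) e).
  apply: (cvg_unique _ c1) => //.
  rewrite (_ : (fun n => _) = (fun n => \I (fun x => u x * dq (- e) n v x)))//.
  by apply/funext => n; exact: dq_adjoint bu' bv'.
under eq_Rintegral do rewrite mulrN -mulN1r.
by rewrite RintegralZl ?mulN1r//; exact: bsI (bounded_suppM bu mke keN).
Qed.

(* Integration by parts twice turns the left side into the right one; the
   difference quotients do both steps at once, with no second derivatives. *)
Lemma aegrad_curl u g v k : has_aegrad u g -> has_aegrad v k ->
  \I (fun x => (g x).2 * (k x).1) = \I (fun x => (g x).1 * (k x).2).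
Proof.
move=> [[M [bu bg1 bg2 dM]] cu] [[N [bv bk1 bk2 dN]] cv].
have [mg1 _ _] := bg1; have [mg2 _ _] := bg2; have [mk1 _ _] := bk1; have [mk2 _ _] := bk2.
have ce1 : coord_dir ((1, 0) : plane R) by exact: Or41.
have ce2 : coord_dir ((0, 1) : plane R) by exact: Or42.
pose L := Num.max M N; have bu' : bounded_supp L u by apply: bounded_suppW bu; rewrite le_max lexx.
have bv' : bounded_supp L v by apply: bounded_suppW bv; rewrite le_max lexx orbT.
have cc a b : coord_dir a -> coord_dir b -> 
   \I (fun x => dq a n u x * dq b n v x) @[n --> \oo] --> \I (fun x => dotp (g x) a * dotp (k x) b).
  move=> ca cb; apply: Rintegral_cvg => [n||].
  - have [md _ _] := bounded_supp_dq b n bv.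
    by apply: (bounded_suppM (bounded_supp_dq1 ca bu _) md) => x; [exact: dM|exact: dN].
  - by apply: measurable_realfun.measurable_funM; exact: measurable_dotp.
  - by apply: ae_imply (ae_and cu cv) => x [cux cvx]; apply: cvgM; [exact: cux|exact: cvx].
transitivity (\I (fun x => dotp (g x) (0, 1) * dotp (k x) (1, 0))).
  by congr Rintegral; apply/funext => x; rewrite /dotp /=; ring.
transitivity (\I (fun x => dotp (g x) (- (1, 0)) * dotp (k x) (- (0, 1)))).
  apply: (cvg_unique _ (cc _ _ ce2 ce1)) => //.
  rewrite (_ : (fun n => _) =
     (fun n => \I (fun x => dq (- (1, 0)) n u x * dq (- (0, 1)) n v x))).
    by apply: cc; exact: coord_dirN.
  by apply/funext => n; exact: dq_cross bu' bv'.
by congr Rintegral; apply/funext => x; rewrite /dotp /=; ring.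
Qed.

End DiffQuot.

(** * Weak gradients *)

Section WeakGrad.
Variable R : realType.
Implicit Types (U Omega : set (plane R)) (x y z e : plane R) (u v w f phi : plane R -> R)
  (g k : plane R -> plane R) (n : nat) (M : R).
Let mu := leb2 R.

Lemma is_derive_lip (F F' : R -> R) M : (forall t : R, is_derive t 1 F (F' t)) ->
  (forall t, `|F' t| <= M) -> forall a b, `|F b - F a| <= M * `|b - a|.
Proof.
move=> dF bF.
have H a b : a < b -> `|F b - F a| <= M * `|b - a|.
  move=> ab; have [|c _ ->] := @MVT R F F' a b ab (fun t _ => dF t).
    by apply: continuous_subspaceT => t; exact: is_derive_cont (dF t).
  by rewrite normrM ler_wpM2r.
move=> a b; have [ab|ba|->] := ltgtP a b; first exact: H.
  by rewrite distrC (distrC b); exact: H.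
by rewrite !subrr normr0 mulr0.
Qed.

Lemma cvg_seq_derive (F : R -> R) (t d s : R) : s != 0 -> is_derive t 1 F d ->
  (F (t + n.+1%:R^-1 * s) - F t) * n.+1%:R @[n --> \oo] --> d * s.
Proof.
move=> s0 [dF <-].
have c1 : h^-1 *: ((F \o shift t) (h *: (1 : R)) - F t) @[h --> 0^'] --> 'D_1 F t := dF.
have cn : (n.+1%:R^-1 * s : R) @[n --> \oo] --> (0 : R)^'.
  have c0 : (n.+1%:R^-1 * s : R) @[n --> \oo] --> (0 : R).
    by rewrite -(mul0r s); apply: cvgM; [exact: cvg_harmonic|exact: cvg_cst].
  move=> A hA.
  have h : \forall n \near \oo, ((n.+1%:R^-1 * s : R) != 0 -> A (n.+1%:R^-1 * s)) := c0 _ hA.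
  suff : \forall n \near \oo, A (n.+1%:R^-1 * s) by [].
  by apply: filterS h => n; apply; rewrite mulf_neq0// invr_eq0 pnatr_eq0.
rewrite (_ : (fun n => _) = (fun n : nat =>
  ((n.+1%:R^-1 * s)^-1 *: ((F \o shift t) ((n.+1%:R^-1 * s) *: (1 : R)) - F t)) * s)).
  by apply: cvgM; [exact: (cvg_comp _ _ cn c1)|exact: cvg_cst].
apply/funext => n /=.
rewrite /GRing.scale /= mulr1 invfM invrK (addrC t).
by field; rewrite s0.
Qed.

Lemma test_fun_supp Omega phi : test_fun Omega phi -> exists K M,
  [/\ compact K, K `<=` Omega, forall x, K x -> `|x| <= M & forall x, ~ K x ->
    [/\ phi x = 0, 'D_(1, 0) phi x = 0 & 'D_(0, 1) phi x = 0]].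
Proof.
move=> [sphi cK KO]; pose K := closure [set x | phi x != 0].
have [M [_ hM]] := compact_bounded cK.
exists K, (M + 1); split => //; first by move=> x; apply: hM; rewrite ltrDl ltr01.
have oK : open (~` K) by apply: closed_openC; exact: closed_closure.
have near0 x : ~ K x -> \near x, phi x = (fun=> 0) x.
  move=> Kx; have : nbhs x (~` K) by apply: open_nbhs_nbhs.
  by apply: filterS => y Ky; exact: supp0.
move=> x Kx; split; first exact: supp0.
  by rewrite (near_eq_derive _ (near0 x Kx)) derive_cst.
by rewrite (near_eq_derive _ (near0 x Kx)) derive_cst.
Qed.

Lemma test_fun_derive Omega phi : test_fun Omega phi ->
  [/\ continuous (fun x => 'D_(1, 0) phi x), continuous (fun x => 'D_(0, 1) phi x),
      forall x, is_derive x.1 1 (fun t => phi (t, x.2)) ('D_(1, 0) phi x)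
    & forall x, is_derive x.2 1 (fun t => phi (x.1, t)) ('D_(0, 1) phi x)].
Proof.
move=> [/(_ 1%N)[_ [d1 d2] c1 c2] _ _]; split; [exact: c1|exact: c2|move=> x|move=> x].
  by split; [rewrite -derivable10E|rewrite -derive10E].
by split; [rewrite -derivable01E|rewrite -derive01E].
Qed.

Lemma cont_supp_bounded (K : set (plane R)) M f : compact K ->
  (forall x, K x -> `|x| <= M) -> continuous f -> (forall x, ~ K x -> f x = 0) ->
  exists N, forall L, N <= L -> bounded_supp L f.
Proof.
move=> cK KM cf f0; have [N N0 fN] := cont_bounded cK cf.
exists (Num.max N M) => L; rewrite ge_max => /andP[NL ML]; split.
- exact: continuous_measurable_plane.
- move=> x; have [Kx|Kx] := pselect (K x); first exact: le_trans (fN x Kx) NL.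
  by rewrite f0// normr0 (le_trans _ NL)// ltW.
- move=> x Lx; apply: f0 => /KM xM; have := lt_le_trans Lx xM; lra.
Qed.

(** The mean value theorem along the axes bounds the difference quotients by the bounds of the
    partial derivatives. *)
Lemma test_fun_aegrad Omega phi : test_fun Omega phi ->
  has_aegrad phi (fun x => ('D_(1, 0) phi x, 'D_(0, 1) phi x)).
Proof.
move=> tphi; have [K [M [cK KO KM K0]]] := test_fun_supp tphi.
have [c1 c2 d1 d2] := test_fun_derive tphi.
have [N hN] := cont_supp_bounded cK KM (test_fun_cont tphi)
  (fun x Kx => let: And3 a _ _ := K0 x Kx in a).
have [N1 hN1] := cont_supp_bounded cK KM c1 (fun x Kx => let: And3 _ a _ := K0 x Kx in a).
have [N2 hN2] := cont_supp_bounded cK KM c2 (fun x Kx => let: And3 _ _ a := K0 x Kx in a).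
pose L := Num.max N (Num.max N1 N2).
have b0 : bounded_supp L phi by apply: hN; rewrite le_max lexx.
have b1 : bounded_supp L (fun x => 'D_(1, 0) phi x).
  by apply: hN1; rewrite !le_max lexx orbT.
have b2 : bounded_supp L (fun x => 'D_(0, 1) phi x).
  by apply: hN2; rewrite !le_max lexx !orbT.
have pe1 (x1 x2 s : R) : (x1, x2) + (s, 0) = (x1 + s, x2) :> plane R.
  by apply/eqP; rewrite xpair_eqE /= addr0 !eqxx.
have pe2 (x1 x2 s : R) : (x1, x2) + (0, s) = (x1, x2 + s) :> plane R.
  by apply/eqP; rewrite xpair_eqE /= addr0 !eqxx.
have L1 x s : `|phi (x + (s, 0)) - phi x| <= L * `|s|.
  case: x => x1 x2.
  have := @is_derive_lip (fun t => phi (t, x2)) (fun t => 'D_(1, 0) phi (t, x2)) L.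
  have [_ bL _] := b1.
  move=> /(_ (fun t => d1 (t, x2)) (fun t => bL (t, x2)) x1 (x1 + s)).
  have -> : x1 + s - x1 = s by ring.
  by apply: le_trans; rewrite /= pe1.
have L2 x s : `|phi (x + (0, s)) - phi x| <= L * `|s|.
  case: x => x1 x2.
  have := @is_derive_lip (fun t => phi (x1, t)) (fun t => 'D_(0, 1) phi (x1, t)) L.
  have [_ bL _] := b2.
  move=> /(_ (fun t => d2 (x1, t)) (fun t => bL (x1, t)) x2 (x2 + s)).
  have -> : x2 + s - x2 = s by ring.
  by apply: le_trans; rewrite /= pe2.
have se (s t : R) n : n.+1%:R^-1 *: ((s, t) : plane R) = (n.+1%:R^-1 * s, n.+1%:R^-1 * t).
  by [].
split.
  exists L; split => //.
  move=> e n x ce; rewrite /dq normrM normr_nat -ler_pdivlMr ?ltr0n//.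
  have nn : `|n.+1%:R^-1 : R| = n.+1%:R^-1 by rewrite ger0_norm// invr_ge0.
  by case: ce => ->; rewrite se mulr0 ?mulr1 ?mulrN1;
     [have := L1 x (n.+1%:R^-1)|have := L2 x (n.+1%:R^-1)
     |have := L1 x (- n.+1%:R^-1)|have := L2 x (- n.+1%:R^-1)]; rewrite ?normrN nn.
apply: ae_all => -[x1 x2] e ce; rewrite /dq /dotp /=.
have A1 s : s != 0 -> (phi ((x1, x2) + n.+1%:R^-1 *: (s, 0)) - phi (x1, x2)) * n.+1%:R @[n --> \oo]
    --> 'D_(1, 0) phi (x1, x2) * s.
  move=> s0; rewrite (_ : (fun n => _) = (fun n : nat =>
     (phi (x1 + n.+1%:R^-1 * s, x2) - phi (x1, x2)) * n.+1%:R)).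
    exact: (cvg_seq_derive s0 (d1 (x1, x2))).
  by apply/funext => n; rewrite se mulr0 pe1.
have A2 s : s != 0 -> (phi ((x1, x2) + n.+1%:R^-1 *: (0, s)) - phi (x1, x2)) * n.+1%:R @[n --> \oo]
    --> 'D_(0, 1) phi (x1, x2) * s.
  move=> s0; rewrite (_ : (fun n => _) = (fun n : nat =>
     (phi (x1, x2 + n.+1%:R^-1 * s) - phi (x1, x2)) * n.+1%:R)).
    exact: (cvg_seq_derive s0 (d2 (x1, x2))).
  by apply/funext => n; rewrite se mulr0 pe2.
by case: ce => -> /=; rewrite mulr0 ?addr0 ?add0r; [apply: A1|apply: A2|apply: A1|apply: A2];
   rewrite ?oppr_eq0 oner_eq0.
Qed.

Lemma bounded_supp_loc_integrable Omega M f v : open Omega -> bounded_supp M f ->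
  (forall x, Omega x -> v x = f x) -> loc_integrable Omega v.
Proof.
move=> oO bf vf K cK KO; have mK := compact_measurable_plane cK.
apply: (eq_integrable mK (EFin \o f)).
  by move=> x; rewrite inE => /KO /vf /= ->.
by apply: integrableS (integrable_bounded_supp bf).
Qed.

(** The function v is free outside [Omega]: u is typically the extension by 0 of a finite element
    function v, whose values off the closure are arbitrary. *)
Lemma aegrad_weak_grad Omega u g v : open Omega -> has_aegrad u g ->
  (forall x, Omega x -> v x = u x) -> weak_grad Omega v g.
Proof.
move=> oO ug vu; have [[M [bu b1 b2 _]] _] := ug.
have lu := bounded_supp_loc_integrable oO bu (fun x _ => erefl).
have l1 := bounded_supp_loc_integrable oO b1 (fun x _ => erefl).
have l2 := bounded_supp_loc_integrable oO b2 (fun x _ => erefl).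
split => //; first exact: (bounded_supp_loc_integrable oO bu vu).
move=> phi tphi; have tg := test_fun_aegrad tphi.
have [K [N [cK KO KM K0]]] := test_fun_supp tphi.
have [c1 c2 _ _] := test_fun_derive tphi.
have key (c : plane R -> R) (D : plane R -> R) : loc_integrable Omega c -> continuous D ->
    (forall x, ~ K x -> D x = 0) ->
    Rintegral mu setT (fun x => u x * D x) = - Rintegral mu setT (fun x => c x * phi x) ->
   (\int[mu]_(x in Omega) (v x * D x)%:E = - \int[mu]_(x in Omega) (c x * phi x)%:E)%E.
  move=> lc cD D0 I.
  have p0 x : ~ K x -> phi x = 0 by move=> /K0[].
  have [i1 [_ e1]] := loc_integrable_mul oO cK KO lu cD D0.
  have [i2 [_ e2]] := loc_integrable_mul oO cK KO lc (test_fun_cont tphi) p0.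
  rewrite [X in (- X)%E]e2.
  have -> : (\int[mu]_(x in Omega) (v x * D x)%:E = \int[mu]_(x in Omega) (u x * D x)%:E)%E.
    by apply: eq_integral => x; rewrite inE => /vu ->.
  rewrite e1.
  have f1 := integrable_fin_num measurableT i1.
  have f2 := integrable_fin_num measurableT i2.
  by rewrite -(fineK f1) -(fineK f2) -EFinN; congr EFin.
have e1 : coord_dir ((1, 0) : plane R) by exact: Or41.
have e2 : coord_dir ((0, 1) : plane R) by exact: Or42.
have := aegrad_ibp e1 ug tg; have := aegrad_ibp e2 ug tg.
rewrite /dotp /= => I2 I1.
split; [apply: (key _ _ l1 c1)|apply: (key _ _ l2 c2)].
- by move=> x /K0[].
- apply: oppr_inj; rewrite opprK.
  transitivity (- Rintegral mu setT (fun x => u x * ('D_(1, 0) phi x * 1 + 'D_(0, 1) phi x * 0))).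
    by congr (- _); congr Rintegral; apply/funext => x; ring.
  by rewrite -I1; congr Rintegral; apply/funext => x; ring.
- by move=> x /K0[].
- apply: oppr_inj; rewrite opprK.
  transitivity (- Rintegral mu setT (fun x => u x * ('D_(1, 0) phi x * 0 + 'D_(0, 1) phi x * 1))).
    by congr (- _); congr Rintegral; apply/funext => x; ring.
  by rewrite -I2; congr Rintegral; apply/funext => x; ring.
Qed.

Lemma loc_integrableD Omega a u v : loc_integrable Omega u -> loc_integrable Omega v ->
  loc_integrable Omega (fun x => a * u x + v x).
Proof.
move=> lu lv K cK KO; have mK := compact_measurable_plane cK.
have := integrableD mK (integrableZl mK a (lu K cK KO)) (lv K cK KO).
by apply: eq_integrable.
Qed.

Lemma weak_gradD Omega a u v g k : open Omega -> weak_grad Omega u g -> weak_grad Omega v k ->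
  weak_grad Omega (fun x => a * u x + v x) (fun x => a *: g x + k x).
Proof.
move=> oO [lu l1 l2 hu] [lv k1 k2 hv]; split; [exact: loc_integrableD..|].
move=> phi tphi; have [K [N [cK KO KM K0]]] := test_fun_supp tphi.
have [c1 c2 _ _] := test_fun_derive tphi.
have mO := open_measurable_plane oO.
have lin (p q D : plane R -> R) : loc_integrable Omega p -> loc_integrable Omega q ->
   continuous D -> (forall x, ~ K x -> D x = 0) ->
   (\int[mu]_(x in Omega) ((a * p x + q x) * D x)%:E =
     a%:E * \int[mu]_(x in Omega) (p x * D x)%:E + \int[mu]_(x in Omega) (q x * D x)%:E)%E /\
     exists r s : R, ((\int[mu]_(x in Omega) (p x * D x)%:E = r%:E) /\
        (\int[mu]_(x in Omega) (q x * D x)%:E = s%:E))%E.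
  move=> lp lq cD D0.
  have [_ [i1 _]] := loc_integrable_mul oO cK KO lp cD D0.
  have [_ [i2 _]] := loc_integrable_mul oO cK KO lq cD D0.
  split; last first.
    exists (fine (\int[mu]_(x in Omega) (p x * D x)%:E)%E), (fine (\int[mu]_(x in Omega) (q x * D x)%:E)%E).
    have f1 := integrable_fin_num mO i1; have f2 := integrable_fin_num mO i2.
    by rewrite !fineK.
  rewrite -integralZl// -integralD//; last exact: integrableZl.
  by apply: eq_integral => x _; rewrite -EFinM -EFinD; congr EFin; ring.
have p0 x : ~ K x -> phi x = 0 by move=> /K0[].
have d10 x : ~ K x -> 'D_(1, 0) phi x = 0 by move=> /K0[].
have d20 x : ~ K x -> 'D_(0, 1) phi x = 0 by move=> /K0[].
have cp := test_fun_cont tphi.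
have [hu1 hu2] := hu phi tphi; have [hv1 hv2] := hv phi tphi.
split.
- have [-> _] := lin u v _ lu lv c1 d10.
  have [-> [r [s [rE sE]]]] := lin _ _ _ l1 k1 cp p0.
  rewrite hu1 hv1 rE sE.
  by apply: (congr1 EFin (x := a * - r - s) (y := - (a * r + s))); ring.
- have [-> _] := lin u v _ lu lv c2 d20.
  have [-> [r [s [rE sE]]]] := lin _ _ _ l2 k2 cp p0.
  rewrite hu2 hv2 rE sE.
  by apply: (congr1 EFin (x := a * - r - s) (y := - (a * r + s))); ring.
Qed.

(** The difference vanishes on [Omega], so its weak gradient integrates to 0 against every test
    function. *)
Lemma weak_grad_unique Omega u v g k : open Omega -> weak_grad Omega u g ->
  weak_grad Omega v k -> (forall x, Omega x -> u x = v x) ->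
  {ae mu, forall x, Omega x -> g x = k x}.
Proof.
move=> oO wu wv uv.
have [lw w1 w2 hw] := weak_gradD (-1) oO wu wv.
have Z : {ae mu, forall x, (Omega x -> (-1 *: g x + k x).1 = 0) /\
                         (Omega x -> (-1 *: g x + k x).2 = 0)}.
  apply: ae_and; apply: (fundamental_lemma oO) => // phi tphi.
    have [h _] := hw phi tphi; apply: oppe_inj; rewrite oppe0 -h.
    by rewrite integral0_eq// => x /uv ->; rewrite mulN1r addNr mul0r.
  have [_ h] := hw phi tphi; apply: oppe_inj; rewrite oppe0 -h.
  by rewrite integral0_eq// => x /uv ->; rewrite mulN1r addNr mul0r.
apply: ae_imply Z => x [h1 h2] Ox; move: (h1 Ox) (h2 Ox); case: (g x) (k x) => a b [c d] /=.
by rewrite /GRing.scale /= !mulN1r => e1 e2; congr pair; lra.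
Qed.

Lemma weak_grad_grad Omega u g : weak_grad Omega u g -> weak_grad Omega u (grad Omega u).
Proof. by move=> wg; rewrite /grad; exact: (xgetPex _ (ex_intro _ g wg)). Qed.

Lemma gradP Omega u g : open Omega -> weak_grad Omega u g ->
  {ae mu, forall x, Omega x -> grad Omega u x = g x}.
Proof.
by move=> oO wg; apply: weak_grad_unique (weak_grad_grad wg) wg _.
Qed.

End WeakGrad.

(** * Triangles and finite element functions *)

Section Triangles.
Variable R : realType.
Implicit Types (T Omega : set (plane R)) (x y z e a b c : plane R) (u v w f : plane R -> R)
  (g k : plane R -> plane R) (n : nat) (M L : R).
Let mu := leb2 R.

(** Twice the signed area of the triangle, the quantity that [is_triangle] requires to be nonzero;
    the barycentric coordinates are ratios of such areas. *)
Definition orient a b c : R := (b.1 - a.1) * (c.2 - a.2) - (b.2 - a.2) * (c.1 - a.1).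

Definition bary1 a b c x := orient x b c / orient a b c.
Definition bary2 a b c x := orient a x c / orient a b c.
Definition bary3 a b c x := orient a b x / orient a b c.

Lemma bary_sum a b c x : orient a b c != 0 ->
  bary1 a b c x + bary2 a b c x + bary3 a b c x = 1.
Proof. by rewrite /bary1 /bary2 /bary3 /orient => D; field. Qed.

Lemma bary_decomp a b c x : orient a b c != 0 ->
  x = bary1 a b c x *: a + bary2 a b c x *: b + bary3 a b c x *: c.
Proof.
case: a b c x => a1 a2 [b1 b2] [c1 c2] [x1 x2].
rewrite /bary1 /bary2 /bary3 /orient /= => D; apply/eqP; rewrite xpair_eqE /=.
by rewrite /GRing.scale /=; apply/andP; split; apply/eqP; field.
Qed.

Lemma bary_comb a b c (r s t : R) : orient a b c != 0 -> r + s + t = 1 ->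
  let x := r *: a + s *: b + t *: c in
  [/\ bary1 a b c x = r, bary2 a b c x = s & bary3 a b c x = t].
Proof.
move=> D rst; have -> : r = 1 - s - t by rewrite -rst; ring.
move: D; case: a b c => a1 a2 [b1 b2] [c1 c2].
rewrite /bary1 /bary2 /bary3 /orient /= /GRing.scale /= => D.
by split; field.
Qed.

Lemma hull3P a b c x : orient a b c != 0 -> hull3 a b c x <->
  [/\ 0 <= bary1 a b c x, 0 <= bary2 a b c x & 0 <= bary3 a b c x].
Proof.
move=> D; split=> [[r [s [t [r0 s0 t0 rst ->]]]]|[r0 s0 t0]].
  by have [-> -> ->] := bary_comb D rst.
exists (bary1 a b c x), (bary2 a b c x), (bary3 a b c x); split => //.
  exact: bary_sum.
exact: bary_decomp.
Qed.

Lemma cont_affine (p q r : R) : continuous (fun x : plane R => p + q * x.1 + r * x.2).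
Proof.
move=> x; apply: cvgD; last by apply: cvgM; [exact: cvg_cst|exact: cvg_snd].
by apply: cvgD; [exact: cvg_cst|apply: cvgM; [exact: cvg_cst|exact: cvg_fst]].
Qed.

Lemma bary_affine a b c : orient a b c != 0 -> exists p q r : R * (R * R),
  [/\ forall x, bary1 a b c x = p.1 + p.2.1 * x.1 + p.2.2 * x.2,
      forall x, bary2 a b c x = q.1 + q.2.1 * x.1 + q.2.2 * x.2,
      forall x, bary3 a b c x = r.1 + r.2.1 * x.1 + r.2.2 * x.2
    & [/\ (p.2.1 != 0) || (p.2.2 != 0), (q.2.1 != 0) || (q.2.2 != 0)
        & (r.2.1 != 0) || (r.2.2 != 0)]].
Proof.
move=> D; have D' := D.
exists ((b.1 * c.2 - b.2 * c.1) / orient a b c,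
        ((b.2 - c.2) / orient a b c, (c.1 - b.1) / orient a b c)).
exists ((c.1 * a.2 - c.2 * a.1) / orient a b c,
        ((c.2 - a.2) / orient a b c, (a.1 - c.1) / orient a b c)).
exists ((a.1 * b.2 - a.2 * b.1) / orient a b c,
        ((a.2 - b.2) / orient a b c, (b.1 - a.1) / orient a b c)).
split; try by move=> x; rewrite /bary1 /bary2 /bary3 /=; move: D'; rewrite /orient => D'; field.
have nz (p q : R) : (p == 0 -> q == 0 -> orient a b c = 0) ->
     (p / orient a b c != 0) || (q / orient a b c != 0).
  move=> h; rewrite -negb_and; apply/negP => /andP[]; rewrite !mulf_eq0 !invr_eq0 (negbTE D) !orbF.
  by move=> p0 q0; move: D; rewrite (h p0 q0) eqxx.
split; apply: nz => /eqP p0 /eqP q0; rewrite /orient.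
- have -> : c.1 = b.1 by lra. have -> : c.2 = b.2 by lra. ring.
- have -> : c.1 = a.1 by lra. have -> : c.2 = a.2 by lra. ring.
- have -> : b.1 = a.1 by lra. have -> : b.2 = a.2 by lra. ring.
Qed.

Lemma triangle_closed T : triangle T -> closed T.
Proof.
move=> [a [b [c [D ->]]]]; have [p [q [r [hp hq hr _]]]] := bary_affine D.
have -> : hull3 a b c = [set x | 0 <= p.1 + p.2.1 * x.1 + p.2.2 * x.2] `&`
   [set x | 0 <= q.1 + q.2.1 * x.1 + q.2.2 * x.2] `&`
   [set x | 0 <= r.1 + r.2.1 * x.1 + r.2.2 * x.2].
  apply/seteqP; split=> x /=.
    by move=> /(hull3P _ D); rewrite hp hq hr => -[].
  by move=> [[h1 h2] h3]; apply/(hull3P _ D); rewrite hp hq hr.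
have cl (m : R * (R * R)) : closed [set x : plane R | 0 <= m.1 + m.2.1 * x.1 + m.2.2 * x.2].
  apply: (closed_comp (f := fun x : plane R => m.1 + m.2.1 * x.1 + m.2.2 * x.2)
     (D := [set t | 0 <= t])); last exact: closed_ge.
  by move=> x _; exact: cont_affine.
by apply: closedI => //; apply: closedI.
Qed.

(** Points with three positive barycentric coordinates are interior, the centroid among them; the
    other points of T lie on three lines, which are null sets. *)
Lemma triangle_interior T : triangle T ->
  [/\ T° !=set0 & mu.-negligible (T `\` T°)].
Proof.
move=> [a [b [c [D ->]]]]; have [p [q [r [hp hq hr [np nq nr]]]]] := bary_affine D.
pose U := [set x : plane R | 0 < p.1 + p.2.1 * x.1 + p.2.2 * x.2] `&`
   [set x | 0 < q.1 + q.2.1 * x.1 + q.2.2 * x.2] `&`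
   [set x | 0 < r.1 + r.2.1 * x.1 + r.2.2 * x.2].
have oU : open U.
  have op (m : R * (R * R)) : open [set x : plane R | 0 < m.1 + m.2.1 * x.1 + m.2.2 * x.2].
    apply: (open_comp (f := fun x : plane R => m.1 + m.2.1 * x.1 + m.2.2 * x.2)
     (D := [set t | 0 < t])); last exact: open_gt.
    by move=> x _; exact: cont_affine.
  by apply: openI => //; apply: openI.
have UT : U `<=` (hull3 a b c)°.
  rewrite -(open_subsetE _ oU) => x [[/= h1 h2] h3]; apply/(hull3P _ D).
  by rewrite hp hq hr !ltW.
split.
  have s3 : 3%:R^-1 + 3%:R^-1 + 3%:R^-1 = 1 :> R by field.
  have [z [e1 e2 e3]] : exists z, [/\ bary1 a b c z = 3%:R^-1, bary2 a b c z = 3%:R^-1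
      & bary3 a b c z = 3%:R^-1] by eexists; exact: (bary_comb D s3).
  exists z; apply: UT.
  by split; [split|]; rewrite /mkset -?hp -?hq -?hr ?e1 ?e2 ?e3 invr_gt0.
have ln (m : R * (R * R)) : (m.2.1 != 0) || (m.2.2 != 0) ->
    mu.-negligible [set x : plane R | m.2.1 * x.1 + m.2.2 * x.2 = - m.1].
  move=> nm; exists [set x : plane R | m.2.1 * x.1 + m.2.2 * x.2 = - m.1].
  by split => //; [exact: measurable_line|exact: leb2_line].
apply: (negligibleS _ (negligibleU (ln p np) (negligibleU (ln q nq) (ln r nr)))).
move=> x [/(hull3P _ D)[+ + +] nx]; rewrite hp hq hr.
rewrite !le_eqVlt => /orP[/eqP h|h1]; first by left => /=; lra.
move=> /orP[/eqP h|h2]; first by right; left => /=; lra.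
move=> /orP[/eqP h|h3]; first by right; right => /=; lra.
by exfalso; apply: nx; apply: UT.
Qed.

(** Continuity induction: the supremum of the t with |F t - F 0| <= L t satisfies this bound itself,
    and the local estimate around it would go further if it were less than 1. *)
Lemma lip_segment (F : R -> R) L : 
  (forall s, 0 <= s <= 1 -> exists2 d, 0 < d & forall t, 0 <= t <= 1 -> `|t - s| < d ->
      `|F t - F s| <= L * `|t - s|) -> `|F 1 - F 0| <= L.
Proof.
move=> hF; pose S := [set t : R | 0 <= t <= 1 /\ `|F t - F 0| <= L * t].
have S0 : S 0 by split; [rewrite lexx ler01|rewrite subrr normr0 mulr0].
have hS : has_sup S.
  by split; [exists 0|exists 1 => t [/andP[]]].
have sS1 : sup S <= 1 by apply: ge_sup; [exists 0|move=> t [/andP[]]].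
have sS0 : 0 <= sup S by apply: ub_le_sup => //; exists 1 => t [/andP[]].
have s01 : 0 <= sup S <= 1 by rewrite sS0 sS1.
have [d d0 hd] := hF _ s01.
have Ssup : S (sup S).
  split; rewrite ?s01//.
  have [t St tS] := sup_adherent d0 hS.
  have tle : t <= sup S by apply: ub_le_sup => //; exists 1 => r [/andP[]].
  have [t01 Ft] := St.
  have ab : `|t - sup S| = sup S - t by rewrite distrC ger0_norm// subr_ge0.
  have := hd t t01; rewrite ab => /(_ _)/wrap[]; first by lra.
  move=> Fs; rewrite -(subrKA (F t)) (le_trans (ler_normD _ _))// distrC.
  by rewrite (_ : L * sup S = L * (sup S - t) + L * t) ?lerD//; ring.
have [s1|s1] := ltP (sup S) 1; last first.
  by have [_] := Ssup; rewrite (_ : sup S = 1) ?mulr1//; apply/le_anti; rewrite sS1.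
pose t := Num.min (sup S + d / 2) 1.
have ts : sup S < t by rewrite lt_min s1 andbT; lra.
have t1 : t <= 1 by rewrite ge_min lexx orbT.
have td : t <= sup S + d / 2 by rewrite ge_min lexx.
have St : S t.
  split; first by rewrite t1 andbT; lra.
  have ab : `|t - sup S| = t - sup S by rewrite ger0_norm// subr_ge0 ltW.
  have := hd t; rewrite ab => /(_ _ _)/wrap[]; [by rewrite t1 andbT; lra|by lra|].
  move=> Fs; have [_ Fs'] := Ssup.
  rewrite -(subrKA (F (sup S))) (le_trans (ler_normD _ _))//.
  by rewrite (_ : L * t = L * (t - sup S) + L * sup S) ?lerD//; ring.
have : t <= sup S by apply: ub_le_sup => //; exists 1 => r [/andP[]].
by rewrite leNgt ts.
Qed.

End Triangles.

(** * Piecewise affine functions and their gradients *)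

Section PiecewiseAffine.
Variable R : realType.
Implicit Types (T Omega : set (plane R)) (x y z e : plane R) (u v w f : plane R -> R)
  (g k : plane R -> plane R) (n : nat) (M L : R) (Tau : set (set (plane R))).
Let mu := leb2 R.

Lemma finite_bound (X : choiceType) (A : set X) (F : X -> R) : finite_set A ->
  exists2 M : R, 0 <= M & forall i, A i -> F i <= M.
Proof.
move=> /finite_seqP[s ->]; elim: s => [|a s [M M0 IH]]; first by exists 0.
exists (Num.max M (F a)); first by rewrite le_max M0.
move=> i /=; rewrite inE => /orP[/eqP ->|xs]; first by rewrite le_max lexx orbT.
by rewrite le_max IH.
Qed.

Definition affine (p : R * plane R) x := p.1 + dotp p.2 x.

Lemma affineB p x y : affine p x - affine p y = dotp p.2 (x - y).
Proof. by rewrite /affine /dotp /=; ring. Qed.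

Lemma norm_dotp x y : `|dotp x y| <= (`|x.1| + `|x.2|) * `|y|.
Proof.
have h : `|y| <= `|y| by []. move: h; rewrite {1}normp_le => /andP[h1 h2].
rewrite /dotp (le_trans (ler_normD _ _))// !normrM mulrDl.
by apply: lerD; apply: ler_wpM2l.
Qed.

Lemma triangulation_closed Omega Tau T : triangulation Omega Tau -> Tau T -> closed T.
Proof. by move=> [_ tri _] /tri; exact: triangle_closed. Qed.

Lemma triangulation_sub Omega Tau T : triangulation Omega Tau -> Tau T -> T `<=` closure Omega.
Proof. by move=> [_ _ ->] TT x Tx; exists T. Qed.

Lemma triangulation_cover Omega Tau x : triangulation Omega Tau -> closure Omega x ->
  exists2 T, Tau T & T x.
Proof. by move=> [_ _ ->] [T TT Tx]; exists T. Qed.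

(** The triangles are finitely many and closed, so those that miss x miss a whole ball around it. *)
Lemma triangulation_near Omega Tau x : triangulation Omega Tau -> 
  exists2 d, 0 < d & forall y, `|y - x| < d -> forall T, Tau T -> T y -> T x.
Proof.
move=> tri; have [fT tT _] := tri; case/finite_seqP: fT => s sE.
have {}tT T : T \in s -> closed T.
  by move=> Ts; apply: (triangulation_closed tri); rewrite sE.
suff [d d0 hd] : exists2 d, 0 < d & forall y, `|y - x| < d -> forall T, T \in s -> T y -> T x.
  by exists d => // y yx T; rewrite sE; exact: hd.
elim: s {sE} tT => [|T s IH] cl; first by exists 1.
have [|d d0 hd] := IH; first by move=> T' T's; apply: cl; rewrite inE T's orbT.
have [Tx|nTx] := pselect (T x).
  by exists d => // y yx T'; rewrite inE => /orP[/eqP ->//|]; exact: hd.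
have oT : open (~` T) by apply: closed_openC; apply: cl; rewrite inE eqxx.
have [r r0 hr] := openP oT (nTx : (~` T) x).
exists (Num.min d r); first by rewrite lt_min d0.
move=> y; rewrite lt_min => /andP[yd yr] T'; rewrite inE => /orP[/eqP ->|].
  by move=> Ty; exfalso; exact: (hr y yr).
exact: hd.
Qed.

Lemma V1_coef Omega Tau v : V1 Omega Tau v -> exists c : set (plane R) -> R * plane R,
  forall T, Tau T -> forall x, T x -> v x = affine (c T) x.
Proof.
move=> [_ hv].
have /choice[c hc] : forall T, exists p : R * plane R, Tau T -> forall x, T x -> v x = affine p x.
  move=> T; have [TT|nT] := pselect (Tau T); last by exists (0, 0).
  have [a [b [d h]]] := hv T TT; exists (a, (b, d)) => _ x Tx.
  by rewrite (h x Tx) /affine /dotp /= addrA.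
by exists c.
Qed.

(** Around a point of the closure, every near point of the closure shares a triangle with it, and
    outside the closure the boundary value 0 continues v. [lip_segment] glues these local bounds
    along the segment from y to x. *)
Lemma V10_lip Omega Tau v c L : triangulation Omega Tau ->
  (forall x, frontier Omega x -> v x = 0) -> 0 <= L ->
  (forall T, Tau T -> forall x, T x -> v x = affine (c T) x) ->
  (forall T, Tau T -> `|(c T).2.1| + `|(c T).2.2| <= L) ->
  forall x y, `|(v \_ (closure Omega)) x - (v \_ (closure Omega)) y| <= L * `|x - y|.
Proof.
move=> tri v0 L0 hc hL x y; set vb := v \_ _.
have [_ _ cE] := tri.
have vbin z : closure Omega z -> vb z = v z by move=> h; rewrite /vb /patch mem_set.
have vbout z : ~ closure Omega z -> vb z = 0 by move=> h; rewrite /vb /patch memNset.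
have loc z0 : exists2 d, 0 < d & forall z, `|z - z0| < d -> `|vb z - vb z0| <= L * `|z - z0|.
  have [c0|nc0] := pselect (closure Omega z0); last first.
    have oC : open (~` closure Omega) by apply: closed_openC; exact: closed_closure.
    have [d d0 hd] := openP oC (nc0 : (~` closure Omega) z0).
    by exists d => // z zd; rewrite !vbout//; [rewrite subrr normr0 mulr_ge0|exact: hd].
  have [d d0 hd] := triangulation_near z0 tri.
  have inn z : closure Omega z -> `|z - z0| < d -> `|vb z - vb z0| <= L * `|z - z0|.
    move=> cz zd; rewrite vbin//; have [T TT Tz] := triangulation_cover tri cz.
    have Tz0 := hd z zd T TT Tz.
    rewrite vbin// (hc T TT z Tz) (hc T TT z0 Tz0) affineB.
    by rewrite (le_trans (norm_dotp _ _))// ler_wpM2r// hL.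
  have [fz|nfz] := pselect ((closure Omega)° z0).
    have [r r0 hr] := openP (open_interior _) fz.
    exists (Num.min d r); first by rewrite lt_min d0.
    move=> z; rewrite lt_min => /andP[zd zr]; apply: inn => //.
    by apply: interior_subset; exact: hr.
  have f0 : frontier Omega z0.
    split=> // i0; apply: nfz; move: i0; apply: interiorS; exact: subset_closure.
  exists d => // z zd; have [cz|ncz] := pselect (closure Omega z); first exact: inn.
  by rewrite vbout// vbin// v0// subrr normr0 mulr_ge0.
pose F t := vb (y + t *: (x - y)).
have := @lip_segment _ F (L * `|x - y|).
rewrite /F scale1r scale0r addr0 [y + (x - y)]addrC subrK; apply => s s01.
have [d d0 hd] := loc (y + s *: (x - y)).
have P0 : 0 < 1 + `|x - y| by rewrite ltr_wpDr.
exists (d / (1 + `|x - y|)); first by rewrite divr_gt0.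
move=> t t01 ts.
have E : y + t *: (x - y) - (y + s *: (x - y)) = (t - s) *: (x - y).
  by rewrite scalerBl opprD addrACA subrr add0r.
have := hd (y + t *: (x - y)); rewrite E normrZ => /(_ _)/wrap[].
  rewrite ltr_pdivlMr// in ts; apply: le_lt_trans ts.
  by rewrite ler_wpM2l// lerDr.
by rewrite -mulrA (mulrC `|x - y|).
Qed.

(** The slope on the first listed triangle whose interior contains x, and 0 if there is none: a
    total measurable choice of piecewise gradient. *)
Fixpoint pick_grad (s : seq (set (plane R))) (c : set (plane R) -> R * plane R) x : plane R :=
  if s is T :: s' then (if `[< T° x >] then (c T).2 else pick_grad s' c x) else 0.

Lemma measurable_pick_grad s c : 
  measurable_plane setT (fun x => (pick_grad s c x).1) /\
  measurable_plane setT (fun x => (pick_grad s c x).2).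
Proof.
elim: s => [|T s [IH1 IH2]] /=; first by split; exact: measurable_cst.
have mT : measurable (T° : set (plane_mt R)).
  by apply: open_measurable_plane; exact: open_interior.
have E (pr : plane R -> R) : measurable_plane setT (fun x => pr (pick_grad s c x)) ->
    measurable_plane setT (fun x => pr (if `[< T° x >] then (c T).2 else pick_grad s c x)).
  move=> mp.
  rewrite (_ : (fun x => _) = (fun x => (pr (c T).2 - pr (pick_grad s c x)) * \1_(T°) x
      + pr (pick_grad s c x))).
    apply: measurable_realfun.measurable_funD => //.
    apply: measurable_realfun.measurable_funM; last exact: measurable_indic.
    by apply: measurable_realfun.measurable_funB => //; exact: measurable_cst.
  apply/funext => x; rewrite indicE; case: ifPn => [/asboolP h|/asboolP h].
    by rewrite mem_set// mulr1 subrK.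
  by rewrite memNset// mulr0 add0r.
by split; exact: E.
Qed.

Lemma pick_gradP s c x : (exists T, [/\ T \in s, T° x & pick_grad s c x = (c T).2]) \/
  (forall T, T \in s -> ~ T° x) /\ pick_grad s c x = 0.
Proof.
elim: s => [|T s IH] /=; first by right.
case: ifPn => [/asboolP Tx|/asboolP nTx].
  by left; exists T; rewrite inE eqxx.
case: IH => [[T' [T's T'x E]]|[h E]].
  by left; exists T'; rewrite inE T's orbT.
by right; split => // T'; rewrite inE => /orP[/eqP ->//|]; exact: h.
Qed.

(** Makes [pick_grad] independent of the order of the list: [triangulation] alone lets interiors
    overlap, but v is then given by both affine functions near x. *)
Lemma affine_near_unique p q x : (\forall y \near x, affine p y = affine q y) -> p.2 = q.2.
Proof.
move=> /nbhs_ballP[d d0 hd]; have [d20 dd] : 0 < d / 2 /\ d / 2 < d.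
  by move: d0 => /= d0; split; lra.
have hh y : `|y - x| < d -> affine p y = affine q y.
  by move=> yx; apply: hd; rewrite -ball_normE /= distrC.
have h0 := hh x; rewrite subrr normr0 in h0.
have h1 := hh (x + (d / 2, 0)); have h2 := hh (x + (0, d / 2)).
have n1 : `|x + (d / 2, 0) - x| < d.
  by rewrite addrC addKr normp_lt /= normr0 d0 andbT gtr0_norm.
have n2 : `|x + (0, d / 2) - x| < d.
  by rewrite addrC addKr normp_lt /= normr0 d0 gtr0_norm.
move: (h0 d0) (h1 n1) (h2 n2); rewrite /affine /dotp /=.
case: p q {hd hh h0 h1 h2} => p1 [p2 p3] [q1 [q2 q3]] /= e0 e1 e2.
have d2n : d / 2 != 0 by rewrite gt_eqF.
congr pair; apply: (mulIf d2n); lra.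
Qed.

Lemma triangulation_ae Omega Tau : triangulation Omega Tau ->
  {ae mu, forall x, closure Omega x -> exists2 T, Tau T & T° x}.
Proof.
move=> tri; have [fT tT _] := tri; case/finite_seqP: fT => s sE.
have sub : ~` [set x | closure Omega x -> exists2 T, Tau T & T° x] `<=`
    \big[setU/set0]_(T <- s) (T `\` T°).
  move=> x /= /not_implyP[cx nx]; have [T TT Tx] := triangulation_cover tri cx.
  have Ts : T \in s by rewrite sE in TT.
  rewrite -bigcup_seq; exists T => //; split => // Tix; apply: nx; exists T => //.
suff H : mu.-negligible (\big[setU/set0]_(T <- s) (T `\` T°)) 
  by exact: (@negligibleS _ _ _ mu _ _ sub H).
have {}tT T : T \in s -> triangle T by move=> Ts; apply: tT; rewrite sE.
elim: s tT {sE sub} => [|T s IH] tT; first by rewrite big_nil; exact: negligible_set0.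
rewrite big_cons; apply: negligibleU.
  by have [] := triangle_interior (tT T (mem_head _ _)).
by apply: IH => T' T's; apply: tT; rewrite inE T's orbT.
Qed.

Lemma lip_continuous (f : plane R -> R) L : 0 <= L ->
  (forall x y, `|f x - f y| <= L * `|x - y|) -> continuous f.
Proof.
move=> L0 fL x; apply/cvgrPdist_lt => e e0.
have L1 : 0 < L + 1 by lra.
have eL : 0 < e / (L + 1) by rewrite divr_gt0.
apply: filterS (nbhsx_ballx x _ eL) => y.
rewrite -ball_normE /= ltr_pdivlMr// => h.
apply: le_lt_trans (fL x y) _; apply: le_lt_trans h.
by rewrite mulrC ler_wpM2l// lerDl.
Qed.

Lemma bounded_closure Omega : bounded_set Omega ->
  exists2 K : R, 0 <= K & forall x, closure Omega x -> `|x| <= K.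
Proof.
move=> [B [Br hB]]; exists (`|B| + 1); first by rewrite addr_ge0.
have cl : closed [set x : plane R | `|x| <= `|B| + 1].
  apply: (closed_comp (f := fun x : plane R => `|x|) (D := [set t | t <= `|B| + 1])).
    by move=> y _; exact: norm_continuous.
  exact: closed_le.
have sub : Omega `<=` [set x | `|x| <= `|B| + 1].
  by move=> y Oy; apply: hB => //; have := ler_norm B; lra.
by rewrite closureE; apply: smallest_sub.
Qed.

(** The Lipschitz bound of the extension by 0 controls all its difference quotients. Almost every
    point is interior to a triangle or outside the closure; there the extension is locally affine
    and the quotients are eventually constant. The last clause identifies g on a triangle from any
    affine expression of v. *)
Lemma V10_aegrad Omega Tau v : bounded_set Omega -> triangulation Omega Tau ->
  V10 Omega Tau v -> exists g, has_aegrad (v \_ (closure Omega)) g /\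
    forall T p x, Tau T -> (forall y, T y -> v y = affine p y) -> T° x -> g x = p.2.
Proof.
move=> bO tri v10; have [v1 v0] := v10; have [c hc] := V1_coef v1.
have [fT tT cE] := tri; case/finite_seqP: (fT) => s sE.
have [L L0 hL] := finite_bound (fun T => `|(c T).2.1| + `|(c T).2.2|) fT.
have lip := V10_lip tri v0 L0 hc hL.
set vb := v \_ _ in lip *.
pose g := pick_grad s c; exists g.
have vbin z : closure Omega z -> vb z = v z by move=> h; rewrite /vb /patch mem_set.
have vbout z : ~ closure Omega z -> vb z = 0 by move=> h; rewrite /vb /patch memNset.
have gP T p x : Tau T -> (forall y, T y -> v y = affine p y) -> T° x -> g x = p.2.
  move=> TT hp Tx; case: (pick_gradP s c x) => [[T' [T's T'x E]]|[h _]]; last first.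
    by exfalso; apply: (h T) => //; rewrite sE in TT.
  rewrite /g E; apply: (@affine_near_unique _ _ x).
  near=> y; rewrite -hp; last by near: y; exact: Tx.
  rewrite -hc//; first by rewrite sE.
  by near: y; exact: T'x.
split => //; have [K K0 cB] := bounded_closure bO.
have ed n e : coord_dir e -> `|n.+1%:R^-1 *: e| = n.+1%:R^-1.
  move=> ce; rewrite normrZ ger0_norm ?invr_ge0// -[RHS]mulr1; congr (_ * _).
  by rewrite prod_normE; case: ce => -> /=; rewrite ?normrN normr1 normr0;
    [rewrite max_l|rewrite max_r|rewrite max_l|rewrite max_r]; rewrite ?ler01.
have [mg1 mg2] := measurable_pick_grad s c.
have gb x : `|(g x).1| + `|(g x).2| <= L.
  rewrite /g; case: (pick_gradP s c x) => [[T' [T's _ ->]]|[_ ->]].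
    by apply: hL; rewrite sE.
  by rewrite normr0 addr0.
have g0 x : K < `|x| -> g x = 0.
  move=> Kx; rewrite /g; case: (pick_gradP s c x) => [[T' [T's T'x _]]|[_ ->]//].
  have : closure Omega x.
    apply: (triangulation_sub tri (T := T')); first by rewrite sE.
    exact: interior_subset.
  by move=> /cB; rewrite leNgt Kx.
split.
  pose M := K + L * (2 * K + 1) + L.
  have KM : K <= M by rewrite /M -addrA lerDl; apply: addr_ge0 => //; apply: mulr_ge0; lra.
  have LM : L <= M by rewrite /M lerDr; apply: addr_ge0 => //; apply: mulr_ge0; lra.
  exists M; split.
  - split.
    + exact: continuous_measurable_plane (lip_continuous L0 lip).
    + move=> x; have [cx|ncx] := pselect (closure Omega x); last first.
        by rewrite vbout// normr0; lra.
      (* This point is outside the closure, where the extension is 0: the Lipschitz bound from there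
         bounds v. *)
      have nz : `|(K + 1, 0) : plane R| = K + 1.
        have h : 0 <= K + 1 by lra.
        by rewrite prod_normE /= normr0 (ger0_norm h) max_l.
      have := lip x (K + 1, 0); rewrite (vbout (K + 1, 0)) ?subr0; last first.
        by move=> /cB; rewrite nz; lra.
      move=> h; apply: (le_trans h); rewrite /M.
      have : L * `|x - (K + 1, 0)| <= L * (2 * K + 1).
        apply: ler_wpM2l => //; apply: le_trans (ler_normB _ _) _; rewrite nz.
        by have := cB x cx; lra.
      lra.
    + by move=> x Mx; apply: vbout => /cB; lra.
  - split=> // x.
      by have := gb x; have := normr_ge0 (g x).2; lra.
    by move=> Mx; rewrite g0//; exact: le_lt_trans Mx.
  - split=> // x.
      by have := gb x; have := normr_ge0 (g x).1; lra.
    by move=> Mx; rewrite g0//; exact: le_lt_trans Mx.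
  - move=> e n x ce; apply: le_trans LM.
    rewrite /dq normrM normr_nat -ler_pdivlMr ?ltr0n//.
    have := lip (x + n.+1%:R^-1 *: e) x; rewrite (_ : x + _ - x = n.+1%:R^-1 *: e).
      by rewrite ed.
    by rewrite addrC addKr.
apply: ae_imply (triangulation_ae tri) => x cx e ce.
suff [d d0 hd] : exists2 d, 0 < d & forall y, `|y - x| < d -> vb y - vb x = dotp (g x) (y - x).
  apply: cvg_near_cst.
  have : \forall n \near \oo, n.+1%:R^-1 < d := near_infty_natSinv_lt (PosNum d0).
  apply: filterS => n nd; rewrite /dq.
  rewrite hd; last by rewrite addrC addKr ed.
  rewrite addrC addKr /dotp /= /GRing.scale /=.
  have : n.+1%:R != 0 :> R by rewrite pnatr_eq0.
  by move: (n.+1%:R : R) => N N0; field.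
have [cOx|nc] := pselect (closure Omega x).
  have [T TT Tx] := cx cOx.
  have [d d0 hd] := openP (open_interior T) Tx.
  exists d => // y yx; have Ty : T y by apply: interior_subset; exact: hd.
  have Txx : T x by exact: interior_subset.
  rewrite !vbin; [|exact: (triangulation_sub tri TT)..].
  rewrite (hc T)// (hc T)// affineB (gP T (c T))//.
  by move=> z; exact: hc.
have oC : open (~` closure Omega) by apply: closed_openC; exact: closed_closure.
have [d d0 hd] := openP oC (nc : (~` closure Omega) x).
exists d => // y yx; rewrite !vbout//; last exact: hd.
suff -> : g x = 0 by rewrite subrr /dotp /= !mul0r addr0.
rewrite /g; case: (pick_gradP s c x) => [[T [Ts Tx _]]|[_ ->//]].
exfalso; apply: nc; apply: (triangulation_sub tri (T := T)); first by rewrite sE.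
exact: interior_subset.
Unshelve. all: by end_near. Qed.

End PiecewiseAffine.

(** * Galerkin approximation *)

Section FiniteDim.
Variables (R : realType) (X : Type) (V : (X -> R) -> Prop) (n : nat) (pts : 'I_n -> X).
Variables (B : (X -> R) -> (X -> R) -> R) (l : (X -> R) -> R).
Hypothesis V0 : V (fun=> 0).
Hypothesis VD : forall a u v, V u -> V v -> V (fun x => a * u x + v x).
Hypothesis BDl : forall a u v w, V u -> V v -> V w ->
  B (fun x => a * u x + v x) w = a * B u w + B v w.
Hypothesis BDr : forall a u v w, V u -> V v -> V w ->
  B w (fun x => a * u x + v x) = a * B w u + B w v.
Hypothesis lD : forall a u v, V u -> V v -> l (fun x => a * u x + v x) = a * l u + l v.
Hypothesis Bdef : forall u, V u -> B u u = 0 -> forall i, u (pts i) = 0.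
Hypothesis ker0 : forall v, V v -> (forall i, v (pts i) = 0) ->
  (forall u, V u -> B u v = 0) /\ l v = 0.

Let comb m (s : seq 'I_m) (c : 'I_m -> R) (e : 'I_m -> X -> R) x := \sum_(i <- s) c i * e i x.

Let comb_cons m i (s : seq 'I_m) c e :
  comb (i :: s) c e = (fun x => c i * e i x + comb s c e x).
Proof. by apply/funext => x; rewrite /comb big_cons. Qed.

Let comb_nil m c (e : 'I_m -> X -> R) : comb [::] c e = (fun=> 0).
Proof. by apply/funext => x; rewrite /comb big_nil. Qed.

Let V_comb m (s : seq 'I_m) c e : (forall i, V (e i)) -> V (comb s c e).
Proof.
move=> Ve; elim: s => [|i s IH]; first by rewrite comb_nil.
by rewrite comb_cons; exact: VD.
Qed.

Let B0l w : V w -> B (fun=> 0) w = 0.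
Proof.
move=> Vw; have := BDl (-1) V0 V0 Vw.
rewrite (_ : (fun _ => _) = (fun=> 0)); first by lra.
by apply/funext => x; rewrite mulr0 addr0.
Qed.

Let B0r w : V w -> B w (fun=> 0) = 0.
Proof.
move=> Vw; have := BDr (-1) V0 V0 Vw.
rewrite (_ : (fun _ => _) = (fun=> 0)); first by lra.
by apply/funext => x; rewrite mulr0 addr0.
Qed.

Let l0 : l (fun=> 0) = 0.
Proof.
have := lD (-1) V0 V0.
rewrite (_ : (fun _ => _) = (fun=> 0)); first by lra.
by apply/funext => x; rewrite mulr0 addr0.
Qed.

Let Bl_comb m (s : seq 'I_m) c e w : (forall i, V (e i)) -> V w ->
  B (comb s c e) w = \sum_(i <- s) c i * B (e i) w.
Proof.
move=> Ve Vw; elim: s => [|i s IH]; first by rewrite comb_nil big_nil B0l.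
by rewrite comb_cons BDl ?IH ?big_cons//; exact: V_comb.
Qed.

Let Br_comb m (s : seq 'I_m) c e w : (forall i, V (e i)) -> V w ->
  B w (comb s c e) = \sum_(i <- s) c i * B w (e i).
Proof.
move=> Ve Vw; elim: s => [|i s IH]; first by rewrite comb_nil big_nil B0r.
by rewrite comb_cons BDr ?IH ?big_cons//; exact: V_comb.
Qed.

Let l_comb m (s : seq 'I_m) c e : (forall i, V (e i)) ->
  l (comb s c e) = \sum_(i <- s) c i * l (e i).
Proof.
move=> Ve; elim: s => [|i s IH]; first by rewrite comb_nil big_nil l0.
by rewrite comb_cons lD ?IH ?big_cons//; exact: V_comb.
Qed.

Let ev v : 'rV[R]_n := \row_j v (pts j).
Let evm m (e : 'I_m -> X -> R) : 'M[R]_(m, n) := \matrix_(i, j) e i (pts j).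

Let free_family m := exists2 e : 'I_m -> X -> R, (forall i, V (e i)) & row_free (evm e).

(* [V] is finite dimensional because its elements are determined by their values
   at the points [pts]. *)
Let maximal_family : exists m (e : 'I_m -> X -> R),
  [/\ forall i, V (e i), row_free (evm e) & forall v, V v -> (ev v <= evm e)%MS].
Proof.
pose P m := `[< free_family m >].
have P0 : exists m, P m.
  exists 0%N; apply/asboolP; exists (fun _ _ => 0); first by case.
  by rewrite /row_free -leqn0 rank_leq_row.
have Pn m : P m -> (m <= n)%N.
  by move=> /asboolP[e _]; rewrite /row_free => /eqP <-; exact: rank_leq_col.
case: (ex_maxnP P0 Pn) => m /asboolP[e Ve fe] mmax.
exists m, e; split => // v Vv; apply/negPn/negP => nv.
suff /mmax : P m.+1 by rewrite ltnn.
apply/asboolP.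
pose e' (i : 'I_m.+1) := if unlift ord_max i is Some j then e j else v.
exists e'; first by move=> i; rewrite /e'; case: unlift => [j|].
rewrite /row_free eqn_leq rank_leq_row /=.
have lt1 : (evm e < evm e + ev v)%MS.
  by rewrite ltmxE addsmxSl /=; apply: contra nv => h; apply: submx_trans h; exact: addsmxSr.
have := rank_ltmx lt1; rewrite (eqP fe) => h; apply: leq_trans h _.
apply: mxrankS; rewrite addsmx_sub; apply/andP; split.
  apply/row_subP => i.
  have -> : row i (evm e) = row (lift ord_max i) (evm e').
    by apply/rowP => j; rewrite !mxE /e' liftK.
  exact: row_sub.
have -> : ev v = row ord_max (evm e').
  by apply/rowP => j; rewrite !mxE /e' unlift_none.
exact: row_sub.
Qed.

(** The Gram matrix of B on a maximal independent family is invertible: a vector of its kernel gives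
    u with B(u, u) = 0, hence u vanishes at [pts] and its coefficients are 0. A general v equals a
    combination of the family up to a function vanishing at [pts], which B and l ignore by [ker0];
    such functions need not be 0, the elements of V being total functions. *)
Lemma findim_solve : exists u, V u /\ forall v, V v -> B u v = l v.
Proof.
have [m [e [Ve fe he]]] := maximal_family.
pose s := index_enum 'I_m.
have evc (c : 'rV[R]_m) : ev (comb s (c ord0) e) = c *m evm e.
  apply/rowP => j; rewrite !mxE; apply: eq_bigr => i _; by rewrite !mxE.
pose G : 'M[R]_m := \matrix_(i, j) B (e i) (e j).
have fG : row_free G.
  rewrite -kermx_eq0; apply/eqP/row_matrixP => i; rewrite row0.
  set c := row i (kermx G); have cG : c *m G = 0 by rewrite /c -row_mul mulmx_ker row0.
  pose u := comb s (c ord0) e; have Vu : V u by exact: V_comb.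
  have Buj j : B u (e j) = 0.
    rewrite Bl_comb//; move/rowP/(_ j): cG; rewrite !mxE => h; rewrite -[RHS]h.
    by rewrite /s; apply: eq_bigr => k _; rewrite [G _ _]mxE.
  have Buu : B u u = 0.
    by rewrite {2}/u Br_comb//; apply: big1 => k _; rewrite Buj mulr0.
  have : c *m evm e = 0.
    by rewrite -evc; apply/rowP => j; rewrite !mxE; exact: Bdef Buu j.
  by rewrite -(mul0mx _ (evm e)) => /(row_free_inj fe).
have uG : G \in unitmx by rewrite -row_free_unit.
pose b : 'rV[R]_m := \row_j l (e j).
pose c := b *m invmx G; pose u := comb s (c ord0) e.
have Vu : V u by exact: V_comb.
exists u; split => // v Vv.
have Buj j : B u (e j) = l (e j).
  have : c *m G = b by rewrite /c mulmxKV.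
  move/rowP/(_ j); rewrite !mxE => <-; rewrite Bl_comb//.
  by rewrite /s; apply: eq_bigr => k _; rewrite [G _ _]mxE.
have /submxP[d dE] := he v Vv.
pose v1 := comb s (d ord0) e; have Vv1 : V v1 by exact: V_comb.
pose v2 := fun x => (-1) * v1 x + v x; have Vv2 : V v2 by exact: VD.
have v20 i : v2 (pts i) = 0.
  have : ev v1 = ev v by rewrite dE evc.
  by move/rowP/(_ i); rewrite !mxE => h; rewrite /v2 h mulN1r addNr.
have [h1 h2] := ker0 Vv2 v20.
have := h1 u Vu; rewrite /v2 BDr//; move: h2; rewrite /v2 lD//.
have -> : B u v1 = l v1.
  by rewrite Br_comb// l_comb//; apply: eq_bigr => i _; rewrite Buj.
lra.
Qed.

End FiniteDim.

(** * The energy form and the discrete problem *)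

Section Energy.
Variable R : realType.
Implicit Types (T Omega : set (plane R)) (x y z e : plane R) (u v w f h : plane R -> R)
  (g k : plane R -> plane R) (n : nat) (M L : R) (Tau : set (set (plane R)))
  (A : plane R -> 'M[R]_2).
Let mu := leb2 R.

(** On a set of finite measure, bounded measurable functions are integrable and stable under sums
    and products, which settles the integrability of all products of coefficients and gradients. *)
Definition bm Omega f := measurable_plane Omega f /\
  exists M, forall x, Omega x -> `|f x| <= M.

Lemma bm_cst Omega a : bm Omega (fun=> a).
Proof. by split; [exact: measurable_cst|exists `|a|]. Qed.

Lemma bmD Omega f h : bm Omega f -> bm Omega h -> bm Omega (fun x => f x + h x).
Proof.
move=> [mf [M fM]] [mh [N hN]]; split; first exact: measurable_realfun.measurable_funD.
exists (M + N) => x Ox; apply: le_trans (ler_normD _ _) _.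
by apply: lerD; [exact: fM|exact: hN].
Qed.

Lemma bmM Omega f h : bm Omega f -> bm Omega h -> bm Omega (fun x => f x * h x).
Proof.
move=> [mf [M fM]] [mh [N hN]]; split; first exact: measurable_realfun.measurable_funM.
by exists (M * N) => x Ox; rewrite normrM; apply: ler_pM => //; [exact: fM|exact: hN].
Qed.

Lemma bmB Omega f h : bm Omega f -> bm Omega h -> bm Omega (fun x => f x - h x).
Proof.
move=> bf bh; have := bmD bf (bmM (bm_cst Omega (-1)) bh).
by congr bm; apply/funext => x; rewrite mulN1r.
Qed.

Lemma bounded_measure_fin Omega : open Omega -> bounded_set Omega -> (mu Omega < +oo)%E.
Proof.
move=> oO bO; have [K K0 hK] := bounded_closure bO.
apply: le_lt_trans (leb2_cbox_fin ((- K, - K), (K, K))).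
apply: le_measure; rewrite ?inE; [exact: open_measurable_plane|exact: measurable_cbox|].
move=> x Ox; have := hK x (subset_closure Ox).
by rewrite normp_le /cbox /= !ler_norml => /andP[].
Qed.

Lemma bm_integrable Omega f : open Omega -> bounded_set Omega -> bm Omega f ->
  mu.-integrable Omega (EFin \o f).
Proof.
move=> oO bO [mf [M fM]].
apply: measurable_bounded_integrable => //.
- exact: open_measurable_plane.
- exact: bounded_measure_fin.
- exists M; split; first exact: num_real.
  by move=> N MN x Ox; exact: le_trans (fM x Ox) (ltW MN).
Qed.

Lemma bm_fin Omega f : open Omega -> bounded_set Omega -> bm Omega f ->
  (\int[mu]_(x in Omega) (f x)%:E = (Rintegral mu Omega f)%:E)%E.
Proof.
move=> oO bO bf; rewrite /Rintegral fineK//; apply: integrable_fin_num.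
  exact: open_measurable_plane.
exact: bm_integrable.
Qed.

(** Gives access to an explicit bounded gradient g in place of [grad], an arbitrary representative
    which agrees with g only almost everywhere. *)
Definition bdd_wgrad Omega v g := [/\ weak_grad Omega v g, bm Omega (fun x => (g x).1)
  & bm Omega (fun x => (g x).2)].

Lemma loc_integrable_measurable Omega f : open Omega -> loc_integrable Omega f ->
  measurable_plane Omega f.
Proof.
move=> oO lf; have [Q [QO OE]] := open_bigcup_obox oO.
rewrite OE; apply/measurable_fun_bigcup => [k|k]; first exact: measurable_obox.
apply: (measurable_funS (measurable_cbox (Q k)) (@obox_cbox _ (Q k))).
exact: integrable_measurable_plane (lf _ (@compact_cbox _ (Q k)) (QO k)).
Qed.

Lemma weak_grad_measurable Omega u g : open Omega -> weak_grad Omega u g ->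
  measurable_plane Omega (fun x => (g x).1) /\ measurable_plane Omega (fun x => (g x).2).
Proof. by move=> oO [_ l1 l2 _]; split; exact: loc_integrable_measurable. Qed.

Lemma measurable_form Omega A g k : (forall i j, measurable_plane Omega (fun x => A x i j)) ->
  measurable_plane Omega (fun x => (g x).1) -> measurable_plane Omega (fun x => (g x).2) ->
  measurable_plane Omega (fun x => (k x).1) -> measurable_plane Omega (fun x => (k x).2) ->
  measurable_plane Omega (fun x => dotp (mx_app (A x) (g x)) (k x)).
Proof.
move=> mA g1 g2 k1 k2; rewrite /dotp /mx_app /=.
by repeat (apply: measurable_realfun.measurable_funD || apply: measurable_realfun.measurable_funM).
Qed.

Lemma bm_dotp Omega g k :
  bm Omega (fun x => (g x).1) -> bm Omega (fun x => (g x).2) ->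
  bm Omega (fun x => (k x).1) -> bm Omega (fun x => (k x).2) ->
  bm Omega (fun x => dotp (g x) (k x)).
Proof.
by move=> g1 g2 k1 k2; rewrite /dotp; apply: bmD; apply: bmM.
Qed.

Lemma bm_mx_app Omega A g : (forall i j, bm Omega (fun x => A x i j)) ->
  bm Omega (fun x => (g x).1) -> bm Omega (fun x => (g x).2) ->
  bm Omega (fun x => (mx_app (A x) (g x)).1) /\ bm Omega (fun x => (mx_app (A x) (g x)).2).
Proof.
by move=> bA g1 g2; split; apply: bmD; apply: bmM.
Qed.

Lemma bm_form Omega A g k : (forall i j, bm Omega (fun x => A x i j)) ->
  bm Omega (fun x => (g x).1) -> bm Omega (fun x => (g x).2) ->
  bm Omega (fun x => (k x).1) -> bm Omega (fun x => (k x).2) ->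
  bm Omega (fun x => dotp (mx_app (A x) (g x)) (k x)).
Proof.
move=> bA g1 g2 k1 k2; have [h1 h2] := bm_mx_app bA g1 g2; exact: bm_dotp.
Qed.

Lemma ae_eq_Rintegral Omega f h : open Omega -> measurable_plane Omega f ->
  measurable_plane Omega h -> {ae mu, forall x, Omega x -> f x = h x} ->
  (\int[mu]_(x in Omega) (f x)%:E = \int[mu]_(x in Omega) (h x)%:E)%E.
Proof.
move=> oO mf mh fh; apply: ae_eq_integral.
- exact: open_measurable_plane.
- exact/measurable_EFinP.
- exact/measurable_EFinP.
- by apply: ae_imply fh => x /= H Ox; rewrite H.
Qed.

Lemma energyE Omega A u g v k : open Omega -> bounded_set Omega ->
  (forall i j, bm Omega (fun x => A x i j)) -> bdd_wgrad Omega u g -> bdd_wgrad Omega v k ->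
  (\int[mu]_(x in Omega) (dotp (mx_app (A x) (grad Omega u x)) (grad Omega v x))%:E
  = (Rintegral mu Omega (fun x => dotp (mx_app (A x) (g x)) (k x)))%:E)%E.
Proof.
move=> oO bO bA [wu g1 g2] [wv k1 k2].
have [u1 u2] := weak_grad_measurable oO (weak_grad_grad wu).
have [v1 v2] := weak_grad_measurable oO (weak_grad_grad wv).
rewrite -bm_fin//; last exact: bm_form.
apply: ae_eq_Rintegral => //.
- by apply: measurable_form => // i j; have [] := bA i j.
- by have [] := bm_form bA g1 g2 k1 k2.
- apply: ae_imply (ae_and (gradP oO wu) (gradP oO wv)) => x [hu hv] Ox.
  by rewrite hu// hv.
Qed.

Lemma linformE Omega G v k : open Omega -> bounded_set Omega ->
  bm Omega (fun x => (G x).1) -> bm Omega (fun x => (G x).2) -> bdd_wgrad Omega v k ->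
  Rintegral mu Omega (fun x => dotp (G x) (grad Omega v x))
  = Rintegral mu Omega (fun x => dotp (G x) (k x)).
Proof.
move=> oO bO b1 b2 [wv k1 k2].
have [v1 v2] := weak_grad_measurable oO (weak_grad_grad wv).
congr fine; apply: ae_eq_Rintegral => //.
- rewrite /dotp; apply: measurable_realfun.measurable_funD;
    apply: measurable_realfun.measurable_funM => //; by [case: b1|case: b2].
- by have [] := bm_dotp b1 b2 k1 k2.
- by apply: ae_imply (gradP oO wv) => x hv Ox; rewrite hv.
Qed.

Lemma repD Omega a u v g k : open Omega -> bdd_wgrad Omega u g -> bdd_wgrad Omega v k ->
  bdd_wgrad Omega (fun x => a * u x + v x) (fun x => a *: g x + k x).
Proof.
move=> oO [wu g1 g2] [wv k1 k2]; split; first exact: weak_gradD.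
  by apply: (bmD (bmM (bm_cst Omega a) g1) k1).
by apply: (bmD (bmM (bm_cst Omega a) g2) k2).
Qed.

Lemma bounded_supp_bm Omega M f : open Omega -> bounded_supp M f -> bm Omega f.
Proof.
move=> oO [mf fM _]; split; last by exists M => x _; exact: fM.
by apply: measurable_funS mf => //; exact: measurableT.
Qed.

Lemma aegrad_rep Omega v g : open Omega -> has_aegrad (v \_ (closure Omega)) g -> bdd_wgrad Omega v g.
Proof.
move=> oO hg; have [[M [_ b1 b2 _]] _] := hg; split.
- apply: aegrad_weak_grad oO hg _ => x Ox.
  by rewrite /patch mem_set//; exact: subset_closure.
- exact: bounded_supp_bm b1.
- exact: bounded_supp_bm b2.
Qed.

Lemma V10_rep Omega Tau v : open Omega -> bounded_set Omega -> triangulation Omega Tau ->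
  V10 Omega Tau v -> exists g, bdd_wgrad Omega v g.
Proof.
move=> oO bO tri hv; have [g [hg _]] := V10_aegrad bO tri hv.
by exists g; exact: aegrad_rep.
Qed.

Lemma V10_0 Omega Tau : V10 Omega Tau (fun=> 0 : R).
Proof.
split=> //; split; first by move=> x; exact: cvg_cst.
by move=> T _; exists 0, 0, 0 => x _; rewrite !mul0r !addr0.
Qed.

Lemma V10_D Omega Tau a u v : V10 Omega Tau u -> V10 Omega Tau v ->
  V10 Omega Tau (fun x => a * u x + v x).
Proof.
move=> [[cu hu] u0] [[cv hv] v0]; split; last first.
  by move=> x fx; rewrite u0// v0// mulr0 addr0.
split.
  move=> x; apply: cvgD; last exact: cv.
  by apply: cvgM; [exact: cvg_cst|exact: cu].
move=> T TT; have [p [q [r h]]] := hu T TT; have [p' [q' [r' h']]] := hv T TT.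
exists (a * p + p'), (a * q + q'), (a * r + r') => x Tx; rewrite h// h'//; ring.
Qed.

Lemma open_not_negligible (U : set (plane R)) : open U -> U !=set0 -> ~ mu.-negligible U.
Proof.
move=> oU [x Ux] nU; have [d d0 hd] := openP oU Ux.
pose Q : plane R * plane R := ((x.1 - d / 2, x.2 - d / 2), (x.1 + d / 2, x.2 + d / 2)).
have QU : cbox Q `<=` U.
  move=> y [/= /andP[h1 h2] /andP[h3 h4]]; apply: hd.
  by rewrite normp_lt /= !ltr_norml; lra.
have nQ : mu.-negligible (cbox Q) by exact: (@negligibleS _ _ _ mu U _ QU nU).
have /eqP := measure_negligible (measurable_cbox Q) nQ.
rewrite [X in X == _]leb2_cbox /Q /=; [|lra|lra].
have -> : x.1 + d / 2 - (x.1 - d / 2) = d by field.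
have -> : x.2 + d / 2 - (x.2 - d / 2) = d by field.
by rewrite eqe mulf_eq0 !gt_eqF.
Qed.

Lemma closure_open_meet Omega (U : set (plane R)) : open U -> U !=set0 ->
  U `<=` closure Omega -> (U `&` Omega) !=set0.
Proof.
move=> oU [x Ux] UO; have := UO x Ux U (open_nbhs_nbhs (conj oU Ux)).
by rewrite setIC.
Qed.

(** The interior of each triangle meets [Omega] in a nonempty open set, which is not negligible, so
    every slope is 0. [V10_lip] with L = 0 makes the extension by 0 constant on the plane, and it is
    0 far away. *)
Lemma V10_grad0 Omega Tau (z : plane R -> R) g : open Omega -> bounded_set Omega -> triangulation Omega Tau ->
  V10 Omega Tau z ->
  (forall T p x, Tau T -> (forall y, T y -> z y = affine p y) -> T° x -> g x = p.2) ->
  {ae mu, forall x, Omega x -> g x = 0} -> forall x, closure Omega x -> z x = 0.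
Proof.
move=> oO bO tri hz gP g0 x cx.
have [c hc] := V1_coef hz.1.
have c0 T : Tau T -> (c T).2 = 0.
  move=> TT; have [_ tT _] := tri; have [T0 _] := triangle_interior (tT T TT).
  have oT : open (T°) by exact: open_interior.
  have TO : T° `<=` closure Omega.
    by apply: subset_trans (triangulation_sub tri TT); exact: interior_subset.
  have n0 := closure_open_meet oT T0 TO.
  have nn := open_not_negligible (openI oT oO) n0.
  apply: contrapT => cT; apply: nn.
  apply: (negligibleS _ g0) => y [Ty Oy] /= h.
  by apply: cT; rewrite -(gP T (c T) y TT _ Ty) ?h// => y' ; exact: hc.
have lip y y' : (z \_ (closure Omega)) y = (z \_ (closure Omega)) y'.
  have := V10_lip tri hz.2 (lexx 0) hc _ y y'; rewrite mul0r normr_le0 => /(_ _)/wrap[].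
    by move=> T TT; rewrite (c0 T TT) normr0 addr0.
  by move=> /eqP h; apply/eqP; rewrite -subr_eq0 h.
have [K K0 hK] := bounded_closure bO.
have := lip x (K + 1, 0); rewrite /patch mem_set// memNset//.
have h : 0 <= K + 1 by lra.
by move=> /hK; rewrite normp_le /= (ger0_norm h); lra.
Qed.

Lemma bm_RintegralD Omega a f h : open Omega -> bounded_set Omega -> bm Omega f -> bm Omega h ->
  Rintegral mu Omega (fun x => a * f x + h x) = a * Rintegral mu Omega f + Rintegral mu Omega h.
Proof.
move=> oO bO bf bh; have mO := open_measurable_plane oO.
rewrite RintegralD//; [|exact: bm_integrable (bmM (bm_cst Omega a) bf)|exact: bm_integrable].
by rewrite RintegralZl//; exact: bm_integrable.
Qed.

Lemma bm_le_Rintegral Omega f h : open Omega -> bounded_set Omega -> bm Omega f -> bm Omega h ->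
  (forall x, Omega x -> f x <= h x) -> Rintegral mu Omega f <= Rintegral mu Omega h.
Proof.
move=> oO bO bf bh fh; apply: le_Rintegral => //; [exact: open_measurable_plane
  |exact: bm_integrable|exact: bm_integrable].
Qed.

Lemma ae_bm_Rintegral Omega f h : open Omega -> bounded_set Omega -> bm Omega f -> bm Omega h ->
  {ae mu, forall x, Omega x -> f x = h x} -> Rintegral mu Omega f = Rintegral mu Omega h.
Proof.
by move=> oO bO [mf _] [mh _] fh; congr fine; exact: ae_eq_Rintegral.
Qed.

Lemma bm_Rintegral0 Omega f : open Omega -> bounded_set Omega -> bm Omega f ->
  (forall x, Omega x -> 0 <= f x) -> Rintegral mu Omega f <= 0 ->
  {ae mu, forall x, Omega x -> f x = 0}.
Proof.
move=> oO bO bf f0 If; have mO := open_measurable_plane oO; have [mf _] := bf.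
have mEf : @measurable_fun _ _ (plane_mt R) _ Omega (EFin \o f) by exact/measurable_EFinP.
have [h _] := ae_eq_integral_abs mu mO mEf.
have E : (\int[mu]_(x in Omega) `|(f x)%:E| = 0)%E.
  have -> : (\int[mu]_(x in Omega) `|(f x)%:E| = \int[mu]_(x in Omega) (f x)%:E)%E.
    by apply: eq_integral => x; rewrite inE => /f0 fx; rewrite gee0_abs.
  rewrite bm_fin//; congr EFin; apply/le_anti; rewrite If /=; exact: Rintegral_ge0.
by apply: ae_imply (h E) => x /= H Ox; have [] := H Ox.
Qed.

Section Galerkin.
Variables (Omega : set (plane R)) (Tau : set (set (plane R))).
Hypotheses (oO : open Omega) (bO : bounded_set Omega) (tri : triangulation Omega Tau).
Variables (A : plane R -> 'M[R]_2) (G : plane R -> plane R) (c : R).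
Hypotheses (bA : forall i j, bm Omega (fun x => A x i j))
  (bG1 : bm Omega (fun x => (G x).1)) (bG2 : bm Omega (fun x => (G x).2)) (c0 : 0 < c)
  (ellA : forall x, Omega x -> forall p, c * dotp p p <= dotp (mx_app (A x) p) p).

Definition gform v := - Rintegral mu Omega (fun x => dotp (G x) (grad Omega v x)).

Let V := V10 Omega Tau.
Let B u v := Rintegral mu Omega (fun x => dotp (mx_app (A x) (grad Omega u x)) (grad Omega v x)).

Let BE u g v k : bdd_wgrad Omega u g -> bdd_wgrad Omega v k ->
  B u v = Rintegral mu Omega (fun x => dotp (mx_app (A x) (g x)) (k x)).
Proof. by move=> ru rv; rewrite /B /Rintegral (energyE oO bO bA ru rv). Qed.

Let formE v k : bdd_wgrad Omega v k -> gform v = - Rintegral mu Omega (fun x => dotp (G x) (k x)).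
Proof. by move=> rv; rewrite /gform (linformE oO bO bG1 bG2 rv). Qed.

Let bmf g k u v : bdd_wgrad Omega u g -> bdd_wgrad Omega v k ->
  bm Omega (fun x => dotp (mx_app (A x) (g x)) (k x)).
Proof. by move=> [_ g1 g2] [_ k1 k2]; exact: bm_form. Qed.

Let BDl a u v w : V u -> V v -> V w -> B (fun x => a * u x + v x) w = a * B u w + B v w.
Proof.
move=> /(V10_rep oO bO tri)[g ru] /(V10_rep oO bO tri)[k rv] /(V10_rep oO bO tri)[m rw].
rewrite (BE (repD a oO ru rv) rw) (BE ru rw) (BE rv rw).
rewrite -bm_RintegralD//; [|exact: bmf ru rw|exact: bmf rv rw].
by congr Rintegral; apply/funext => x; rewrite /dotp /mx_app /= /GRing.scale /=; ring.
Qed.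

Let BDr a u v w : V u -> V v -> V w -> B w (fun x => a * u x + v x) = a * B w u + B w v.
Proof.
move=> /(V10_rep oO bO tri)[g ru] /(V10_rep oO bO tri)[k rv] /(V10_rep oO bO tri)[m rw].
rewrite (BE rw (repD a oO ru rv)) (BE rw ru) (BE rw rv).
rewrite -bm_RintegralD//; [|exact: bmf rw ru|exact: bmf rw rv].
by congr Rintegral; apply/funext => x; rewrite /dotp /mx_app /= /GRing.scale /=; ring.
Qed.

Let lD a u v : V u -> V v ->
  - gform (fun x => a * u x + v x) = a * - gform u + - gform v.
Proof.
move=> /(V10_rep oO bO tri)[g ru] /(V10_rep oO bO tri)[k rv].
rewrite (formE (repD a oO ru rv)) (formE ru) (formE rv) !opprK.
have [_ g1 g2] := ru; have [_ k1 k2] := rv.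
rewrite -bm_RintegralD//; [|exact: bm_dotp|exact: bm_dotp].
by congr Rintegral; apply/funext => x; rewrite /dotp /mx_app /= /GRing.scale /=; ring.
Qed.

(** Ellipticity bounds the integral of |g|^2 by B u u / c, so the gradient is 0 almost
    everywhere. *)
Let Bdef u : V u -> B u u = 0 -> forall x, closure Omega x -> u x = 0.
Proof.
move=> Vu; have [g [hg gP]] := V10_aegrad bO tri Vu; have ru := aegrad_rep oO hg.
rewrite (BE ru ru) => B0; have [_ g1 g2] := ru.
have bn : bm Omega (fun x => dotp (g x) (g x)) by exact: bm_dotp.
have n0 x : 0 <= dotp (g x) (g x) by rewrite /dotp -!expr2 addr_ge0 ?sqr_ge0.
have In : Rintegral mu Omega (fun x => dotp (g x) (g x)) <= 0.
  rewrite -(pmulr_rle0 _ c0) -B0.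
  have := bm_RintegralD c oO bO bn (bm_cst Omega 0).
  have -> : Rintegral mu Omega (fun=> 0) = 0.
    by rewrite /Rintegral integral0_eq.
  rewrite addr0 => <-; apply: bm_le_Rintegral => //.
  - by apply: bmD (bm_cst Omega 0); exact: bmM (bm_cst Omega c) bn.
  - exact: (bmf ru ru).
  - by move=> x Ox; rewrite addr0; exact: ellA.
have z := bm_Rintegral0 oO bO bn (fun x _ => n0 x) In.
apply: (V10_grad0 oO bO tri Vu gP); apply: ae_imply z => x h Ox.
move: (h Ox); rewrite /dotp -!expr2; case: (g x) => p q /= /eqP.
by rewrite paddr_eq0 ?sqr_ge0// !sqrf_eq0 => /andP[/eqP -> /eqP ->].
Qed.

Let ker0 v : V v -> (forall x, closure Omega x -> v x = 0) ->
  (forall u, V u -> B u v = 0) /\ - gform v = 0.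
Proof.
move=> Vv v0.
have [k rv] := V10_rep oO bO tri Vv.
(* On [Omega], where v is 0, v coincides with -v + v, whose weak gradient -k + k is 0; uniqueness
   then gives k = 0 almost everywhere. *)
have rz := repD (-1) oO rv rv.
have k0 : {ae mu, forall x, Omega x -> k x = 0}.
  have [wv _ _] := rv; have [wz _ _] := rz.
  have eqz x : Omega x -> v x = -1 * v x + v x.
    by move=> Ox; rewrite v0 ?mulr0 ?addr0//; exact: subset_closure.
  apply: ae_imply (weak_grad_unique oO wv wz eqz) => x h Ox.
  by rewrite h// scaleN1r addNr.
have [_ k1 k2] := rv; split => [u Vu|].
  have [g ru] := V10_rep oO bO tri Vu; rewrite (BE ru rv).
  rewrite (ae_bm_Rintegral oO bO (bmf ru rv) (bm_cst Omega 0)).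
    by rewrite /Rintegral integral0_eq.
  by apply: ae_imply k0 => x h Ox; rewrite h// /dotp /= !mulr0 addr0.
rewrite (formE rv) opprK (ae_bm_Rintegral oO bO (bm_dotp bG1 bG2 k1 k2) (bm_cst Omega 0)).
  by rewrite /Rintegral integral0_eq.
by apply: ae_imply k0 => x h Ox; rewrite h// /dotp /= !mulr0 addr0.
Qed.

Let galerkin_B u : galerkin Omega Tau A gform u <-> V u /\ forall v, V v -> B u v = - gform v.
Proof.
split=> -[Vu h]; split => // v Vv; have [g ru] := V10_rep oO bO tri Vu;
  have [k rv] := V10_rep oO bO tri Vv; have := h v Vv.
  by rewrite (energyE oO bO bA ru rv) (BE ru rv) => -[].
by rewrite (energyE oO bO bA ru rv) (BE ru rv) => ->.
Qed.

Lemma galerkin_unique u w : galerkin Omega Tau A gform u -> galerkin Omega Tau A gform w ->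
  forall x, closure Omega x -> w x = u x.
Proof.
move=> /galerkin_B[Vu hu] /galerkin_B[Vw hw] x cx.
have Vz := V10_D (-1) Vu Vw.
have := Bdef Vz; rewrite BDl// hu// hw// => /(_ _ x cx)/wrap[]; lra.
Qed.

(** The vertices of all triangles: an affine function that is 0 at the three vertices of a triangle
    is 0 on it. *)
Let nodes : exists (n : nat) (pts : 'I_n -> plane R), (forall i, closure Omega (pts i)) /\
  forall v, V v -> (forall i, v (pts i) = 0) -> forall x, closure Omega x -> v x = 0.
Proof.
have [fT tT _] := tri; case/finite_seqP: (fT) => s sE.
have /choice[abc habc] : forall T, exists p : plane R * plane R * plane R,
    Tau T -> is_triangle T p.1.1 p.1.2 p.2.
  move=> T; have [TT|nT] := pselect (Tau T); last by exists (0, 0, 0).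
  by have [a [b [d h]]] := tT T TT; exists (a, b, d).
pose P := flatten [seq [:: (abc T).1.1; (abc T).1.2; (abc T).2] | T <- s].
have inP T p : T \in s -> p \in [:: (abc T).1.1; (abc T).1.2; (abc T).2] -> p \in P.
  by move=> Ts pT; apply/flattenP; exists [:: (abc T).1.1; (abc T).1.2; (abc T).2] => //;
    apply: map_f.
exists (size P), (fun i => nth 0 P i); split.
  move=> i; have : nth 0 P i \in P by exact: mem_nth.
  move=> /flattenP[r /mapP[T Ts ->]]; set p := nth _ _ _ => pT.
  have TT : Tau T by rewrite sE.
  apply: (triangulation_sub tri TT); have [D TE] := habc T TT; rewrite TE.
  move: pT; rewrite !inE => /or3P[] /eqP ->.
  - by exists 1, 0, 0; split => //; rewrite ?addr0// scale1r !scale0r !addr0.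
  - by exists 0, 1, 0; split => //; rewrite ?addr0 ?add0r// scale1r !scale0r add0r addr0.
  - by exists 0, 0, 1; split => //; rewrite ?addr0 ?add0r// scale1r !scale0r !add0r.
move=> v Vv v0 x cx; have [T TT Tx] := triangulation_cover tri cx.
have [d hd] := V1_coef Vv.1; have Ts : T \in s by rewrite sE in TT.
have vP p : p \in P -> v p = 0.
  by move=> pP; have := v0 (Ordinal (etrans (index_mem p P) pP)); rewrite /= nth_index.
have [D TE] := habc T TT.
move: (Tx); rewrite {1}TE => -[r [t [q [_ _ _ rtq xE]]]].
have inT p : p \in [:: (abc T).1.1; (abc T).1.2; (abc T).2] -> T p /\ v p = 0.
  move=> pT; split; last by apply: vP; exact: inP pT.
  rewrite TE; move: pT; rewrite !inE => /or3P[] /eqP ->.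
  - by exists 1, 0, 0; split => //; rewrite ?addr0// scale1r !scale0r !addr0.
  - by exists 0, 1, 0; split => //; rewrite ?addr0 ?add0r// scale1r !scale0r add0r addr0.
  - by exists 0, 0, 1; split => //; rewrite ?addr0 ?add0r// scale1r !scale0r !add0r.
have [T1 v1] := inT (abc T).1.1 ltac:(by rewrite !inE eqxx).
have [T2 v2] := inT (abc T).1.2 ltac:(by rewrite !inE eqxx ?orbT).
have [T3 v3] := inT (abc T).2 ltac:(by rewrite !inE eqxx ?orbT).
rewrite (hd T TT x Tx).
move: v1 v2 v3; rewrite (hd T TT _ T1) (hd T TT _ T2) (hd T TT _ T3) => v1 v2 v3.
have -> : affine (d T) x = r * affine (d T) (abc T).1.1 + t * affine (d T) (abc T).1.2
    + q * affine (d T) (abc T).2.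
  by rewrite xE /affine /dotp /= /GRing.scale /= -[X in X + _ = _]mulr1 -rtq; ring.
by rewrite v1 v2 v3 !mulr0 !addr0.
Qed.

Lemma galerkin_exists : exists u, galerkin Omega Tau A gform u.
Proof.
have [n [pts [inO det]]] := nodes.
have [|||||||u hu] := @findim_solve R (plane R) V n pts B (fun v => - gform v).
- exact: V10_0.
- by move=> a u v; exact: V10_D.
- exact: BDl.
- exact: BDr.
- exact: lD.
- by move=> u Vu Bu i; exact: Bdef Vu Bu _ (inO i).
- by move=> v Vv v0; apply: ker0 => //; exact: det.
by exists u; apply/galerkin_B.
Qed.

End Galerkin.

End Energy.

(** * Lagrange interpolation *)

Section Interpolation.
Variable R : realType.
Implicit Types (T Omega : set (plane R)) (x y z e a b c : plane R) (u v w f phi : plane R -> R)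
  (g k : plane R -> plane R) (n : nat) (M L : R) (Tau : set (set (plane R))).
Let mu := leb2 R.

Lemma dotp_ge0 x : 0 <= dotp x x.
Proof. by rewrite /dotp -!expr2 addr_ge0 ?sqr_ge0. Qed.

Lemma enorm_le x (r : R) : 0 <= r -> (enorm x <= r) = (dotp x x <= r ^+ 2).
Proof.
move=> r0; have rE : r = Num.sqrt (r ^+ 2) by rewrite sqrtr_sqr ger0_norm.
by rewrite /enorm {1}rE ler_sqrt// exprn_ge0.
Qed.

Lemma enorm_ge0 x : 0 <= enorm x.
Proof. exact: sqrtr_ge0. Qed.

Lemma enorm_sqr x : enorm x ^+ 2 = dotp x x.
Proof. by rewrite sqr_sqrtr// dotp_ge0. Qed.

Lemma norm_le_enorm x : `|x| <= enorm x.
Proof.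
rewrite normp_le; have h := enorm_sqr x; have e0 := enorm_ge0 x.
apply/andP; split; rewrite -(ler_pXn2r (n := 2%N)) ?nnegrE// h -normrX ger0_norm ?sqr_ge0// /dotp -!expr2.
  by rewrite lerDl sqr_ge0.
by rewrite lerDr sqr_ge0.
Qed.

Lemma enorm_le_norm x : enorm x <= `|x.1| + `|x.2|.
Proof.
have sq (t : R) : `|t| * `|t| = t * t by rewrite -normrM ger0_norm// -expr2 sqr_ge0.
have h := mulr_ge0 (normr_ge0 x.1) (normr_ge0 x.2).
rewrite enorm_le ?addr_ge0// /dotp sqrrD !expr2 !sq; lra.
Qed.

Lemma hull3_perm a b c : hull3 b a c = hull3 a b c /\ hull3 c b a = hull3 a b c.
Proof.
split; apply/seteqP; split=> x [r [s [t [r0 s0 t0 rst ->]]]].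
- by exists s, r, t; split => //; [rewrite -rst; ring|rewrite [s *: _ + _]addrC].
- by exists s, r, t; split => //; [rewrite -rst; ring|rewrite [s *: _ + _]addrC].
- by exists t, s, r; split => //; [rewrite -rst; ring|rewrite addrC [r *: _ + _]addrC addrA].
- by exists t, s, r; split => //; [rewrite -rst; ring|rewrite addrC [r *: _ + _]addrC addrA].
Qed.

Lemma is_triangle_vertices T a b c : is_triangle T a b c ->
  [/\ vertex T a, vertex T b & vertex T c].
Proof.
move=> [D TE]; have [h1 h2] := hull3_perm a b c.
have E1 : orient b a c = - orient a b c by rewrite /orient; ring.
have E2 : orient c b a = - orient a b c by rewrite /orient; ring.
split; [exists b, c|exists a, c|exists b, a]; split => //.
- by rewrite -/(orient b a c) E1 oppr_eq0.
- by rewrite TE.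
- by rewrite -/(orient c b a) E2 oppr_eq0.
- by rewrite TE.
Qed.

Lemma affine_comb p (r s t : R) a b c : r + s + t = 1 ->
  affine p (r *: a + s *: b + t *: c) = r * affine p a + s * affine p b + t * affine p c.
Proof.
move=> rst; rewrite /affine /dotp /= /GRing.scale /= -[X in X + _ = _]mulr1 -rst; ring.
Qed.

Lemma affine_comb2 p (s t : R) a b : s + t = 1 ->
  affine p (s *: a + t *: b) = s * affine p a + t * affine p b.
Proof.
move=> st; have := @affine_comb p s t 0 a b 0; rewrite addr0 st scale0r addr0 mul0r addr0.
by apply.
Qed.

Lemma bary_affineP a b c : orient a b c != 0 -> exists p q r : R * plane R,
  [/\ bary1 a b c =1 affine p, bary2 a b c =1 affine q & bary3 a b c =1 affine r].
Proof.
move=> D; have [p [q [r [hp hq hr _]]]] := bary_affine D.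
by exists p, q, r; split=> x; rewrite ?hp ?hq ?hr /affine /dotp addrA.
Qed.

Lemma bary_vertices a b c : orient a b c != 0 ->
  [/\ bary1 a b c a = 1, bary2 a b c a = 0, bary3 a b c a = 0 &
  [/\ bary1 a b c b = 0, bary2 a b c b = 1, bary3 a b c b = 0 &
  [/\ bary1 a b c c = 0, bary2 a b c c = 0 & bary3 a b c c = 1]]].
Proof.
move=> D.
have [] := @bary_comb R a b c 1 0 0 D ltac:(ring).
have [] := @bary_comb R a b c 0 1 0 D ltac:(ring).
have [] := @bary_comb R a b c 0 0 1 D ltac:(ring).
by rewrite !scale1r !scale0r !addr0 !add0r => -> -> -> -> -> -> -> -> ->.
Qed.

Lemma convex_comb_eq1 (r s t p q k : R) : 0 <= r -> 0 <= s -> 0 <= t -> r + s + t = 1 ->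
  p <= 1 -> q <= 1 -> k <= 1 -> r * p + s * q + t * k = 1 -> [\/ p = 1, q = 1 | k = 1].
Proof.
move=> r0 s0 t0 rst p1 q1 k1 e.
have hr := mulr_ge0 r0 (_ : 0 <= 1 - p); have hs := mulr_ge0 s0 (_ : 0 <= 1 - q).
have ht := mulr_ge0 t0 (_ : 0 <= 1 - k).
have [r1|r1] := ltP 0 r.
  apply: Or31; have /eqP : r * (1 - p) = 0 by have := hr ltac:(lra); have := hs ltac:(lra);
    have := ht ltac:(lra); lra.
  by rewrite mulf_eq0 gt_eqF//= => /eqP; lra.
have [s1|s1] := ltP 0 s.
  apply: Or32; have /eqP : s * (1 - q) = 0 by have := hr ltac:(lra); have := hs ltac:(lra);
    have := ht ltac:(lra); lra.
  by rewrite mulf_eq0 gt_eqF//= => /eqP; lra.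
apply: Or33; have r00 : r = 0 by lra. have s00 : s = 0 by lra. have t1 : t = 1 by lra.
by move: e; rewrite r00 s00 t1; lra.
Qed.

(** A vertex is defined through some presentation of T; this shows that all presentations have the
    same vertices. The barycentric coordinate attached to x is at most 1 on T with equality only at
    x, and x is a convex combination of a, b, c, so one of them reaches the value 1. *)
Lemma vertex_in T a b c x : is_triangle T a b c -> vertex T x -> [\/ x = a, x = b | x = c].
Proof.
move=> [_ TE] [b' [c' [D TE']]].
have [p [_ [_ [hp _ _]]]] := bary_affineP D.
have le1 y : T y -> affine p y <= 1 /\ (affine p y = 1 -> x = y).
  rewrite TE' => /(hull3P _ D)[y1 y2 y3]; have S := bary_sum y D.
  rewrite -hp; split; first by lra.
  move=> e1; have e2 : bary2 x b' c' y = 0 by lra. have e3 : bary3 x b' c' y = 0 by lra.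
  by rewrite [RHS](bary_decomp y D) e1 e2 e3 scale1r !scale0r !addr0.
have [px _ _ _] := bary_vertices D; rewrite hp in px.
have Tx : T x by rewrite TE'; exists 1, 0, 0; split => //; rewrite ?addr0// scale1r !scale0r !addr0.
have Ta : T a by rewrite TE; exists 1, 0, 0; split => //; rewrite ?addr0// scale1r !scale0r !addr0.
have Tb : T b by rewrite TE; exists 0, 1, 0; split => //; rewrite ?addr0 ?add0r// scale1r !scale0r add0r addr0.
have Tc : T c by rewrite TE; exists 0, 0, 1; split => //; rewrite ?addr0 ?add0r// scale1r !scale0r !add0r.
move: (Tx); rewrite TE => -[r [s [t [r0 s0 t0 rst xE]]]].
move: px; rewrite xE affine_comb// -xE.
have [la ea] := le1 a Ta; have [lb eb] := le1 b Tb; have [lc ec] := le1 c Tc.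
by move=> /(convex_comb_eq1 r0 s0 t0 rst la lb lc)[/ea|/eb|/ec] ->;
  [apply: Or31|apply: Or32|apply: Or33].
Qed.

(** The extreme point argument of [vertex_in] for segments; the triangle supplies the barycentric
    coordinates that single out a' and b'. *)
Lemma seg_ends T a b c a' b' : is_triangle T a' b' c -> seg a b = seg a' b' ->
  (a' = a \/ a' = b) /\ (b' = a \/ b' = b).
Proof.
move=> [D _] E.
have [p [q [_ [hp hq _]]]] := bary_affineP D.
have [p1 q0 _ [p0 q1 _ _]] := bary_vertices D.
rewrite !hp !hq in p1 q0 p0 q1.
have sa : seg a b a by exists 1, 0; split => //; rewrite ?addr0// scale1r scale0r addr0.
have sb : seg a b b by exists 0, 1; split => //; rewrite ?add0r// scale1r scale0r add0r.
have sa' : seg a b a' by rewrite E; exists 1, 0; split => //; rewrite ?addr0// scale1r scale0r addr0.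
have sb' : seg a b b' by rewrite E; exists 0, 1; split => //; rewrite ?add0r// scale1r scale0r add0r.
have le1 y : seg a b y -> [/\ affine p y <= 1, affine p y = 1 -> a' = y,
    affine q y <= 1 & affine q y = 1 -> b' = y].
  rewrite E => -[s [t [s0 t0 st ->]]].
  rewrite !affine_comb2// p1 q0 p0 q1 !mulr0 !mulr1 addr0 add0r; split.
  - by rewrite -st lerDl.
  - move=> s1; have -> : t = 0 by apply: (addrI s); rewrite st s1 addr0.
    by rewrite s1 scale1r scale0r addr0.
  - by rewrite -st lerDr.
  - move=> t1; have -> : s = 0 by apply: (addIr t); rewrite st t1 add0r.
    by rewrite t1 scale1r scale0r add0r.
have [pa ea qa fa] := le1 a sa; have [pb eb qb fb] := le1 b sb.
split.
- move: (sa') => [s [t [s0 t0 st aE]]]; move: p1; rewrite aE affine_comb2// -aE => e.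
  have st0 : s + t + 0 = 1 by rewrite addr0.
  have e0 : s * affine p a + t * affine p b + 0 * 0 = 1 by rewrite mulr0 addr0.
  case: (convex_comb_eq1 s0 t0 (lexx 0) st0 pa pb ler01 e0) => [/ea|/eb|/eqP];
    [by left|by right|by rewrite eq_sym oner_eq0].
- move: (sb') => [s [t [s0 t0 st aE]]]; move: q1; rewrite aE affine_comb2// -aE => e.
  have st0 : s + t + 0 = 1 by rewrite addr0.
  have e0 : s * affine q a + t * affine q b + 0 * 0 = 1 by rewrite mulr0 addr0.
  case: (convex_comb_eq1 s0 t0 (lexx 0) st0 qa qb ler01 e0) => [/fa|/fb|/eqP];
    [by left|by right|by rewrite eq_sym oner_eq0].
Qed.

Lemma affine_interp T phi : triangle T -> exists p, forall x, vertex T x -> affine p x = phi x.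
Proof.
move=> [a [b [c tT]]]; have [D TE] := tT.
have [p [q [r [hp hq hr]]]] := bary_affineP D.
exists (phi a * p.1 + phi b * q.1 + phi c * r.1,
        phi a *: p.2 + phi b *: q.2 + phi c *: r.2) => x /(vertex_in tT) vx.
have -> : affine (phi a * p.1 + phi b * q.1 + phi c * r.1,
        phi a *: p.2 + phi b *: q.2 + phi c *: r.2) x =
   phi a * bary1 a b c x + phi b * bary2 a b c x + phi c * bary3 a b c x.
  by rewrite hp hq hr /affine /dotp /= /GRing.scale /=; ring.
have [e1 e2 e3 [e4 e5 e6 [e7 e8 e9]]] := bary_vertices D.
by case: vx => ->; rewrite ?e1 ?e2 ?e3 ?e4 ?e5 ?e6 ?e7 ?e8 ?e9; ring.
Qed.

(* Admissibility makes the vertexwise affine interpolants agree on the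
   intersection of two triangles. *)
Lemma interp_compat Tau phi p T T' x : admissible Tau ->
  (forall T, Tau T -> forall y, vertex T y -> affine (p T) y = phi y) ->
  Tau T -> Tau T' -> T x -> T' x -> affine (p T) x = affine (p T') x.
Proof.
move=> adm hp TT TT' Tx Tx'.
have [->//|/eqP TnT] := eqVneq T T'.
have Ix : (T `&` T') x by [].
case: (adm T T' TT TT' TnT) => [E|[y [vy vy' E]]|[S [[a [b [c [ta SE]]]] [a' [b' [c' [ta' SE']]]] E]]].
- by rewrite E in Ix.
- by move: Ix; rewrite E => ->; rewrite (hp T)// (hp T').
- have EE : seg a b = seg a' b' by rewrite -SE.
  have [ha hb] := seg_ends ta' EE.
  have [va vb _] := is_triangle_vertices ta; have [va' vb' _] := is_triangle_vertices ta'.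
  have Va : vertex T a' by case: ha => ->.
  have Vb : vertex T b' by case: hb => ->.
  move: Ix; rewrite E SE' => -[s [t [_ _ st ->]]]; rewrite !affine_comb2//.
  by rewrite !hp.
Qed.

Lemma bounded_diam T K : (forall x, T x -> `|x| <= K) ->
  has_ubound [set r | exists x y, [/\ T x, T y & r = enorm (x - y)]].
Proof.
move=> hK; exists (4 * K) => _ [x [y [Tx Ty ->]]].
have hx := hK x Tx; have hy := hK y Ty.
move: hx hy; rewrite !normp_le => /andP[x1 x2] /andP[y1 y2].
apply: le_trans (enorm_le_norm _) _ => /=.
have := ler_normB x.1 y.1; have := ler_normB x.2 y.2; lra.
Qed.

Lemma le_diam T K x y : (forall x, T x -> `|x| <= K) -> T x -> T y -> enorm (x - y) <= diam T.
Proof.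
move=> hK Tx Ty; apply: ub_le_sup; first exact: bounded_diam hK.
by exists x, y.
Qed.

(** To avoid proving that the supremum is attained, a ball of diameter above half of [indiam T] is
    taken: indiam T < 4 r, whence the factor 4. *)
Lemma inscribed_ball T K s : triangle T -> (forall x, T x -> `|x| <= K) -> 0 < s ->
  diam T / indiam T <= s -> exists c r, [/\ 0 < r, diam T <= 4 * s * r &
    forall x, enorm (x - c) <= r -> T x].
Proof.
move=> tT hK s0 hs; have [[c0 ic0] _] := triangle_interior tT.
have [d d0 hd] := openP (@open_interior _ T) ic0.
set S := [set d | exists (c : plane R) (r : R),
    [/\ 0 <= r, [set x | enorm (x - c) <= r] `<=` T & d = 2 * r]].
have Sd : S d.
  exists c0, (d / 2); split; [lra| |lra] => x /= xc.
  apply: interior_subset; apply: hd; apply: le_lt_trans (norm_le_enorm _) _; lra.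
have ubS : has_ubound S.
  exists (diam T) => _ [c [r [r0 cT ->]]].
  have T1 : T (c + (r, 0)).
    apply: cT => /=; rewrite addrC addKr enorm_le// /dotp /= mulr0 addr0 expr2//.
  have T2 : T (c - (r, 0)).
    apply: cT => /=; rewrite addrC addKr enorm_le// /dotp /= oppr0 mulr0 addr0 expr2 mulrNN//.
  have := le_diam hK T1 T2; apply: le_trans.
  have -> : c + (r, 0) - (c - (r, 0)) = (2 * r, 0).
    by apply/eqP; rewrite xpair_eqE /=; apply/andP; split; apply/eqP; ring.
  rewrite /enorm /dotp /= mulr0 addr0 -expr2 sqrtr_sqr; exact: ler_norm.
have hS : has_sup S by split => //; exists d.
have dS : d <= indiam T by exact: ub_le_sup.
(* If [indiam T] were 0, the quotient in [hs] would be the junk value 0 and say nothing. *)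
have i0 : 0 < indiam T by exact: lt_le_trans dS.
have i20 : 0 < indiam T / 2 by lra.
have [_ [c [r [r0 cT ->]]] hr] := sup_adherent i20 hS.
rewrite -/(indiam T) in hr.
exists c, r; split; [lra| |by move=> x xc; exact: cT].
move: hs; rewrite ler_pdivrMr// => hs; apply: le_trans hs _.
have -> : 4 * s * r = s * (4 * r) by ring.
by rewrite ler_pM2l//; lra.
Qed.

(** Global C^(1,1) regularity with gradient g, stated without second derivatives. *)
Definition quad phi g M :=
  forall x y, `|phi y - phi x - dotp (g x) (y - x)| <= M * dotp (y - x) (y - x).

(** Subtract from p the Taylor polynomial of phi at x: what is left is affine and at most M diam^2
    at the vertices, hence on T. Compared at opposite points of a ball of radius r inside T, it has
    slope at most M diam^2 / r, and diam <= 4 s r. *)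
Lemma interp_grad T K s phi g M p x : triangle T -> (forall x, T x -> `|x| <= K) -> 0 < s ->
  diam T / indiam T <= s -> 0 <= M -> quad phi g M ->
  (forall y, vertex T y -> affine p y = phi y) -> T x ->
  `|p.2.1 - (g x).1| <= 4 * s * M * diam T /\ `|p.2.2 - (g x).2| <= 4 * s * M * diam T.
Proof.
move=> tT hK s0 hs M0 qphi hp Tx.
have [c [r [r0 dr cT]]] := inscribed_ball tT hK s0 hs.
have aux1 (t1 t2 : R) : 2 * r * t1 <= 2 * t2 -> r * t1 <= t2 by move=> ?; lra.
have aux2 (t1 t2 t3 : R) : t1 <= t3 -> t2 <= t3 -> t1 + t2 <= 2 * t3 by move=> ? ?; lra.
have [a1 [b1 [c1 t1]]] := tT; have [D TE] := t1.
pose q : R * plane R := (p.1 - phi x + dotp (g x) x, p.2 - g x).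
have qE y : affine q y = affine p y - phi x - dotp (g x) (y - x).
  by rewrite /q /affine /dotp /=; ring.
have [va vb vc] := is_triangle_vertices t1.
have d0 : 0 <= diam T by apply: le_trans (le_diam hK Tx Tx); exact: enorm_ge0.
have inT : [/\ T a1, T b1 & T c1].
  rewrite TE; split.
  - by exists 1, 0, 0; split => //; rewrite ?addr0// scale1r !scale0r !addr0.
  - by exists 0, 1, 0; split => //; rewrite ?addr0 ?add0r// scale1r !scale0r add0r addr0.
  - by exists 0, 0, 1; split => //; rewrite ?addr0 ?add0r// scale1r !scale0r !add0r.
have [Ta Tb Tc] := inT.
have vq y : vertex T y -> T y -> `|affine q y| <= M * diam T ^+ 2.
  move=> vy Ty; rewrite qE hp//; apply: le_trans (qphi x y) _.
  by apply: ler_wpM2l => //; rewrite -enorm_le//; exact: le_diam hK Ty Tx.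
have Tq y : T y -> `|affine q y| <= M * diam T ^+ 2.
  move=> Ty; have [e1 [e2 [e3 [e10 e20 e30 e123 ->]]]] : hull3 a1 b1 c1 y by rewrite -TE.
  rewrite affine_comb//.
  rewrite (_ : M * diam T ^+ 2 = e1 * (M * diam T ^+ 2) + e2 * (M * diam T ^+ 2)
      + e3 * (M * diam T ^+ 2)); last by rewrite -!mulrDl e123 mul1r.
  apply: le_trans (ler_normD _ _) _; apply: lerD; last first.
    by rewrite normrM ger0_norm// ler_wpM2l// vq.
  apply: le_trans (ler_normD _ _) _; apply: lerD.
    by rewrite normrM ger0_norm// ler_wpM2l// vq.
  by rewrite normrM ger0_norm// ler_wpM2l// vq.
have main e : dotp e e = 1 -> `|dotp q.2 e| <= 4 * s * M * diam T.
  move=> e1.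
  have de t : dotp (t *: e) (t *: e) = t ^+ 2.
    by rewrite -[RHS]mulr1 -e1 /dotp /= /GRing.scale /=; ring.
  have T1 : T (c + r *: e).
    by apply: cT; rewrite addrC addKr (enorm_le _ (ltW r0)) de.
  have T2 : T (c - r *: e).
    by apply: cT; rewrite addrC addKr -scaleNr (enorm_le _ (ltW r0)) de sqrrN.
  have q1 := Tq _ T1; have q2 := Tq _ T2.
  have E : affine q (c + r *: e) - affine q (c - r *: e) = 2 * r * dotp q.2 e.
    by rewrite affineB /dotp /= /GRing.scale /=; ring.
  have h : `|2 * r * dotp q.2 e| <= 2 * (M * diam T ^+ 2).
    by rewrite -E; apply: le_trans (ler_normB _ _) _; exact: aux2.
  have r2 : 0 <= 2 * r by rewrite mulr_ge0// ltW.
  move: h; rewrite normrM (ger0_norm r2) => /aux1 h.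
  rewrite -(ler_pM2l r0); apply: le_trans h _.
  rewrite expr2 (_ : r * (4 * s * M * diam T) = M * ((4 * s * r) * diam T)); last by ring.
  by apply: ler_wpM2l => //; apply: ler_wpM2r.
have := main (1, 0); have := main (0, 1); rewrite /dotp /= !mulr1 !mulr0 !addr0 !add0r => h1 h2.
by split; [apply: h2|apply: h1]; rewrite ?mulr0 ?mulr1 ?addr0 ?add0r.
Qed.

(** On the frontier the interpolant is a combination of values at vertices that may lie inside
    [Omega]; this is why phi is asked to vanish on every triangle that touches the frontier. *)
Lemma interpolation Omega Tau s phi g M h : bounded_set Omega -> triangulation Omega Tau ->
  admissible Tau -> 0 < s -> (forall T, Tau T -> diam T / indiam T <= s) ->
  (forall T, Tau T -> diam T <= h) -> 0 <= M -> quad phi g M ->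
  (forall T x y, Tau T -> T x -> T y -> frontier Omega x -> phi y = 0) ->
  exists2 v, V10 Omega Tau v & forall T, Tau T -> exists2 p, (forall x, T x -> v x = affine p x) &
    forall x, T x -> `|p.2.1 - (g x).1| <= 4 * s * M * h /\ `|p.2.2 - (g x).2| <= 4 * s * M * h.
Proof.
move=> bO tri adm s0 hs hh M0 qphi phi0; have [_ tT _] := tri.
have [K K0 hK] := bounded_closure bO.
have TK T x : Tau T -> T x -> `|x| <= K.
  by move=> TT Tx; apply: hK; exact: (triangulation_sub tri TT).
have /choice[p hp] : forall T, exists p, Tau T -> forall x, vertex T x -> affine p x = phi x.
  move=> T; have [TT|nT] := pselect (Tau T); last by exists (0, 0).
  by have [p hp] := affine_interp phi (tT T TT); exists p.
have /choice[v hv] : forall x, exists r : R, forall T, Tau T -> T x -> r = affine (p T) x.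
  move=> x; have [[T [TT Tx]]|nx] := pselect (exists T, Tau T /\ T x).
    by exists (affine (p T) x) => T' TT' T'x; exact: (interp_compat adm hp TT TT' Tx T'x).
  by exists 0 => T TT Tx; exfalso; apply: nx; exists T.
have vT T x : Tau T -> T x -> v x = affine (p T) x by move=> TT Tx; exact: hv.
have v0 x : frontier Omega x -> v x = 0.
  move=> fx; have [cx _] := fx; have [T TT Tx] := triangulation_cover tri cx.
  have [a [b [c t1]]] := tT T TT; have [D TE] := t1.
  have [va vb vc] := is_triangle_vertices t1.
  have [Ta Tb Tc] : [/\ T a, T b & T c].
    rewrite TE; split.
    - by exists 1, 0, 0; split => //; rewrite ?addr0// scale1r !scale0r !addr0.
    - by exists 0, 1, 0; split => //; rewrite ?addr0 ?add0r// scale1r !scale0r add0r addr0.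
    - by exists 0, 0, 1; split => //; rewrite ?addr0 ?add0r// scale1r !scale0r !add0r.
  have [r [q [t [_ _ _ rqt xE]]]] : hull3 a b c x by rewrite -TE.
  rewrite (vT T)// xE affine_comb// (hp T TT a va) (hp T TT b vb) (hp T TT c vc).
  rewrite (phi0 T x a)// (phi0 T x b)// (phi0 T x c)//.
  by rewrite !mulr0 !addr0.
exists v; last first.
  move=> T TT; exists (p T); first by move=> x; exact: vT.
  move=> x Tx; have [h1 h2] := interp_grad (tT T TT) (fun x => @TK T x TT) s0 (hs T TT) M0 qphi (hp T TT) Tx.
  have le : 4 * s * M * diam T <= 4 * s * M * h.
    by apply: ler_wpM2l; [rewrite !mulr_ge0// ltW|exact: hh].
  by split; [exact: le_trans h1 le|exact: le_trans h2 le].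
split => //; split; last first.
  move=> T TT; exists (p T).1, (p T).2.1, (p T).2.2 => x Tx.
  by rewrite (vT T)// /affine /dotp addrA.
have [fT _ _] := tri.
have [L L0 hL] := finite_bound (fun T => `|(p T).2.1| + `|(p T).2.2|) fT.
have lip := V10_lip tri v0 L0 (fun T TT x Tx => vT T x TT Tx) hL.
apply: (@subspace_eq_continuous _ _ _ (v \_ (closure Omega))).
  by move=> x; rewrite inE => cx; rewrite /patch mem_set.
exact: continuous_subspaceT (lip_continuous L0 lip).
Qed.

End Interpolation.

(** * Functions with a second order Taylor bound *)

Section SecondOrder.
Variable R : realType.
Implicit Types (P : set (plane R)) (x y z e : plane R) (u v f phi psi : plane R -> R)
  (g k : plane R -> plane R) (n : nat) (K M S : R).
Let mu := leb2 R.

Let d2 x y : R := dotp (y - x) (y - x).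

(** C^(1,1) regularity on P with all bounds under one constant, for stability under products and
    compositions. The Lipschitz bound is squared so that only the quadratic form [d2] occurs. *)
Definition nice P phi g := exists2 K, 0 <= K & forall x, P x ->
  [/\ `|phi x| <= K, `|(g x).1| <= K, `|(g x).2| <= K & forall y, P y ->
    (phi y - phi x) ^+ 2 <= K * d2 x y /\
    `|phi y - phi x - dotp (g x) (y - x)| <= K * d2 x y].

Lemma niceD P phi psi g k : nice P phi g -> nice P psi k ->
  nice P (fun x => phi x + psi x) (fun x => g x + k x).
Proof.
move=> [K K0 hK] [M M0 hM]; exists (2 * (K + M)); first by lra.
move=> x Px; have [a1 a2 a3 a4] := hK x Px; have [b1 b2 b3 b4] := hM x Px.
have tri (s t : R) : `|s| <= K -> `|t| <= M -> `|s + t| <= 2 * (K + M).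
  by move=> h1 h2; apply: le_trans (ler_normD _ _) _; lra.
split; [exact: tri..|] => y Py; have [c1 c2] := a4 y Py; have [e1 e2] := b4 y Py.
have D0 : 0 <= d2 x y by exact: dotp_ge0.
split.
  set p := phi y - phi x in c1; set q := psi y - psi x in e1.
  have -> : phi y + psi y - (phi x + psi x) = p + q by rewrite /p /q; ring.
  have : 0 <= (p - q) ^+ 2 by exact: sqr_ge0.
  have -> : (p - q) ^+ 2 = 2 * (p ^+ 2 + q ^+ 2) - (p + q) ^+ 2 by ring.
  lra.
set p := phi y - _ - _ in c2; set q := psi y - _ - _ in e2.
have -> : phi y + psi y - (phi x + psi x) - dotp (g x + k x) (y - x) = p + q.
  by rewrite /p /q /dotp /=; ring.
apply: le_trans (ler_normD _ _) _.
have := mulr_ge0 (addr_ge0 K0 M0) D0; lra.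
Qed.

Lemma niceM P phi psi g k : nice P phi g -> nice P psi k ->
  nice P (fun x => phi x * psi x) (fun x => phi x *: k x + psi x *: g x).
Proof.
move=> [K' K0 hK] [M' M0 hM].
(* With a common K at least 1, every power of K that arises is at most [K ^+ 3]. *)
wlog [K [K1 hK1 hM1]] : / exists K, [/\ 1 <= K, K' <= K & M' <= K].
  apply; exists (1 + K' + M'); split; lra.
have KK : 0 <= K by lra.
exists (6 * K ^+ 3); first by rewrite mulr_ge0// exprn_ge0.
have K2 : K <= K ^+ 2 by rewrite expr2; have := ler_wpM2l KK K1; lra.
have K3 : K ^+ 2 <= K ^+ 3 by rewrite (exprS K 2); have := ler_wpM2l (exprn_ge0 2 KK) K1; lra.
move=> x Px; have [a1 a2 a3 a4] := hK x Px; have [b1 b2 b3 b4] := hM x Px.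
have pr (s t : R) : `|s| <= K -> `|t| <= K -> `|s * t| <= K ^+ 2.
  by move=> h1 h2; rewrite normrM expr2; apply: ler_pM.
have up1 (s : R) : `|s| <= K' -> `|s| <= K by move=> h; exact: le_trans hK1.
have up2 (s : R) : `|s| <= M' -> `|s| <= K by move=> h; exact: le_trans hM1.
have KP : 0 <= K ^+ 3 by rewrite exprn_ge0.
split.
- by have := pr _ _ (up1 _ a1) (up2 _ b1); lra.
- rewrite /= /GRing.scale /=; apply: le_trans (ler_normD _ _) _.
  by have := pr _ _ (up1 _ a1) (up2 _ b2); have := pr _ _ (up2 _ b1) (up1 _ a2); lra.
- rewrite /= /GRing.scale /=; apply: le_trans (ler_normD _ _) _.
  by have := pr _ _ (up1 _ a1) (up2 _ b3); have := pr _ _ (up2 _ b1) (up1 _ a3); lra.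
move=> y Py; have [c1 c2] := a4 y Py; have [e1 e2] := b4 y Py.
have [f1 _ _ _] := hM y Py.
have D0 : 0 <= d2 x y by exact: dotp_ge0.
have KD : K' * d2 x y <= K * d2 x y by exact: ler_wpM2r.
have MD : M' * d2 x y <= K * d2 x y by exact: ler_wpM2r.
set p := phi y - phi x in c1; set q := psi y - psi x in e1.
set ep := phi y - _ - _ in c2; set eq := psi y - _ - _ in e2.
have KKD : 0 <= K * d2 x y by exact: mulr_ge0.
have sqK (s : R) : `|s| <= K -> s ^+ 2 <= K ^+ 2.
  by move=> h; rewrite -(ger0_norm (sqr_ge0 s)) normrX lerXn2r ?nnegrE.
split.
  have -> : phi y * psi y - phi x * psi x = p * psi y + phi x * q by rewrite /p /q; ring.
  have h : (p * psi y + phi x * q) ^+ 2 <= 2 * (p ^+ 2 * psi y ^+ 2 + phi x ^+ 2 * q ^+ 2).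
    have : 0 <= (p * psi y - phi x * q) ^+ 2 by exact: sqr_ge0.
    have -> : (p * psi y - phi x * q) ^+ 2 = 2 * (p ^+ 2 * psi y ^+ 2 + phi x ^+ 2 * q ^+ 2)
      - (p * psi y + phi x * q) ^+ 2 by ring.
    lra.
  have h1 : p ^+ 2 * psi y ^+ 2 <= (K * d2 x y) * K ^+ 2.
    by apply: ler_pM; rewrite ?sqr_ge0//; [lra|exact: sqK (up2 _ f1)].
  have h2 : phi x ^+ 2 * q ^+ 2 <= K ^+ 2 * (K * d2 x y).
    by apply: ler_pM; rewrite ?sqr_ge0//; [exact: sqK (up1 _ a1)|lra].
  have -> : 6 * K ^+ 3 * d2 x y = 2 * ((K * d2 x y) * K ^+ 2 + K ^+ 2 * (K * d2 x y))
     + 2 * (K ^+ 3 * d2 x y) by ring.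
  have := mulr_ge0 KP D0; lra.
have -> : phi y * psi y - phi x * psi x - dotp (phi x *: k x + psi x *: g x) (y - x)
   = phi x * eq + psi x * ep + p * q.
  by rewrite /p /q /ep /eq /dotp /= /GRing.scale /=; ring.
have h1 : `|phi x * eq| <= K * (K * d2 x y).
  by rewrite normrM; apply: ler_pM => //; [exact: up1|exact: le_trans e2 MD].
have h2 : `|psi x * ep| <= K * (K * d2 x y).
  by rewrite normrM; apply: ler_pM => //; [exact: up2|exact: le_trans c2 KD].
have h3 : `|p * q| <= K * d2 x y.
  have r1 : 0 <= (p - q) ^+ 2 by exact: sqr_ge0.
  have r2 : 0 <= (p + q) ^+ 2 by exact: sqr_ge0.
  have r3 : (p - q) ^+ 2 = p ^+ 2 + q ^+ 2 - 2 * (p * q) by ring.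
  have r4 : (p + q) ^+ 2 = p ^+ 2 + q ^+ 2 + 2 * (p * q) by ring.
  rewrite r3 in r1; rewrite r4 in r2; rewrite ler_norml; lra.
apply: le_trans (ler_normD _ _) _; apply: le_trans (lerD (ler_normD _ _) (lexx _)) _.
have i1 : K * (K * d2 x y) <= K ^+ 3 * d2 x y.
  by rewrite mulrA -expr2 ler_wpM2r.
have i2 : K * d2 x y <= K ^+ 3 * d2 x y by rewrite ler_wpM2r//; lra.
have := mulr_ge0 KP D0; lra.
Qed.

(** F is controlled on Q only, since negative powers are C^(1,1) only away from 0. *)
Lemma nice_comp P phi g (F F' : R -> R) (Q : set R) K : nice P phi g ->
  (forall x, P x -> Q (phi x)) ->
  (forall s, Q s -> [/\ `|F s| <= K, `|F' s| <= K & forall t, Q t ->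
    `|F t - F s| <= K * `|t - s| /\ `|F t - F s - F' s * (t - s)| <= K * (t - s) ^+ 2]) ->
  nice P (fun x => F (phi x)) (fun x => F' (phi x) *: g x).
Proof.
move=> [K1 K10 hK] PQ hF.
wlog [L [L1 hL1 hL2]] : / exists L, [/\ 1 <= L, K <= L & K1 <= L].
  apply; exists (1 + `|K| + K1); split; try by have := ler_norm K; have := normr_ge0 K; lra.
have LL : 0 <= L by lra.
have L2 : L <= L ^+ 2 by rewrite expr2; have := ler_wpM2l LL L1; lra.
have L3 : L ^+ 2 <= L ^+ 3 by rewrite (exprS L 2); have := ler_wpM2l (exprn_ge0 2 LL) L1; lra.
have LP : 0 <= L ^+ 3 by rewrite exprn_ge0.
exists (2 * L ^+ 3); first by rewrite mulr_ge0.
move=> x Px; have [a1 a2 a3 a4] := hK x Px; have [b1 b2 b3] := hF _ (PQ x Px).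
have pr (s t : R) : `|s| <= K -> `|t| <= K1 -> `|s * t| <= L ^+ 2.
  by move=> h1 h2; rewrite normrM expr2; apply: ler_pM => //; [exact: le_trans hL1|exact: le_trans hL2].
split.
- by lra.
- by rewrite /= /GRing.scale /=; have := pr _ _ b2 a2; lra.
- by rewrite /= /GRing.scale /=; have := pr _ _ b2 a3; lra.
move=> y Py; have [c1 c2] := a4 y Py; have [e1 e2] := b3 _ (PQ y Py).
have D0 : 0 <= d2 x y by exact: dotp_ge0.
have LD : K1 * d2 x y <= L * d2 x y by exact: ler_wpM2r.
have LLD : 0 <= L * d2 x y by exact: mulr_ge0.
set p := phi y - phi x in c1 e1 e2 *.
have pL : p ^+ 2 <= L * d2 x y by lra.
split.
  have h : `|F (phi y) - F (phi x)| <= L * `|p|.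
    by apply: le_trans e1 _; exact: ler_wpM2r.
  have h' : (F (phi y) - F (phi x)) ^+ 2 <= (L * `|p|) ^+ 2.
    by rewrite -(ger0_norm (sqr_ge0 (_ - _))) normrX lerXn2r ?nnegrE ?mulr_ge0.
  apply: le_trans h' _; rewrite exprMn -normrX (ger0_norm (sqr_ge0 p)).
  apply: (@le_trans _ _ (L ^+ 2 * (L * d2 x y))); first by apply: ler_wpM2l => //; rewrite exprn_ge0.
  have -> : L ^+ 2 * (L * d2 x y) = L ^+ 3 * d2 x y by ring.
  have := mulr_ge0 LP D0; lra.
set ep := phi y - _ - _ in c2.
have -> : F (phi y) - F (phi x) - dotp (F' (phi x) *: g x) (y - x) =
   (F (phi y) - F (phi x) - F' (phi x) * p) + F' (phi x) * ep.
  by rewrite /p /ep /dotp /= /GRing.scale /=; ring.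
apply: le_trans (ler_normD _ _) _.
have h1 : K * p ^+ 2 <= L * (L * d2 x y).
  apply: (@le_trans _ _ (L * p ^+ 2)); first by rewrite ler_wpM2r ?sqr_ge0.
  exact: ler_wpM2l.
have h2 : `|F' (phi x) * ep| <= L * (L * d2 x y).
  by rewrite normrM; apply: ler_pM => //; [exact: le_trans hL1|exact: le_trans c2 LD].
have h3 : L * (L * d2 x y) <= L ^+ 3 * d2 x y by rewrite mulrA -expr2 ler_wpM2r.
lra.
Qed.

Lemma nice_affine P p K : (forall x, P x -> `|x| <= K) -> nice P (affine p) (fun=> p.2).
Proof.
move=> hK; pose B := `|p.2.1| + `|p.2.2|; have B0 : 0 <= B by rewrite addr_ge0.
exists (`|p.1| + B * `|K| + B + 2 * B ^+ 2).
  by rewrite !addr_ge0// ?mulr_ge0// ?sqr_ge0// exprn_ge0.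
have n1 := normr_ge0 p.2.1; have n2 := normr_ge0 p.2.2; have n0 := normr_ge0 p.1.
have s0 : 0 <= B ^+ 2 by rewrite exprn_ge0.
have BK : 0 <= B * `|K| by rewrite mulr_ge0.
move=> x Px; split.
- rewrite /affine; apply: le_trans (ler_normD _ _) _.
  have h : `|dotp p.2 x| <= B * `|K|.
    apply: le_trans (norm_dotp _ _) _; apply: ler_wpM2l => //.
    by apply: le_trans (hK x Px) _; exact: ler_norm.
  lra.
- by rewrite /B in BK s0 B0 *; lra.
- by rewrite /B in BK s0 B0 *; lra.
move=> y _; rewrite affineB subrr normr0; have D0 : 0 <= d2 x y by exact: dotp_ge0.
split; last by rewrite mulr_ge0//; lra.
apply: (@le_trans _ _ (2 * B ^+ 2 * d2 x y)); last by rewrite ler_wpM2r//; lra.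
rewrite -[X in X <= _](ger0_norm (sqr_ge0 _)) normrX.
have h := norm_dotp p.2 (y - x).
have h2 : `|dotp p.2 (y - x)| ^+ 2 <= (B * `|y - x|) ^+ 2 by rewrite lerXn2r ?nnegrE ?mulr_ge0.
apply: le_trans h2 _; rewrite exprMn.
have h3 : `|y - x| ^+ 2 <= d2 x y.
  by rewrite /d2 -enorm_sqr lerXn2r ?nnegrE ?enorm_ge0//; exact: norm_le_enorm.
have := ler_wpM2l s0 h3; have := mulr_ge0 s0 D0; lra.
Qed.

(** The annulus where [dotp (x - z) (x - z)] is between S and 4 S separates the support from the
    region without Taylor bound: for points on its two sides, |y - x|^2 >= S, so that terms of order
    zero and one are absorbed by a multiple of |y - x|^2 / S. *)
Lemma quad_ext z S phi g : 0 < S -> 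
  nice [set x | dotp (x - z) (x - z) <= 4 * S] phi g ->
  (forall x, S <= dotp (x - z) (x - z) -> phi x = 0 /\ g x = 0) ->
  exists M, [/\ 0 <= M, quad phi g M, forall x, `|phi x| <= M,
    forall x, `|(g x).1| <= M & forall x, `|(g x).2| <= M].
Proof.
move=> S0 [K K0 hK] out0.
exists (K + 4 * K / S + K).
have KS : 0 <= K / S by rewrite divr_ge0// ltW.
have bnd x : [/\ `|phi x| <= K, `|(g x).1| <= K & `|(g x).2| <= K].
  have [h|h] := leP (dotp (x - z) (x - z)) (4 * S); first by have [] := hK x h.
  have [-> ->] := out0 x ltac:(lra).
  by rewrite /= normr0.
split; [lra| |by move=> x; have [] := bnd x; lra..].
move=> x y; have D0 : 0 <= d2 x y by exact: dotp_ge0.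
(* With a' = a - z and b' = b - z, the inequality |b' - 2 a'|^2 >= 0 gives |b' - a'|^2 >= |b'|^2 / 2
   - |a'|^2 >= S. *)
have far : forall a b, dotp (a - z) (a - z) <= S -> 4 * S < dotp (b - z) (b - z) ->
   S <= dotp (b - a) (b - a).
  move=> a b ha hb.
  have : 0 <= dotp (b - z - (a - z) - (a - z)) (b - z - (a - z) - (a - z)) by exact: dotp_ge0.
  have -> : b - a = (b - z) - (a - z) by rewrite opprB addrA subrK.
  move: ha hb; move: (a - z) (b - z) => [a1 a2] [b1 b2]; rewrite /dotp /=; lra.
have DS : S <= d2 x y -> K <= K / S * d2 x y.
  move=> h; apply: (@le_trans _ _ (K / S * S)); first by rewrite divfK// gt_eqF.
  exact: ler_wpM2l.
have dsym : dotp (x - y) (x - y) = d2 x y by rewrite /d2 /dotp /=; ring.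
have KDD : 0 <= K * d2 x y by rewrite mulr_ge0.
have KSD : 0 <= K / S * d2 x y by rewrite mulr_ge0.
have [bp b1 b2] := bnd x; have [cp _ _] := bnd y.
have E : (K + 4 * K / S + K) * d2 x y = 2 * (K * d2 x y) + 4 * (K / S * d2 x y) by ring.
rewrite -/(d2 x y) E.
have [hx|hx] := leP (dotp (x - z) (x - z)) (4 * S); have [hy|hy] := leP (dotp (y - z) (y - z)) (4 * S).
- have [_ _ _ /(_ y hy)[_ h]] := hK x hx; lra.
- have [-> _] := out0 y ltac:(lra).
  have [hS|hS] := leP S (dotp (x - z) (x - z)).
    by have [-> ->] := out0 x hS; rewrite subrr /dotp !mul0r addr0 subr0 normr0; lra.
  have hfar := far x y (ltW hS) hy; have hDS := DS hfar.
  rewrite sub0r; apply: le_trans (ler_normB _ _) _; rewrite normrN.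
  have hd : `|dotp (g x) (y - x)| <= K * (2 + d2 x y).
    have one (t r : R) : `|t| <= K -> `|t * r| <= K * (1 + r * r / 2).
      move=> ht; rewrite normrM; apply: ler_pM => //.
      have : 0 <= (1 - `|r|) ^+ 2 by exact: sqr_ge0.
      have -> : r * r = `|r| * `|r| by rewrite -normrM ger0_norm// -expr2 sqr_ge0.
      have -> : (1 - `|r|) ^+ 2 = 1 - 2 * `|r| + `|r| * `|r| by ring.
      by have := normr_ge0 r; have := mulr_ge0 (normr_ge0 r) (normr_ge0 r); lra.
    have h1 := one _ (y - x).1 b1; have h2 := one _ (y - x).2 b2.
    rewrite {1}/dotp; apply: le_trans (ler_normD _ _) _.
    apply: le_trans (lerD h1 h2) _.
    rewrite -mulrDr; apply: ler_wpM2l => //.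
    by move: D0; rewrite /d2 /dotp; lra.
  lra.
- have [-> ->] := out0 x ltac:(lra).
  rewrite subr0 /dotp !mul0r addr0 subr0.
  have [hS|hS] := leP S (dotp (y - z) (y - z)).
    by have [-> _] := out0 y hS; rewrite normr0; lra.
  have := far y x (ltW hS) hx; rewrite dsym => /DS; lra.
- have [-> ->] := out0 x ltac:(lra); have [-> _] := out0 y ltac:(lra).
  by rewrite subrr /dotp !mul0r addr0 subr0 normr0; lra.
Qed.

(** The Taylor bound makes the difference quotients converge everywhere, at rate M / (n+1); in
    particular g is measurable, as a pointwise limit. *)
Lemma quad_aegrad phi g M K : quad phi g M -> 0 <= M -> (forall x, `|phi x| <= M) ->
  (forall x, `|(g x).1| <= M) -> (forall x, `|(g x).2| <= M) ->
  (forall x, K < `|x| -> phi x = 0 /\ g x = 0) -> has_aegrad phi g.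
Proof.
move=> qp M0 bp b1 b2 out0.
have dge e x : coord_dir e -> `|dotp (g x) e| <= M.
  by case=> ->; rewrite /dotp /= ?mulr0 ?addr0 ?add0r ?mulr1 ?mulrN1 ?normrN.
have dqe e n x : coord_dir e -> `|dq e n phi x - dotp (g x) e| <= M * n.+1%:R^-1.
  move=> ce; have n0 : (0 : R) < n.+1%:R by rewrite ltr0n.
  have := qp x (x + n.+1%:R^-1 *: e).
  have -> : x + n.+1%:R^-1 *: e - x = n.+1%:R^-1 *: e by rewrite addrC addKr.
  have -> : dotp (n.+1%:R^-1 *: e) (n.+1%:R^-1 *: e) = n.+1%:R^-1 ^+ 2.
    by rewrite /dotp /= /GRing.scale /=; case: ce => -> /=; ring.
  have -> : dq e n phi x - dotp (g x) e =
    (phi (x + n.+1%:R^-1 *: e) - phi x - dotp (g x) (n.+1%:R^-1 *: e)) * n.+1%:R.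
    have : n.+1%:R != 0 :> R by rewrite gt_eqF.
    by rewrite /dq /dotp /= /GRing.scale /=; move: (n.+1%:R : R) => N N0; field.
  move=> h; rewrite normrM normr_nat -ler_pdivlMr//.
  by rewrite -mulrA -expr2.
have cp : continuous phi.
  move=> x; apply/cvgrPdist_lt => e e0.
  pose C := 4 * M + 1; have C0 : 0 < C by rewrite /C; lra.
  have eC : 0 < Num.min 1 (e / C) by rewrite lt_min ltr01 divr_gt0.
  apply: filterS (nbhsx_ballx x _ eC) => y; rewrite -ball_normE /= lt_min distrC => /andP[y1 y2].
  rewrite distrC.
  have h0 := qp x y; have h1 := norm_dotp (g x) (y - x).
  have h2 : dotp (y - x) (y - x) <= 2 * `|y - x|.
    have := norm_dotp (y - x) (y - x); have := ler_norm (dotp (y - x) (y - x)).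
    have : `|(y - x).1| + `|(y - x).2| <= 2.
      by move: y1; rewrite normp_lt => /andP[]; lra.
    move=> k1 k2 k3; have := ler_wpM2r (normr_ge0 (y - x)) k1; lra.
  have h3 : `|dotp (g x) (y - x)| <= 2 * M * `|y - x|.
    apply: le_trans h1 _; apply: ler_wpM2r => //; have := b1 x; have := b2 x; lra.
  have h4 : `|phi y - phi x| <= 4 * M * `|y - x|.
    rewrite -(subrK (dotp (g x) (y - x)) (phi y - phi x)).
    apply: le_trans (ler_normD _ _) _; have := ler_wpM2l M0 h2; lra.
  apply: le_lt_trans h4 _; apply: (@le_lt_trans _ _ (C * `|y - x|)).
    by rewrite ler_wpM2r// /C lerDl.
  by rewrite mulrC -ltr_pdivlMr.
have mp := continuous_measurable_plane cp.
have L : forall e, coord_dir e -> forall x, dq e n phi x @[n --> \oo] --> dotp (g x) e.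
  move=> e ce x; apply/cvgrPdist_le => r r0.
  have M1 : 0 < r / (M + 1) by rewrite divr_gt0//; lra.
  have : \forall n \near \oo, n.+1%:R^-1 < r / (M + 1) := near_infty_natSinv_lt (PosNum M1).
  apply: filterS => n hn; rewrite distrC; apply: le_trans (dqe e n x ce) _.
  have M1' : 0 < M + 1 by lra.
  move: hn; rewrite ltr_pdivlMr// => hn.
  have : (0 : R) <= n.+1%:R^-1 by rewrite invr_ge0.
  by move: hn; move: (n.+1%:R^-1 : R) => iv; lra.
have mdq e n : measurable_plane setT (dq e n phi).
  apply: measurable_realfun.measurable_funM => //.
  apply: measurable_realfun.measurable_funB => //.
  exact: (measurableT_comp mp (measurable_shift_plane _)).
have mg e : coord_dir e -> measurable_plane setT (fun x => dotp (g x) e).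
  move=> ce; apply: (measurable_realfun.measurable_fun_cvg (h := fun n => dq e n phi)) => [n|x _].
    exact: mdq.
  exact: L.
have e1 : coord_dir ((1, 0) : plane R) by exact: Or41.
have e2 : coord_dir ((0, 1) : plane R) by exact: Or42.
have mg1 : measurable_plane setT (fun x => (g x).1).
  rewrite (_ : (fun x => _) = (fun x => dotp (g x) (1, 0))); first exact: mg.
  by apply/funext => x; rewrite /dotp /= mulr1 mulr0 addr0.
have mg2 : measurable_plane setT (fun x => (g x).2).
  rewrite (_ : (fun x => _) = (fun x => dotp (g x) (0, 1))); first exact: mg.
  by apply/funext => x; rewrite /dotp /= mulr1 mulr0 add0r.
split; last by apply: ae_all => x e ce; exact: L.
exists (2 * M + `|K|).
have nK := normr_ge0 K; have lK := ler_norm K.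
split.
- split=> // x; first by have := bp x; lra.
  by move=> hx; have [] := out0 x ltac:(lra).
- split=> // x; first by have := b1 x; lra.
  by move=> hx; have [_ ->] := out0 x ltac:(lra).
- split=> // x; first by have := b2 x; lra.
  by move=> hx; have [_ ->] := out0 x ltac:(lra).
move=> e n x ce; have h1 := dqe e n x ce; have h2 := dge e x ce.
have h3 : M * n.+1%:R^-1 <= M.
  by rewrite ler_piMr// invf_le1 ?ltr0n// ler1n.
have h13 := le_trans h1 h3.
have := ler_normD (dq e n phi x - dotp (g x) e) (dotp (g x) e); rewrite subrK.
move=> /le_trans; apply; have := lerD h13 h2; lra.
Qed.

End SecondOrder.

(** * Taylor bounds for negative powers and for the squared positive part *)

Section RealPowers.
Variable R : realType.
Implicit Types s t c m r : R.

Lemma powR_pred t m : 0 < t -> t `^ (m - 1) * t = t `^ m.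
Proof.
move=> t0; rewrite -{2}(powRr1 (ltW t0)) -powRD ?subrK//.
by apply/implyP => _; rewrite gt_eqF.
Qed.

(** The graph of the convex function t^m lies above its tangents. By homogeneity this reduces to z^m
    >= 1 + m (z - 1), which follows from exp x >= 1 + x used twice, since m < 0. *)
Lemma powR_tangent s t m : m < 0 -> 0 < s -> 0 < t ->
  m * t `^ (m - 1) * (s - t) <= s `^ m - t `^ m.
Proof.
move=> m0 s0 t0; have z0 : 0 < s / t by rewrite divr_gt0.
have tn : t != 0 by rewrite gt_eqF.
have -> : s `^ m = t `^ m * (s / t) `^ m.
  by rewrite -powRM ?ltW//; congr (_ `^ _); field.
have h : 1 + m * (s / t - 1) <= (s / t) `^ m.
  rewrite /powR gt_eqF//.
  have h1 := expR_ge1Dx (m * ln (s / t)).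
  have h2 := expR_ge1Dx (ln (s / t)); rewrite lnK ?posrE// in h2.
  have : m * (s / t - 1) <= m * ln (s / t) by rewrite ler_nM2l//; lra.
  lra.
have := ler_wpM2l (powR_ge0 t m) h.
rewrite -(powR_pred m t0).
have -> : t `^ (m - 1) * t * (1 + m * (s / t - 1)) = t `^ (m - 1) * t + m * t `^ (m - 1) * (s - t).
  by field.
lra.
Qed.

Lemma powR_le_neg c t m : m <= 0 -> 0 < c -> c <= t -> t `^ m <= c `^ m.
Proof.
move=> m0 c0 ct; have t0 := lt_le_trans c0 ct.
rewrite /powR !gt_eqF// ler_expR ler_wnM2l// ler_ln//.
Qed.

Lemma powR_lip c s t m : m < 0 -> 0 < c -> c <= s -> c <= t ->
  `|s `^ m - t `^ m| <= - m * c `^ (m - 1) * `|s - t|.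
Proof.
move=> m0 c0; have one a b : c <= a -> c <= b -> b `^ m - a `^ m <= - m * c `^ (m - 1) * `|a - b|.
  move=> ca cb; have b0 := lt_le_trans c0 cb.
  have := powR_tangent m0 (lt_le_trans c0 ca) b0.
  have h1 : b `^ (m - 1) <= c `^ (m - 1) by apply: powR_le_neg => //; lra.
  have h2 : - m * b `^ (m - 1) * (a - b) <= - m * c `^ (m - 1) * `|a - b|.
    apply: (@le_trans _ _ (- m * b `^ (m - 1) * `|a - b|)).
      by apply: ler_wpM2l; [rewrite mulr_ge0 ?powR_ge0//; lra|exact: ler_norm].
    apply: ler_wpM2r => //; apply: ler_wpM2l => //; lra.
  lra.
move=> cs ct; rewrite ler_norml; have h1 := one s t cs ct; have := one t s ct cs.
by rewrite distrC => h2; apply/andP; split; lra.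
Qed.

(** The tangents at s and at t enclose the Taylor remainder between 0 and (t - s) times the change
    of slope, which [powR_lip] bounds for the exponent m - 1. *)
Lemma powR_C2 m c : m < 0 -> 0 < c -> exists K, forall s, c <= s ->
  [/\ `|s `^ m| <= K, `|m * s `^ (m - 1)| <= K & forall t, c <= t ->
    `|t `^ m - s `^ m| <= K * `|t - s| /\
    `|t `^ m - s `^ m - m * s `^ (m - 1) * (t - s)| <= K * (t - s) ^+ 2].
Proof.
move=> m0 c0; have m1 : m - 1 < 0 by lra.
pose K1 := c `^ m; pose K2 := - m * c `^ (m - 1).
pose K3 := - m * (- (m - 1) * c `^ (m - 1 - 1)).
have k1 : 0 <= K1 by exact: powR_ge0.
have k2 : 0 <= K2 by rewrite mulr_ge0 ?powR_ge0//; lra.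
have k3 : 0 <= K3 by rewrite !mulr_ge0 ?powR_ge0//; lra.
exists (K1 + K2 + K3) => s cs; have s0 := lt_le_trans c0 cs.
split.
- rewrite ger0_norm ?powR_ge0//; have : s `^ m <= K1 by apply: powR_le_neg => //; lra. lra.
- rewrite normrM ltr0_norm// ger0_norm ?powR_ge0//.
  have : - m * s `^ (m - 1) <= K2.
    by apply: ler_wpM2l; [lra|apply: powR_le_neg => //; lra].
  lra.
move=> t ct; split.
  apply: le_trans (powR_lip m0 c0 ct cs) _; apply: ler_wpM2r => //; rewrite -/K2; lra.
have t0 := lt_le_trans c0 ct.
have lo := powR_tangent m0 t0 s0; have up := powR_tangent m0 s0 t0.
have h : m * (t `^ (m - 1) - s `^ (m - 1)) * (t - s) <= K3 * (t - s) ^+ 2.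
  apply: le_trans (ler_norm _) _; rewrite !normrM ltr0_norm// -mulrA.
  rewrite /K3 -mulrA; apply: ler_wpM2l; first by lra.
  have -> : (t - s) ^+ 2 = `|t - s| * `|t - s| by rewrite -normrM ger0_norm ?expr2// -expr2 sqr_ge0.
  rewrite mulrA; apply: ler_wpM2r => //.
  exact: powR_lip.
have S0 : 0 <= (t - s) ^+ 2 by exact: sqr_ge0.
have : K3 * (t - s) ^+ 2 <= (K1 + K2 + K3) * (t - s) ^+ 2 by apply: ler_wpM2r => //; lra.
have e1 : m * (t `^ (m - 1) - s `^ (m - 1)) * (t - s) = 
  - (m * t `^ (m - 1) * (s - t)) - m * s `^ (m - 1) * (t - s) by ring.
rewrite e1 in h; have K0 : 0 <= (K1 + K2 + K3) * (t - s) ^+ 2 by rewrite mulr_ge0//; lra.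
rewrite ler_norml; lra.
Qed.

(** Its square is C^(1,1); it serves both for the cut-off at S and for the correction in [reg]. *)
Definition pos t := Num.max t 0.

Lemma pos_C2 B : exists K, forall s, `|s| <= B ->
  [/\ `|pos s ^+ 2| <= K, `|2 * pos s| <= K & forall t, `|t| <= B ->
    `|pos t ^+ 2 - pos s ^+ 2| <= K * `|t - s| /\
    `|pos t ^+ 2 - pos s ^+ 2 - 2 * pos s * (t - s)| <= K * (t - s) ^+ 2].
Proof.
have posP u : (0 <= u /\ pos u = u) \/ (u <= 0 /\ pos u = 0).
  by rewrite /pos; case: (leP u 0) => h; [right|left]; split => //; exact: ltW.
exists (1 + 2 * `|B| + B ^+ 2) => s sB.
have B0 : 0 <= B by exact: le_trans sB.
rewrite (ger0_norm B0); move: sB; rewrite ler_norml => /andP[s1 s2].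
have ps0 : 0 <= pos s <= B by case: (posP s) => -[h ->]; lra.
have B2 : 0 <= B ^+ 2 by exact: sqr_ge0.
have psB : pos s ^+ 2 <= B ^+ 2 by rewrite lerXn2r ?nnegrE//; lra.
split.
- by rewrite ger0_norm ?sqr_ge0//; lra.
- by rewrite ger0_norm; lra.
move=> t; rewrite ler_norml => /andP[t1 t2].
have pt0 : 0 <= pos t <= B by case: (posP t) => -[h ->]; lra.
have sq : 0 <= (t - s) ^+ 2 by exact: sqr_ge0.
split.
  have -> : pos t ^+ 2 - pos s ^+ 2 = (pos t + pos s) * (pos t - pos s) by ring.
  rewrite normrM; apply: ler_pM => //.
    by rewrite ger0_norm; lra.
  have : `|pos t - pos s| <= `|t - s|.
    have n1 := ler_norm (t - s); have := ler_norm (s - t); rewrite distrC => n2.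
    by rewrite ler_norml; case: (posP t) => -[h1 ->]; case: (posP s) => -[h2 ->];
      apply/andP; split; lra.
  done.
apply: (@le_trans _ _ (1 * (t - s) ^+ 2)); last by apply: ler_wpM2r => //; lra.
rewrite mul1r ler_norml.
by case: (posP t) => -[h1 ->]; case: (posP s) => -[h2 ->]; rewrite ?expr2 in sq *;
  apply/andP; split; nra.
Qed.

End RealPowers.

(** * The singular solution and its regularization *)

Section Singular.
Variables (R : realType) (m S : R) (z : plane R).
Hypotheses (m0 : m < 0) (m1 : - 2^-1 < m) (S0 : 0 < S).
Implicit Types (x y : plane R) (D t : R).

Ltac slra := have := m0; have := m1; have := S0; move=> ? ? ?; lra.
Ltac snra := have := m0; have := m1; have := S0; move=> ? ? ?; nra.

Let lam := 2 * m + 1.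
Let y1 x := x.1 - z.1.
Let y2 x := x.2 - z.2.

Definition sqdist x := dotp (x - z) (x - z).
Let q := sqdist.

(* [reg D] is C^(1,1), at least D / 2, and equal to the identity on [D, +oo):
   it removes the singularity of [t `^ m] at 0. *)
Definition reg D t := t + pos (D - t) ^+ 2 / (2 * D).
Definition dreg D t := 1 - pos (D - t) / D.
Definition prof D t := reg D t `^ m * pos (S - t) ^+ 2.
Definition dprof D t := m * reg D t `^ (m - 1) * dreg D t * pos (S - t) ^+ 2
  - 2 * reg D t `^ m * pos (S - t).

(* If [prof D t] is replaced by [t `^ m], then [coef] times [gsol D] is
   [gstream D] rotated by a right angle; [defectE] computes what is left after
   the regularization at 0 and the cut-off at S. *)
Definition sol D x := y1 x * prof D (q x).
Definition gsol D x : plane R :=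
  (prof D (q x) + 2 * y1 x * y1 x * dprof D (q x), 2 * y1 x * y2 x * dprof D (q x)).
Definition stream D x := lam * (y2 x * prof D (q x)).
Definition gstream D x : plane R :=
  (lam * (2 * y1 x * y2 x * dprof D (q x)),
   lam * (prof D (q x) + 2 * y2 x * y2 x * dprof D (q x))).

Lemma sqdistE x : q x = y1 x ^+ 2 + y2 x ^+ 2.
Proof. by rewrite /q /sqdist /dotp !expr2. Qed.

Lemma sqdist_ge0 x : 0 <= q x.
Proof. exact: dotp_ge0. Qed.

Lemma reg_ge D t : 0 < D -> 0 <= t -> D / 2 <= reg D t.
Proof.
move=> D0 t0; rewrite /reg /pos; case: (leP (D - t) 0) => h.
  by rewrite expr2 mul0r mul0r; slra.
have -> : t + (D - t) ^+ 2 / (2 * D) = D / 2 + t ^+ 2 / (2 * D).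
  by field; rewrite gt_eqF.
by rewrite lerDl divr_ge0 ?sqr_ge0// mulr_ge0// ltW.
Qed.

Lemma nice_eq P (phi psi : plane R -> R) g k : nice P phi g -> (forall x, psi x = phi x) ->
  (forall x, k x = g x) -> nice P psi k.
Proof. by move=> h e1 e2; rewrite (funext e1) (funext e2). Qed.

Let P : set (plane R) := [set x | q x <= 4 * S].

Let P_bounded x : P x -> `|x| <= `|z| + (1 + 4 * S).
Proof.
move=> Px; rewrite -{1}(subrK z x) addrC; apply: le_trans (ler_normD _ _) _.
rewrite lerD2l; apply: le_trans (norm_le_enorm _) _; rewrite enorm_le; last by slra.
have : q x <= 4 * S := Px; rewrite -/(sqdist x) -/q => h; apply: le_trans h _.
by rewrite expr2; snra.
Qed.

Let nice_cst c : nice P (fun=> c) (fun=> 0).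
Proof.
apply: (nice_eq (nice_affine (c, 0) P_bounded)) => // x.
by rewrite /affine /dotp /= !mul0r !addr0.
Qed.

Let nice_y1 : nice P y1 (fun=> (1, 0)).
Proof.
apply: (nice_eq (nice_affine (- z.1, (1, 0)) P_bounded)) => // x.
by rewrite /affine /dotp /= mul1r mul0r addr0 addrC.
Qed.

Let nice_y2 : nice P y2 (fun=> (0, 1)).
Proof.
apply: (nice_eq (nice_affine (- z.2, (0, 1)) P_bounded)) => // x.
by rewrite /affine /dotp /= mul1r mul0r add0r addrC.
Qed.

Let nice_q : nice P q (fun x => 2 *: (x - z)).
Proof.
apply: (nice_eq (niceD (niceM nice_y1 nice_y1) (niceM nice_y2 nice_y2))) => x.
  by rewrite sqdistE !expr2.
apply/eqP; rewrite xpair_eqE /= /GRing.scale /= /y1 /y2.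
by apply/andP; split; apply/eqP; ring.
Qed.

Let nice_posq c : nice P (fun x => pos (c - q x) ^+ 2) (fun x => (- (4 * pos (c - q x))) *: (x - z)).
Proof.
have [K hK] := pos_C2 (`|c| + 4 * S).
have h := niceD (nice_cst c) (niceM (nice_cst (-1)) nice_q).
have Q x : P x -> `|c + -1 * q x| <= `|c| + 4 * S.
  move=> Px; apply: le_trans (ler_normD _ _) _; rewrite lerD2l mulN1r normrN ger0_norm//.
  exact: sqdist_ge0.
apply: (nice_eq (nice_comp h Q hK)) => x; first by rewrite mulN1r.
apply/eqP; rewrite xpair_eqE /= /GRing.scale /= mulN1r.
by apply/andP; split; apply/eqP; ring.
Qed.

Let nice_reg D : 0 < D -> nice P (fun x => reg D (q x)) (fun x => (2 * dreg D (q x)) *: (x - z)).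
Proof.
move=> D0; apply: (nice_eq (niceD nice_q (niceM (nice_posq D) (nice_cst (2 * D)^-1)))) => x //.
apply/eqP; rewrite xpair_eqE /= /GRing.scale /= /dreg.
by apply/andP; split; apply/eqP; field; rewrite gt_eqF.
Qed.

Let nice_prof D : 0 < D ->
  nice P (fun x => prof D (q x)) (fun x => (2 * dprof D (q x)) *: (x - z)).
Proof.
move=> D0; have D20 : 0 < D / 2 by slra.
have [K hK] := powR_C2 m0 D20.
have Q x : P x -> D / 2 <= reg D (q x) by move=> _; apply: reg_ge => //; exact: sqdist_ge0.
have h := nice_comp (F := fun s => s `^ m) (F' := fun s => m * s `^ (m - 1))
  (Q := [set s | D / 2 <= s]) (nice_reg D0) Q hK.
apply: (nice_eq (niceM h (nice_posq S))) => x //.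
apply/eqP; rewrite xpair_eqE /= /GRing.scale /= /dprof.
by apply/andP; split; apply/eqP; ring.
Qed.

Lemma nice_sol D : 0 < D -> nice P (sol D) (gsol D).
Proof.
move=> D0; apply: (nice_eq (niceM nice_y1 (nice_prof D0))) => x //.
apply/eqP; rewrite xpair_eqE /= /GRing.scale /= /y1 /y2.
by apply/andP; split; apply/eqP; ring.
Qed.

Lemma nice_stream D : 0 < D -> nice P (stream D) (gstream D).
Proof.
move=> D0; apply: (nice_eq (niceM (nice_cst lam) (niceM nice_y2 (nice_prof D0)))) => x //.
apply/eqP; rewrite xpair_eqE /= /GRing.scale /= /y1 /y2.
by apply/andP; split; apply/eqP; ring.
Qed.

Lemma prof_out D t : S <= t -> prof D t = 0 /\ dprof D t = 0.
Proof.
move=> h; have p0 : pos (S - t) = 0 by rewrite /pos max_r// subr_le0.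
by rewrite /prof /dprof p0 expr2 !mulr0 subr0.
Qed.

Lemma sol_out D x : S <= q x -> sol D x = 0 /\ gsol D x = 0.
Proof. by move=> /(prof_out D)[h1 h2]; rewrite /sol /gsol h1 h2 !mulr0 addr0. Qed.

Lemma stream_out D x : S <= q x -> stream D x = 0 /\ gstream D x = 0.
Proof. by move=> /(prof_out D)[h1 h2]; rewrite /stream /gstream h1 h2 !mulr0 addr0 mulr0. Qed.

Lemma far_sqdist x : `|z| + (1 + 4 * S) < `|x| -> S <= q x.
Proof.
move=> h; rewrite leNgt; apply/negP => h'; have : P x by rewrite /P /=; slra.
by move=> /P_bounded; rewrite leNgt h.
Qed.

Lemma sol_quad D : 0 < D -> exists M, [/\ 0 <= M, quad (sol D) (gsol D) M
  & has_aegrad (sol D) (gsol D)].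
Proof.
move=> D0; have [M [M0 qM b b1 b2]] := quad_ext S0 (nice_sol D0) (@sol_out D).
exists M; split => //; apply: (quad_aegrad qM M0 b b1 b2 (K := `|z| + (1 + 4 * S))) => x hx.
exact/sol_out/far_sqdist.
Qed.

Lemma stream_aegrad D : 0 < D -> has_aegrad (stream D) (gstream D).
Proof.
move=> D0; have [M [M0 qM b b1 b2]] := quad_ext S0 (nice_stream D0) (@stream_out D).
apply: (quad_aegrad qM M0 b b1 b2 (K := `|z| + (1 + 4 * S))) => x hx.
exact/stream_out/far_sqdist.
Qed.

Definition yc x (i : 'I_2) := if i == ord0 then y1 x else y2 x.

(* Eigenvalue 1 in the radial direction and [lam ^+ 2] in the tangential one; at
   z, where the quotient is the junk value 0, both are [lam ^+ 2]. *)
Definition coef x : 'M[R]_2 :=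
  \matrix_(i, j) ((lam ^+ 2) *+ (i == j) + (1 - lam ^+ 2) * (yc x i * yc x j / q x)).

Lemma coefE x p : mx_app (coef x) p =
  (lam ^+ 2 * p.1 + (1 - lam ^+ 2) * (y1 x * (y1 x * p.1 + y2 x * p.2) / q x),
   lam ^+ 2 * p.2 + (1 - lam ^+ 2) * (y2 x * (y1 x * p.1 + y2 x * p.2) / q x)).
Proof.
rewrite /mx_app /coef !mxE /= /yc /= !mulr1n !mulr0n !add0r.
by apply/eqP; rewrite xpair_eqE; apply/andP; split; apply/eqP; ring.
Qed.

Lemma lam01 : 0 < lam < 1.
Proof. by rewrite /lam; slra. Qed.

Lemma coef_elliptic x p : lam ^+ 2 * dotp p p <= dotp (mx_app (coef x) p) p.
Proof.
have /andP[l0 l1] := lam01.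
rewrite coefE {2}/dotp /=.
have -> : (lam ^+ 2 * p.1 + (1 - lam ^+ 2) * (y1 x * (y1 x * p.1 + y2 x * p.2) / q x)) * p.1 +
  (lam ^+ 2 * p.2 + (1 - lam ^+ 2) * (y2 x * (y1 x * p.1 + y2 x * p.2) / q x)) * p.2 =
  lam ^+ 2 * dotp p p + (1 - lam ^+ 2) * ((y1 x * p.1 + y2 x * p.2) ^+ 2 / q x).
  by rewrite /dotp; ring.
rewrite lerDl mulr_ge0//; last by rewrite divr_ge0 ?sqr_ge0// sqdist_ge0.
by rewrite subr_ge0 expr_le1// ltW.
Qed.

Lemma yc_bound x i j : `|yc x i * yc x j / q x| <= 1.
Proof.
have [q0|q0] := eqVneq (q x) 0; first by rewrite q0 invr0 mulr0 normr0.
have qp : 0 < q x by rewrite lt_def q0 sqdist_ge0.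
rewrite normrM [X in _ * X]ger0_norm ?invr_ge0 ?(ltW qp)// ler_pdivrMr// mul1r sqdistE.
have h1 : 0 <= (y1 x - y2 x) ^+ 2 by exact: sqr_ge0.
have h2 : 0 <= (y1 x + y2 x) ^+ 2 by exact: sqr_ge0.
have h3 : 0 <= y1 x ^+ 2 by exact: sqr_ge0.
have h4 : 0 <= y2 x ^+ 2 by exact: sqr_ge0.
rewrite /yc ler_norml; case: ifP => _; case: ifP => _; rewrite ?expr2 in h1 h2 h3 h4 *;
  apply/andP; split; slra.
Qed.

Let my (i : 'I_2) : measurable_plane setT (fun x => yc x i).
Proof.
apply: continuous_measurable_plane; rewrite /yc /y1 /y2; case: (i == ord0).
  rewrite (_ : (fun x => _) = (fun x => - z.1 + 1 * x.1 + 0 * x.2)); first exact: cont_affine.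
  by apply/funext => x; ring.
rewrite (_ : (fun x => _) = (fun x => - z.2 + 0 * x.1 + 1 * x.2)); first exact: cont_affine.
by apply/funext => x; ring.
Qed.

Let mq : measurable_plane setT q.
Proof.
rewrite (_ : q = fun x => yc x ord0 * yc x ord0 + yc x ord_max * yc x ord_max); last first.
  by apply/funext => x; rewrite sqdistE /yc /= !expr2.
by apply: measurable_realfun.measurable_funD; apply: measurable_realfun.measurable_funM.
Qed.

Let mqinv : measurable_plane setT (fun x => (q x)^-1).
Proof.
rewrite (_ : (fun x => _) = (fun x => q x `^ (-1))); last first.
  by apply/funext => x; rewrite powR_inv1// sqdist_ge0.
exact: (measurableT_comp (measurable_powR _) mq).
Qed.

Lemma measurable_ycyc i j : measurable_plane setT (fun x => yc x i * yc x j / q x).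
Proof. by do 2 apply: measurable_realfun.measurable_funM => //. Qed.

Lemma bm_setT (Omega : set (plane R)) (f : plane R -> R) (M : R) : open Omega -> measurable_plane setT f -> (forall x, `|f x| <= M) ->
  bm Omega f.
Proof.
move=> oO mf fM; split; last by exists M.
by apply: measurable_funS mf => //; exact: measurableT.
Qed.

Lemma bm_coef (Omega : set (plane R)) i j : open Omega -> bm Omega (fun x => coef x i j).
Proof.
move=> oO; rewrite (_ : (fun x => _) = (fun x => (lam ^+ 2) *+ (i == j)
   + (1 - lam ^+ 2) * (yc x i * yc x j / q x))); last by apply/funext => x; rewrite mxE.
apply: bmD; first exact: bm_cst.
apply: bmM; first exact: bm_cst.
apply: (bm_setT oO (measurable_ycyc i j) (M := 1)) => x; exact: yc_bound.
Qed.

(** The value of A grad (y_1 a) minus the rotated gradient of lam y_2 a, for a radial profile a(t),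
    t = |y|^2; it depends on a only through b = t a' - m a. *)
Definition defect_field (b : R) x : plane R :=
  (- (2 * lam * b) + 2 * (1 + lam) * b * (yc x ord0 * yc x ord0 / q x),
   2 * (1 + lam) * b * (yc x ord0 * yc x ord_max / q x)).

(** It is 0 where the profile is a multiple of t^m: it measures the failure of t a' = m a. *)
Definition bdef D t := t * dprof D t - m * prof D t.
(** The same expression for the profile t^m (S - t)_+^2 without regularization: only the derivative
    of the cut-off survives, and the result is bounded near 0. *)
Definition bdef0 t := - (2 * t `^ (m + 1) * pos (S - t)).

Lemma defectE D x : mx_app (coef x) (gsol D x) - ((gstream D x).2, - (gstream D x).1) =
  defect_field (bdef D (q x)) x.
Proof.
rewrite coefE /gsol /gstream /defect_field /bdef /yc /=.
set a := prof D (q x); set a' := dprof D (q x).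
(* At z the junk quotient makes [coef] equal to lam^2 times the identity, and the identity still
   holds there since lam^2 - lam = 2 m lam. *)
have [q0|q0] := eqVneq (q x) 0.
  have := sqdistE x; rewrite q0 => /esym/eqP; rewrite paddr_eq0 ?sqr_ge0// !sqrf_eq0.
  move=> /andP[/eqP -> /eqP ->].
  by apply/eqP; rewrite xpair_eqE /= invr0 /lam; apply/andP; split; apply/eqP; ring.
have qE := sqdistE x; move: q0 qE; move: (q x) (y1 x) (y2 x) a a' => t p r a a' t0 tE.
apply/eqP; rewrite xpair_eqE /= /lam; apply/andP; split; apply/eqP.
  rewrite tE in t0 *; field; exact: t0.
rewrite tE in t0 *; field; exact: t0.
Qed.

Lemma reg_out D t : D <= t -> reg D t = t /\ dreg D t = 1.
Proof.
move=> h; have p0 : pos (D - t) = 0 by rewrite /pos max_r// subr_le0.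
by rewrite /reg /dreg p0 expr2 !mul0r addr0 subr0.
Qed.

Lemma bdef_out D t : 0 < D -> D <= t -> bdef D t = bdef0 t.
Proof.
move=> D0 Dt; have t0 := lt_le_trans D0 Dt; have [r1 r2] := reg_out Dt.
rewrite /bdef /bdef0 /dprof /prof r1 r2.
have e1 := powR_pred m t0; have e2 := powR_pred (m + 1) t0; rewrite addrK in e2.
rewrite -e2 -e1; ring.
Qed.

(** The bound grows as D tends to 0; what matters is that its square times D, the order of the area
    where t < D, is of order D^(2m + 1). The four terms contribute 2, 2, 1 and 2 to the constant
    7. *)
Lemma bdef_bound D t : 0 <= t -> t < D -> D <= S ->
  `|bdef D t - bdef0 t| <= 7 * S ^+ 2 * (D / 2) `^ m.
Proof.
move=> t0 tD DS; have D0 : 0 < D by slra.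
have k0 : pos (S - t) = S - t by rewrite /pos max_l//; slra.
have n2 := reg_ge D0 t0; have D20 : 0 < D / 2 by slra.
have n0 : 0 < reg D t by slra.
have pD : pos (D - t) = D - t by rewrite /pos max_l//; slra.
have dr : 0 <= dreg D t <= 1.
  rewrite /dreg pD; have -> : 1 - (D - t) / D = t / D by field; rewrite gt_eqF.
  apply/andP; split; first exact: divr_ge0 t0 (ltW D0).
  by rewrite ler_pdivrMr//; slra.
rewrite /bdef /bdef0 /dprof /prof k0.
have pn : reg D t `^ m <= (D / 2) `^ m by apply: powR_le_neg => //; slra.
have e1 := powR_pred m n0.
set w := (D / 2) `^ m in pn *; set v := reg D t `^ (m - 1) in e1 *.
set u := reg D t `^ m in pn e1 *; set d := dreg D t in dr *; set k := S - t.
have w0 : 0 <= w by exact: powR_ge0.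
have v0 : 0 <= v by exact: powR_ge0.
have u0 : 0 <= u by exact: powR_ge0.
have kS : 0 <= k <= S by rewrite /k; slra.
have vt : v * t <= 2 * u.
  have : v * t <= v * (2 * reg D t) by apply: ler_wpM2l => //; slra.
  have -> : v * (2 * reg D t) = 2 * u by rewrite -e1; ring.
  by [].
have tp : t `^ (m + 1) <= S * w.
  have h1 : t `^ (m + 1) <= D `^ (m + 1).
    by apply: ge0_ler_powR; rewrite ?nnegrE; slra.
  have e2 := powR_pred (m + 1) D0; rewrite addrK in e2.
  have h2 : D `^ m <= w by apply: powR_le_neg => //; slra.
  have h3 : D `^ m * D <= w * S by apply: ler_pM => //; [exact: powR_ge0|slra].
  by rewrite -e2 in h1; slra.
have tp0 : 0 <= t `^ (m + 1) by exact: powR_ge0.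
set b := t `^ (m + 1) in tp tp0 *.
have SS : 0 <= S ^+ 2 by exact: sqr_ge0.
have kk : 0 <= k ^+ 2 <= S ^+ 2 by rewrite sqr_ge0 lerXn2r ?nnegrE//; slra.
have vt0 : 0 <= v * t by rewrite mulr_ge0.
have A1 : 0 <= v * t * d * k ^+ 2 * - m <= 2 * (S ^+ 2 * w).
  have h1 : v * t * d <= 2 * w.
    apply: (@le_trans _ _ (v * t * 1)); first by apply: ler_wpM2l => //; slra.
    slra.
  have h0 : 0 <= v * t * d by rewrite mulr_ge0//; slra.
  have h2 : v * t * d * k ^+ 2 <= 2 * w * S ^+ 2 by apply: ler_pM => //; slra.
  have h3 : 0 <= v * t * d * k ^+ 2 by rewrite mulr_ge0//; slra.
  apply/andP; split; first by rewrite mulr_ge0//; slra.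
  apply: (@le_trans _ _ (v * t * d * k ^+ 2 * 1)); first by apply: ler_wpM2l => //; slra.
  slra.
have A2 : 0 <= u * (t * k) <= S ^+ 2 * w.
  have h0 : 0 <= t * k by rewrite mulr_ge0//; slra.
  have h1 : t * k <= S * S by apply: ler_pM; slra.
  apply/andP; split; first by rewrite mulr_ge0.
  by rewrite mulrC expr2; apply: ler_pM.
have A3 : 0 <= u * k ^+ 2 * - m <= S ^+ 2 * w.
  have h1 : u * k ^+ 2 <= w * S ^+ 2 by apply: ler_pM => //; slra.
  have h0 : 0 <= u * k ^+ 2 by rewrite mulr_ge0//; slra.
  apply/andP; split; first by rewrite mulr_ge0//; slra.
  apply: (@le_trans _ _ (u * k ^+ 2 * 1)); first by apply: ler_wpM2l => //; slra.
  slra.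
have A4 : 0 <= b * k <= S ^+ 2 * w.
  apply/andP; split; first by rewrite mulr_ge0//; slra.
  have -> : S ^+ 2 * w = S * w * S by ring.
  by apply: ler_pM => //; slra.
have -> : t * (m * v * d * k ^+ 2 - 2 * u * k) - m * (u * k ^+ 2) - - (2 * b * k) =
  - (v * t * d * k ^+ 2 * - m) - 2 * (u * (t * k)) + u * k ^+ 2 * - m + 2 * (b * k) by ring.
have -> : 7 * S ^+ 2 * w = 7 * (S ^+ 2 * w) by ring.
rewrite ler_norml; slra.
Qed.

(** The field is linear in b, with factors at most 2 * 2 + 2 because lam and the quotients are at
    most 1 in absolute value. *)
Lemma defect_field_bound b b' x :
  `|(defect_field b x).1 - (defect_field b' x).1| <= 6 * `|b - b'| /\
  `|(defect_field b x).2 - (defect_field b' x).2| <= 6 * `|b - b'|.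
Proof.
have /andP[l0 l1] := lam01; rewrite /defect_field /=.
have h1 := yc_bound x ord0 ord0; have h2 := yc_bound x ord0 ord_max.
move: h1 h2; set p := _ / _ => h1; set r := _ / _ => h2.
have bb := normr_ge0 (b - b').
split.
  have -> : - (2 * lam * b) + 2 * (1 + lam) * b * p - (- (2 * lam * b') + 2 * (1 + lam) * b' * p)
     = (2 * (1 + lam) * p - 2 * lam) * (b - b') by ring.
  rewrite normrM; apply: ler_wpM2r => //.
  move: h1; rewrite !ler_norml => /andP[h11 h12]; apply/andP; split; snra.
have -> : 2 * (1 + lam) * b * r - 2 * (1 + lam) * b' * r = (2 * (1 + lam) * r) * (b - b') by ring.
rewrite normrM; apply: ler_wpM2r => //.
move: h2; rewrite !ler_norml => /andP[h11 h12]; apply/andP; split; snra.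
Qed.

Lemma bdef0_bound t : 0 <= t -> `|bdef0 t| <= 2 * S `^ (m + 1) * S.
Proof.
move=> t0.
have pos0 u : 0 <= pos u :> R by rewrite /pos le_max lexx orbT.
have p1 : 0 <= 2 * t `^ (m + 1) by apply: mulr_ge0 => //; exact: powR_ge0.
have p2 : 0 <= 2 * S `^ (m + 1) by apply: mulr_ge0 => //; exact: powR_ge0.
rewrite /bdef0 normrN ger0_norm; last by apply: mulr_ge0.
have [h|h] := leP t S; last first.
  have -> : pos (S - t) = 0 by rewrite /pos max_r// subr_le0 ltW.
  by rewrite mulr0; apply: mulr_ge0 => //; exact: ltW.
apply: ler_pM => //.
  by apply: ler_wpM2l => //; apply: ge0_ler_powR; rewrite ?nnegrE; slra.
by rewrite /pos max_l; slra.
Qed.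

(* The limit of the defect of [sol D] as D tends to 0. *)
Definition field0 x := defect_field (bdef0 (q x)) x.

Lemma bm_field0 (Omega : set (plane R)) : open Omega -> bm Omega (fun x => (field0 x).1) /\ bm Omega (fun x => (field0 x).2).
Proof.
move=> oO.
have bb : bm Omega (fun x => bdef0 (q x)).
  apply: (bm_setT oO (M := 2 * S `^ (m + 1) * S)); last by move=> x; exact/bdef0_bound/sqdist_ge0.
  rewrite (_ : (fun x => _) = (fun x => (- 2) * (q x `^ (m + 1)) * Num.max (S - q x) 0)).
    apply: measurable_realfun.measurable_funM.
      apply: measurable_realfun.measurable_funM => //.
      exact: (measurableT_comp (measurable_powR _) mq).
    apply: measurable_realfun.measurable_maxr => //.
    exact: measurable_realfun.measurable_funB.
  by apply/funext => x; rewrite /bdef0 /pos; ring.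
have by_ i j : bm Omega (fun x => yc x i * yc x j / q x).
  by apply: (bm_setT oO (measurable_ycyc i j) (M := 1)) => x; exact: yc_bound.
split.
  apply: (bmD (f := fun x => - (2 * lam * bdef0 (q x)))).
    rewrite (_ : (fun x => _) = (fun x => (- (2 * lam)) * bdef0 (q x))).
      by apply: bmM => //; exact: bm_cst.
    by apply/funext => x; ring.
  by apply: bmM => //; apply: bmM => //; exact: bm_cst.
by apply: bmM => //; apply: bmM => //; exact: bm_cst.
Qed.

(** Where q >= D the regularization is inactive. Since y_1^2 <= q, differentiating the power costs
    at most -2m times the main term, leaving lam k^2 - 4 q k with k = S - q; the condition
    [16 * q x <= lam * S] makes the cut-off term at most half of lam k^2. *)
Lemma gsol_lower D x : 0 < D -> D <= q x -> 16 * q x <= lam * S ->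
  q x `^ m * (lam * S ^+ 2 / 8) <= (gsol D x).1.
Proof.
move=> D0 Dq qS; have t0 := lt_le_trans D0 Dq; have [r1 r2] := reg_out Dq.
have /andP[l0 l1] := lam01.
have lS : lam * S <= S by rewrite ler_piMl// ltW.
have k0 : pos (S - q x) = S - q x by rewrite /pos max_l//; slra.
rewrite /gsol /= /dprof /prof r1 r2 k0.
have yq : y1 x * y1 x <= q x by rewrite sqdistE -!expr2 lerDl sqr_ge0.
have y0 : 0 <= y1 x * y1 x by rewrite -expr2 sqr_ge0.
have e1 : q x `^ (m - 1) * q x = q x `^ m by exact: powR_pred.
have u0 : 0 <= q x `^ m by exact: powR_ge0.
have v0 : 0 <= q x `^ (m - 1) by exact: powR_ge0.
move: yq y0 e1 u0 v0 t0 qS; rewrite -[2 * y1 x * y1 x]mulrA.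
move: (y1 x * y1 x) => Y; move: (q x `^ m) => u; move: (q x `^ (m - 1)) => v.
move: (q x) => t Yt Y0 e1 u0 v0 t0 qS.
set k := S - t; have kS : S / 2 <= k by rewrite /k; slra.
have k00 : 0 <= k by slra.
have kk : 0 <= k ^+ 2 by exact: sqr_ge0.
have h1 : v * Y <= u by rewrite -e1; exact: ler_wpM2l.
have h1' : 0 <= v * Y by rewrite mulr_ge0.
have h2 : v * Y * k ^+ 2 <= u * k ^+ 2 by exact: ler_wpM2r.
have h3 : 2 * m * (u * k ^+ 2) <= 2 * m * (v * Y * k ^+ 2) by rewrite ler_wnM2l//; slra.
have h4 : u * (Y * k) <= u * (t * k) by apply: ler_wpM2l => //; exact: ler_wpM2r.
have h5 : t * k <= (lam * S / 16) * k by apply: ler_wpM2r => //; slra.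
have h6 : lam * S * k <= lam * (2 * (k * k)).
  rewrite -mulrA; apply: ler_wpM2l; first by slra.
  by rewrite mulrA; apply: ler_wpM2r => //; slra.
have h7 : lam * (S ^+ 2 / 4) <= lam * (k * k).
  apply: ler_wpM2l; first by slra.
  by rewrite expr2 (_ : S * S / 4 = S / 2 * (S / 2)); [apply: ler_pM; slra|field].
have h8 : lam * S ^+ 2 / 8 <= lam * k ^+ 2 - 4 * (t * k) by rewrite [k ^+ 2]expr2; slra.
have := ler_wpM2l u0 h8.
have -> : u * k ^+ 2 + 2 * Y * (m * v * 1 * k ^+ 2 - 2 * u * k) =
   u * k ^+ 2 + 2 * m * (v * Y * k ^+ 2) - 4 * (u * (Y * k)) by ring.
have -> : u * (lam * k ^+ 2 - 4 * (t * k)) = u * k ^+ 2 + 2 * m * (u * k ^+ 2) - 4 * (u * (t * k)).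
  by rewrite /lam; ring.
slra.
Qed.

End Singular.

(** * Error estimates and blow-up *)

Section ErrorEstimate.
Variable R : realType.
Implicit Types (T Omega : set (plane R)) (x y z : plane R) (u v w f h psi : plane R -> R)
  (g k G : plane R -> plane R) (n : nat) (M L : R) (Tau : set (set (plane R)))
  (A : plane R -> 'M[R]_2).
Let mu := leb2 R.
Local Notation "'\I_' O f" := (Rintegral mu O f) (at level 10, O at level 2).

Lemma Rintegral_zero_out Omega M f : open Omega -> bounded_supp M f ->
  (forall x, ~ Omega x -> f x = 0) -> \I_Omega f = \I_setT f.
Proof.
move=> oO bf f0; rewrite Rintegral_mkcond; congr Rintegral; apply/funext => x.
rewrite /patch; case: ifPn => //; rewrite notin_setE => h.
by rewrite f0.
Qed.

(** The rotated gradient of a stream function is orthogonal to all gradients: adding it to G leaves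
    the equation unchanged, but makes the residual small pointwise. *)
Definition strong_residual A G k g x : plane R :=
  ((G x).1 + (k x).2 - (mx_app (A x) (g x)).1, (G x).2 - (k x).1 - (mx_app (A x) (g x)).2).

(** The equation is tested with u - v, of gradient d. The integral of A d . d equals that of X . d,
    with X the strong residual, by [aegrad_curl] for the stream term; ellipticity and the Young
    inequality, which absorbs half of c |d|^2, conclude. *)
Lemma galerkin_error Omega Tau A G c u v gu gv psi k : open Omega -> bounded_set Omega ->
  triangulation Omega Tau -> (forall i j, bm Omega (fun x => A x i j)) ->
  bm Omega (fun x => (G x).1) -> bm Omega (fun x => (G x).2) -> 0 < c ->
  (forall x, Omega x -> forall p, c * dotp p p <= dotp (mx_app (A x) p) p) ->
  galerkin Omega Tau A (gform Omega G) u -> V10 Omega Tau v ->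
  bdd_wgrad Omega u gu -> bdd_wgrad Omega v gv -> has_aegrad psi k -> (forall x, ~ Omega x -> k x = 0) ->
  c ^+ 2 * \I_Omega (fun x => dotp (gu x - gv x) (gu x - gv x)) <=
  \I_Omega (fun x => dotp (strong_residual A G k gv x) (strong_residual A G k gv x)).
Proof.
move=> oO bO tri bA bG1 bG2 c0 ell [Vu hu] Vv ru rv hpsi k0.
have Vz := V10_D (-1) Vv Vu; have [d [hd _]] := V10_aegrad bO tri Vz.
have rz := aegrad_rep oO hd; have rz' := repD (-1) oO rv ru.
have dE : {ae mu, forall x, Omega x -> d x = gu x - gv x}.
  have [w1 _ _] := rz; have [w2 _ _] := rz'.
  apply: ae_imply (weak_grad_unique oO w1 w2 (fun _ _ => erefl)) => x h Ox.
  by rewrite h// scaleN1r addrC.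
have [_ d1 d2] := rz; have [_ u1 u2] := ru; have [_ v1 v2] := rv.
have [[M [bpsi bk1 bk2 _]] _] := hpsi.
have k1 := bounded_supp_bm oO bk1; have k2 := bounded_supp_bm oO bk2.
have [av1 av2] := bm_mx_app bA v1 v2.
pose X := strong_residual A G k gv.
have X1 : bm Omega (fun x => (X x).1) by apply: bmB => //; apply: bmD.
have X2 : bm Omega (fun x => (X x).2) by apply: bmB => //; apply: bmB.
have bdd : bm Omega (fun x => dotp (d x) (d x)) by exact: bm_dotp.
have bXX : bm Omega (fun x => dotp (X x) (X x)) by exact: bm_dotp.
have bXd : bm Omega (fun x => dotp (X x) (d x)) by exact: bm_dotp.
have bGd : bm Omega (fun x => dotp (G x) (d x)) by exact: bm_dotp.
have bud : bm Omega (fun x => dotp (mx_app (A x) (gu x)) (d x)) by exact: bm_form.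
have bvd : bm Omega (fun x => dotp (mx_app (A x) (gv x)) (d x)) by exact: bm_form.
have bAd : bm Omega (fun x => dotp (mx_app (A x) (d x)) (d x)) by exact: bm_form.
have Iu : \I_Omega (fun x => dotp (mx_app (A x) (gu x)) (d x)) = \I_Omega (fun x => dotp (G x) (d x)).
  have := hu _ Vz; rewrite (energyE oO bO bA ru rz) /gform opprK => -[->].
  exact: linformE oO bO bG1 bG2 rz.
have bkd1 : bm Omega (fun x => (k x).2 * (d x).1) by exact: bmM.
have bkd2 : bm Omega (fun x => (k x).1 * (d x).2) by exact: bmM.
have Ik : \I_Omega (fun x => (k x).2 * (d x).1) = \I_Omega (fun x => (k x).1 * (d x).2).
  have [[N [_ bd1 bd2 _]] _] := hd.
  have [md1 e1 _] := bd1; have [md2 e2 _] := bd2.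
  (* [aegrad_curl] is about the whole plane; k vanishes off [Omega], so the integrals coincide. *)
  rewrite (Rintegral_zero_out oO (bounded_suppM bk2 md1 e1)); last first.
    by move=> x h; rewrite k0// mul0r.
  rewrite (Rintegral_zero_out oO (bounded_suppM bk1 md2 e2)); last first.
    by move=> x h; rewrite k0// mul0r.
  exact: aegrad_curl hpsi hd.
have IA : \I_Omega (fun x => dotp (mx_app (A x) (d x)) (d x)) = \I_Omega (fun x => dotp (X x) (d x)).
  transitivity (\I_Omega (fun x => -1 * dotp (mx_app (A x) (gv x)) (d x)
      + dotp (mx_app (A x) (gu x)) (d x))).
    apply: ae_bm_Rintegral => //; first by apply: bmD => //; apply: bmM => //; exact: bm_cst.
    apply: ae_imply dE => x h Ox; rewrite {1}h// /dotp /mx_app /=; ring.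
  rewrite bm_RintegralD// Iu -bm_RintegralD//.
  transitivity (\I_Omega (fun x => -1 * ((k x).1 * (d x).2) + ((k x).2 * (d x).1 +
    (-1 * dotp (mx_app (A x) (gv x)) (d x) + dotp (G x) (d x))))).
    have b3 : bm Omega (fun x => -1 * dotp (mx_app (A x) (gv x)) (d x) + dotp (G x) (d x)).
      by apply: bmD => //; apply: bmM => //; exact: bm_cst.
    have b4 : bm Omega (fun x => (k x).2 * (d x).1 +
      (-1 * dotp (mx_app (A x) (gv x)) (d x) + dotp (G x) (d x))) by exact: bmD.
    rewrite (bm_RintegralD (-1) oO bO bkd2 b4).
    have := bm_RintegralD 1 oO bO bkd1 b3.
    have -> : (fun x => 1 * ((k x).2 * (d x).1) + (-1 * dotp (mx_app (A x) (gv x)) (d x) + dotp (G x) (d x)))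
      = (fun x => (k x).2 * (d x).1 + (-1 * dotp (mx_app (A x) (gv x)) (d x) + dotp (G x) (d x))).
      by apply/funext => x; rewrite mul1r.
    move=> ->; rewrite Ik; ring.
  congr Rintegral; apply/funext => x; rewrite /X /strong_residual /dotp /=; ring.
have le1 : c * \I_Omega (fun x => dotp (d x) (d x)) <= \I_Omega (fun x => dotp (X x) (d x)).
  rewrite -IA -[leLHS]addr0.
  have z0 : \I_Omega (fun=> 0) = 0 :> R by rewrite /Rintegral integral0_eq.
  rewrite -{1}z0 -bm_RintegralD//; last exact: bm_cst.
  apply: bm_le_Rintegral => //.
    by apply: bmD (bm_cst _ _); apply: bmM => //; exact: bm_cst.
  by move=> x Ox; rewrite addr0; exact: ell.
have c2 : 0 < 2 * c by lra.
have le2 : \I_Omega (fun x => dotp (X x) (d x)) <=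
   (2 * c)^-1 * \I_Omega (fun x => dotp (X x) (X x)) + c / 2 * \I_Omega (fun x => dotp (d x) (d x)).
  have bcd : bm Omega (fun x => c / 2 * dotp (d x) (d x) + 0).
    by apply: bmD (bm_cst _ _); apply: bmM => //; exact: bm_cst.
  have -> : c / 2 * \I_Omega (fun x => dotp (d x) (d x)) = \I_Omega (fun x => c / 2 * dotp (d x) (d x) + 0).
    rewrite bm_RintegralD//; last exact: bm_cst.
    by rewrite /Rintegral [in X in _ = _ + X]integral0_eq//= addr0.
  rewrite -bm_RintegralD//; apply: bm_le_Rintegral => //.
    by apply: bmD => //; apply: bmM => //; exact: bm_cst.
  move=> x Ox; rewrite addr0.
  have yg (a b : R) : a * b <= (2 * c)^-1 * (a * a) + c / 2 * (b * b).
    have -> : (2 * c)^-1 * (a * a) + c / 2 * (b * b) = a * b + (a - c * b) ^+ 2 / (2 * c).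
      by field; rewrite gt_eqF.
    by rewrite lerDl divr_ge0 ?sqr_ge0// ltW.
  have := yg (X x).1 (d x).1; have := yg (X x).2 (d x).2; rewrite /dotp; lra.
have -> : \I_Omega (fun x => dotp (gu x - gv x) (gu x - gv x)) = \I_Omega (fun x => dotp (d x) (d x)).
  apply: ae_bm_Rintegral => //; last by apply: ae_imply dE => x h Ox; rewrite h.
  by apply: bm_dotp; exact: bmB.
move: le1 le2; rewrite -/X.
move: (\I_Omega (fun x => dotp (d x) (d x))) (\I_Omega (fun x => dotp (X x) (d x)))
  (\I_Omega (fun x => dotp (X x) (X x))) => a b e le1 le2.
have : c * a <= (2 * c)^-1 * e + c / 2 * a by lra.
move=> h; have : c / 2 * a <= (2 * c)^-1 * e by lra.
rewrite ler_pdivlMl// expr2; lra.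
Qed.

Lemma Rintegral_box Omega Q : open Omega -> bounded_set Omega -> Q.1.1 <= Q.2.1 -> Q.1.2 <= Q.2.2 ->
  \I_Omega (\1_(cbox Q)) <= (Q.2.1 - Q.1.1) * (Q.2.2 - Q.1.2) /\
  (cbox Q `<=` Omega -> \I_Omega (\1_(cbox Q)) = (Q.2.1 - Q.1.1) * (Q.2.2 - Q.1.2)).
Proof.
move=> oO bO h1 h2; have mO := open_measurable_plane oO; have mQ := measurable_cbox Q.
have bx := leb2_cbox h1 h2.
rewrite /Rintegral integral_indic//; split.
  have le : (mu (cbox Q `&` Omega) <= ((Q.2.1 - Q.1.1) * (Q.2.2 - Q.1.2))%:E)%E.
    by rewrite -bx; apply: le_measure; rewrite ?inE//; exact: measurableI.
  rewrite -lee_fin fineK//; apply/fin_numPlt; rewrite (le_lt_trans le) ?ltry// andbT.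
  exact: lt_le_trans (ltNyr 0) (measure_ge0 _ _).
by move=> QO; rewrite (setIidl QO) [X in fine X]bx.
Qed.

Lemma bm_indic_box Omega Q : open Omega -> bm Omega (\1_(cbox Q) : plane R -> R).
Proof.
move=> oO; apply: (@bm_setT _ _ _ 1 oO); first exact: measurable_indic (measurable_cbox Q).
by move=> x; rewrite indicE; case: (_ \in _); rewrite ?normr1 ?normr0.
Qed.

End ErrorEstimate.

(** * The Hölder inequality and the linear form *)

Section LpBounds.
Variable R : realType.
Implicit Types (Omega : set (plane R)) (x z : plane R) (u v w h : plane R -> R)
  (G g k : plane R -> plane R) (p q : R) (A : plane R -> 'M[R]_2).
Let mu := leb2 R.

Lemma measurable_enorm Omega g : measurable_plane Omega (fun x => (g x).1) ->
  measurable_plane Omega (fun x => (g x).2) -> measurable_plane Omega (fun x => enorm (g x)).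
Proof.
move=> m1 m2; rewrite (_ : (fun x => _) = (fun x => dotp (g x) (g x) `^ (2^-1))); last first.
  by apply/funext => x; rewrite powR12_sqrt// dotp_ge0.
apply: (measurableT_comp (measurable_powR _)).
by apply: measurable_realfun.measurable_funD; apply: measurable_realfun.measurable_funM.
Qed.

Lemma Lp_norm_cst1_fin Omega p : measurable Omega -> (mu Omega < +oo)%E -> 0 < p ->
  (Lp_norm Omega p%:E (fun=> 1%R) < +oo)%E.
Proof.
move=> mO fO p0; rewrite /Lp_norm unlock; apply: poweR_lty.
rewrite (_ : (\int[leb2 R]_x _)%E = mu Omega)//.
transitivity (\int[mu]_x (\1_Omega x)%:E)%E; last by rewrite integral_indic// setIT.
apply: eq_integral => x _; rewrite /= patchE indicE; case: ifPn => _.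
  by rewrite normr1 powR1.
by rewrite normr0 powR0// gt_eqF.
Qed.

Lemma Lp_L1 Omega p q h : measurable Omega -> measurable_plane Omega h -> 0 < p -> 0 < q ->
  p^-1 + q^-1 = 1 ->
  (\int[mu]_(x in Omega) `|h x|%:E <= Lp_norm Omega p%:E (fun=> 1%R) * Lp_norm Omega q%:E h)%E.
Proof.
move=> mO mh p0 q0 pq.
have m1 : measurable_plane setT ((fun=> 1 : R) \_ Omega).
  by apply/(measurable_restrictT _ mO); exact: measurable_cst.
have m2 : measurable_plane setT (h \_ Omega) by apply/(measurable_restrictT _ mO).
apply: le_trans (hoelder mu m1 m2 p0 q0 pq).
rewrite Lnorm1 [leLHS]integral_mkcond le_eqVlt; apply/orP; left; apply/eqP; congr (integral mu _ _).
by apply/funext => x; rewrite /= /patch; case: ifPn; rewrite ?mul1r ?mul0r ?normr0.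
Qed.

Lemma Lp_integrable Omega p q h : open Omega -> bounded_set Omega -> 0 < p -> 0 < q ->
  p^-1 + q^-1 = 1 -> Lp Omega q%:E h -> mu.-integrable Omega (EFin \o h).
Proof.
move=> oO bO p0 q0 pq [mh fh]; have mO := open_measurable_plane oO.
apply/integrableP; split; first exact/measurable_EFinP.
apply: le_lt_trans (Lp_L1 mO mh p0 q0 pq) _.
by apply: lte_mul_pinfty => //; [exact: Lnorm_ge0|rewrite ge0_fin_numE ?Lnorm_ge0//;
  apply: Lp_norm_cst1_fin => //; exact: bounded_measure_fin].
Qed.

Lemma hoelder_conjugate_fin p : 1 < p -> exists q,
  [/\ 0 < q, p^-1 + q^-1 = 1 & hoelder_conjugate p%:E = q%:E].
Proof.
move=> p1; have p0 : 0 < p by lra.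
exists (p / (p - 1)); split; first by rewrite divr_gt0// subr_gt0.
  by field; rewrite !gt_eqF// subr_gt0.
rewrite /hoelder_conjugate /= eqe gt_eqF//.
by rewrite -EFinB inver subr_eq0 gt_eqF.
Qed.

(** G is bounded and [Omega] has finite measure, so the Hölder inequality against the constant 1
    bounds the form by the conjugate Sobolev norm, whatever p > 1. *)
Lemma gform_Wm1 Omega G p : open Omega -> bounded_set Omega ->
  bm Omega (fun x => (G x).1) -> bm Omega (fun x => (G x).2) -> 1 < p ->
  Wm1 Omega p%:E (gform Omega G).
Proof.
move=> oO bO bG1 bG2 p1; have p0 : 0 < p by lra.
have mO := open_measurable_plane oO.
have [q [q0 pq qE]] := hoelder_conjugate_fin p1; rewrite /Wm1 qE.
have [mG1 [M1 hM1]] := bG1; have [mG2 [M2 hM2]] := bG2.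
have gradm v g : weak_grad Omega v g ->
  measurable_plane Omega (fun x => dotp (G x) (grad Omega v x)) /\
  measurable_plane Omega (fun x => enorm (grad Omega v x)).
  move=> /weak_grad_grad/(weak_grad_measurable oO)[m1 m2]; split.
    by apply: measurable_realfun.measurable_funD; apply: measurable_realfun.measurable_funM.
  exact: measurable_enorm.
split.
- move=> a v w [[_ [gv [wv v1 v2]]] _] [[_ [gw [ww w1 w2]]] _].
  have intg k : Lp Omega q%:E (fun x => (k x).1) -> Lp Omega q%:E (fun x => (k x).2) ->
     mu.-integrable Omega (EFin \o (fun x => dotp (G x) (k x))).
    move=> k1 k2.
    have := Lp_integrable oO bO p0 q0 pq k1; have := Lp_integrable oO bO p0 q0 pq k2.
    move=> i2 i1.
    have b (H : plane R -> R) kk M : measurable_plane Omega H -> (forall x, Omega x -> `|H x| <= M) ->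
      mu.-integrable Omega (EFin \o kk) -> mu.-integrable Omega (EFin \o (fun x => H x * kk x)).
      move=> mH hM ik.
      have bH : [bounded H x | x in Omega].
        exists M; split; first exact: num_real.
        by move=> N MN x Ox; exact: le_trans (hM x Ox) (ltW MN).
      by have := integrableMr mO mH bH ik; congr (_.-integrable _ _).
    have := integrableD mO (b _ _ _ mG1 hM1 i1) (b _ _ _ mG2 hM2 i2).
    by apply: eq_integrable => // x _.
  (* [grad] selects representatives and is additive only almost everywhere, so each one is replaced
     by an explicit gradient. *)
  have ae_dot v' g : weak_grad Omega v' g ->
    \int[mu]_(x in Omega) dotp (G x) (grad Omega v' x) = \int[mu]_(x in Omega) dotp (G x) (g x).
    move=> wg; rewrite /Rintegral; congr fine; apply: (ae_eq_Rintegral oO).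
    - exact: (gradm _ _ wg).1.
    - have [m1 m2] := weak_grad_measurable oO wg.
      by apply: measurable_realfun.measurable_funD; apply: measurable_realfun.measurable_funM.
    - by apply: ae_imply (gradP oO wg) => x e Ox; rewrite e.
  rewrite /gform (ae_dot _ _ wv) (ae_dot _ _ ww) (ae_dot _ _ (weak_gradD a oO wv ww)).
  rewrite mulrN -opprD -RintegralZl//; last exact: intg.
  rewrite -RintegralD//; [|exact: (integrableZl mO a (intg _ v1 v2))|exact: intg].
  congr (- Rintegral _ _ _); apply/funext => x; rewrite /dotp /= /GRing.scale /=; ring.
pose M := `|M1| + `|M2|; pose N := Lp_norm Omega p%:E (fun=> 1%R).
have M0 : 0 <= M by rewrite addr_ge0.
have Nfin : N \is a fin_num.
  rewrite ge0_fin_numE ?Lnorm_ge0//; apply: Lp_norm_cst1_fin => //; exact: bounded_measure_fin.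
exists (M * fine N) => v [[_ [g [wv _ _]]] _].
have [md me] := gradm _ _ wv.
rewrite EFinM fineK// -muleA /gform normrN /Rintegral.
(* [fine] sends infinite values to 0, so the comparison holds before finiteness of the integral is
   known. *)
apply: (@le_trans _ _ (`|\int[mu]_(x in Omega) (dotp (G x) (grad Omega v x))%:E|)%E).
  by case: (\int[mu]_(x in Omega) _)%E => [r| |]//=; rewrite normr0 leey.
apply: le_trans (le_abse_integral mu mO _) _; first exact/measurable_EFinP.
apply: (@le_trans _ _ (\int[mu]_(x in Omega) (M%:E * `|enorm (grad Omega v x)|%:E))%E).
  apply: ge0_le_integral => //.
  - by apply/measurable_EFinP; exact: measurableT_comp md.
  - by apply/measurable_EFinP; apply: measurable_realfun.measurable_funM => //; exact: measurableT_comp me.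
  - move=> x Ox; rewrite -EFinM lee_fin (ger0_norm (enorm_ge0 _)).
    apply: le_trans (ler_normD _ _) _; rewrite !normrM mulrDl.
    have h1 := le_trans (hM1 x Ox) (ler_norm _); have h2 := le_trans (hM2 x Ox) (ler_norm _).
    have := norm_le_enorm (grad Omega v x).
    rewrite normp_le => /andP[e1 e2].
    by apply: lerD; apply: ler_pM.
rewrite ge0_integralZl//; last by apply/measurable_EFinP; exact: measurableT_comp me.
apply: lee_wpmul2l; first by rewrite lee_fin.
apply: le_trans (Lp_L1 mO me p0 q0 pq) _.
apply: lee_wpmul2l; first exact: Lnorm_ge0.
by rewrite /W1_norm leeDr// Lnorm_ge0.
Qed.

Lemma bm_Linfty Omega A : open Omega -> (forall i j, bm Omega (fun x => A x i j)) -> Linfty_mx Omega A.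
Proof.
move=> oO bA i j; have [mA [M hM]] := bA i j; split => //.
rewrite /Lp_norm unlock; case: ifPn => // _.
apply: le_lt_trans (ltry (`|M|)); apply/ess_sup_inf.ess_supP; apply: nearW => x /=.
rewrite patchE; case: ifPn => [|_]; last by rewrite normr0 lee_fin.
by rewrite inE lee_fin => /hM h; exact: le_trans h (ler_norm _).
Qed.

End LpBounds.

(** * Energy bounds and pointwise size of the residual *)

Section BlowUp.
Variable R : realType.
Implicit Types (Omega : set (plane R)) (x z : plane R) (u v w f h : plane R -> R)
  (G g k : plane R -> plane R) (p q m S D L M N C r : R) (A : plane R -> 'M[R]_2)
  (Tau : set (set (plane R))).
Let mu := leb2 R.
Local Notation "'\I_' O f" := (Rintegral mu O f) (at level 10, O at level 2).

Lemma ae_bm_le_Rintegral Omega f h : open Omega -> bounded_set Omega -> bm Omega f -> bm Omega h ->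
  (forall x, Omega x -> 0 <= f x) -> (forall x, Omega x -> 0 <= h x) ->
  {ae mu, forall x, Omega x -> f x <= h x} -> \I_Omega f <= \I_Omega h.
Proof.
move=> oO bO bf bh f0 h0 fh; rewrite -lee_fin -!(bm_fin oO bO)//.
have [mf _] := bf; have [mh _] := bh.
apply: ae_ge0_le_integral => //; try exact/measurable_EFinP.
exact: open_measurable_plane.
Qed.

Lemma bm_powR Omega f p : 0 <= p -> bm Omega f -> bm Omega (fun x => `|f x| `^ p).
Proof.
move=> p0 [mf [M hM]]; split.
  exact: (measurableT_comp (measurable_powR _) (measurableT_comp (@normr_measurable _ _) mf)).
exists (`|M| `^ p) => x Ox; rewrite ger0_norm ?powR_ge0//.
by apply: ge0_ler_powR => //; rewrite ?nnegrE//; exact: le_trans (hM x Ox) (ler_norm _).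
Qed.

(** Only the first component of the gradient is kept, the one that [gsol_lower] bounds from
    below. *)
Lemma W1_norm_energy Omega p C u g : open Omega -> bounded_set Omega -> 0 < p -> bdd_wgrad Omega u g ->
  (W1_norm Omega p%:E u <= C%:E)%E -> \I_Omega (fun x => `|(g x).1| `^ p) <= C `^ p.
Proof.
move=> oO bO p0 [wg g1 g2] hC; have mO := open_measurable_plane oO.
have bg := bm_powR (ltW p0) g1; have [mg _] := bg.
have [h1 h2] := weak_grad_measurable oO (weak_grad_grad wg).
have me := measurable_enorm h1 h2.
rewrite -lee_fin -(bm_fin oO bO bg) -poweR_EFin.
have hN : (Lp_norm Omega p%:E (fun x => enorm (grad Omega u x)) <= C%:E)%E.
  by apply: le_trans hC; rewrite /W1_norm leeDr// Lnorm_ge0.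
have C0 : (0 <= C%:E)%E by exact: le_trans (Lnorm_ge0 _ _ _) hN.
have := gt0_ler_poweR (ltW p0) _ _ hN; rewrite !in_itv /= !leey !andbT.
move=> /(_ (Lnorm_ge0 _ _ _) C0); apply: le_trans.
rewrite /Lp_norm poweR_Lnorm; last by rewrite gt_eqF.
rewrite [leLHS]integral_mkcond.
apply: (@le_trans _ _ (\int[mu]_x ((fun x => (enorm (grad Omega u x) `^ p)%:E) \_ Omega) x)%E).
  rewrite -!integral_mkcond; apply: ae_ge0_le_integral => //.
  - exact/measurable_EFinP.
  - by move=> x _; rewrite lee_fin powR_ge0.
  - apply/measurable_EFinP; exact: (measurableT_comp (measurable_powR _) me).
  - apply: ae_imply (gradP oO wg) => x e Ox; rewrite lee_fin e//.
    apply: ge0_ler_powR; rewrite ?nnegrE ?enorm_ge0//; first exact: ltW.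
    by have := norm_le_enorm (g x); rewrite normp_le => /andP[].
rewrite le_eqVlt; apply/orP; left; apply/eqP; congr (integral mu _ _).
apply/funext => x; rewrite /= /patch; case: ifPn => _.
  by rewrite ger0_norm ?enorm_ge0.
by rewrite normr0 powR0// gt_eqF.
Qed.

(** When a > N, the factor (a / N)^(p - 1) is at least 1. This form is linear in [a ^ p], so it can
    be integrated over a box as it stands. *)
Lemma powR_young (a N p : R) : 0 <= a -> 0 < N -> 1 < p -> a <= N + N `^ (1 - p) * a `^ p.
Proof.
move=> a0 N0 p1; have [aN|Na] := leP a N.
  by rewrite (le_trans aN)// lerDl mulr_ge0// powR_ge0.
have ap : 0 < a by exact: lt_trans N0 Na.
rewrite -[leLHS]add0r; apply: lerD; first exact: ltW.
rewrite -(@mulr_powRB1 _ a p)//; last by lra.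
rewrite mulrCA -[leLHS]mulr1; apply: ler_wpM2l; first exact: ltW.
have e1 : N `^ (1 - p) * N `^ (p - 1) = 1.
  rewrite -powRD ?(gt_eqF N0) ?implybT//.
  by rewrite (_ : 1 - p + (p - 1) = 0) ?powRr0//; ring.
rewrite -[leLHS]e1; apply: ler_wpM2l; first exact: powR_ge0.
by apply: ge0_ler_powR; rewrite ?nnegrE; try exact: ltW; lra.
Qed.

Lemma coef_le1 m S z x i j : m < 0 -> - 2^-1 < m -> 0 < S -> `|coef m z x i j| <= 1.
Proof.
move=> m0 m1 S0; have := yc_bound z m0 m1 S0 x i j; have /andP[l0 l1] := lam01 m0 m1 S0.
rewrite mxE; move: (2 * m + 1) l0 l1 (_ / _) => l l0 l1 t.
have l2 : 0 <= l ^+ 2 <= 1 by rewrite sqr_ge0 expr_le1// ltW.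
have : 0 <= (l ^+ 2) *+ (i == j) <= l ^+ 2.
  by move: l2 => /andP[? ?]; case: (i == j); rewrite ?mulr1n ?mulr0n ?lexx ?andbT.
move: l2; move: (l ^+ 2 *+ (i == j)) (l ^+ 2) => b l' /andP[h1 h2] /andP[h3 h4]; rewrite !ler_norml => /andP[h5 h6].
have h7 : (1 - l') * t <= (1 - l') * 1 by apply: ler_wpM2l => //; lra.
have h8 : (1 - l') * -1 <= (1 - l') * t by apply: ler_wpM2l => //; lra.
by apply/andP; split; lra.
Qed.

(** By [defectE] the residual is the difference of the limit and regularized defects, which is 0
    where q >= D, plus A applied to the interpolation error, with entries of A at most 1. The
    constant 42 is 6 * 7, from [defect_field_bound] and [bdef_bound]; the box contains the disc q <
    D. *)
Lemma strong_residual_bound m S z D (e : R) k g x : m < 0 -> - 2^-1 < m -> 0 < S -> 0 < D -> D <= S ->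
  `|(g x).1 - (gsol m S z D x).1| <= e -> `|(g x).2 - (gsol m S z D x).2| <= e ->
  0 <= e -> k x = gstream m S z D x ->
  dotp (strong_residual (coef m z) (field0 m S z) k g x)
       (strong_residual (coef m z) (field0 m S z) k g x) <= 4 * (42 * S ^+ 2 * (D / 2) `^ m) ^+ 2 *
    \1_(cbox ((z.1 - Num.sqrt D, z.2 - Num.sqrt D), (z.1 + Num.sqrt D, z.2 + Num.sqrt D))) x
    + 16 * e ^+ 2.
Proof.
move=> m0 m1 S0 D0 DS e1 e2 e0 kx; set X := strong_residual _ _ _ _ _.
set B := 42 * S ^+ 2 * (D / 2) `^ m; set I := (X in _ * X + _).
have B0 : 0 <= B.
  apply: mulr_ge0; last exact: powR_ge0.
  by apply: mulr_ge0 => //; exact: sqr_ge0.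
pose d := gsol m S z D x - g x.
pose F := defect_field m z (bdef0 m S (sqdist z x)) x.
pose F' := defect_field m z (bdef m S D (sqdist z x)) x.
have XE : X = (F.1 - F'.1 + (mx_app (coef m z x) d).1, F.2 - F'.2 + (mx_app (coef m z x) d).2).
  have := defectE m S z D x; rewrite -/F' /X /strong_residual /field0 -/F kx.
  move=> <-; rewrite /mx_app /d /=; apply/eqP; rewrite xpair_eqE; apply/andP; split; apply/eqP; ring.
have I0 : 0 <= I by rewrite /I indicE.
have dF : `|F.1 - F'.1| <= B * I /\ `|F.2 - F'.2| <= B * I.
  have [h1 h2] := defect_field_bound z m0 m1 S0 (bdef0 m S (sqdist z x)) (bdef m S D (sqdist z x)) x.
  suff hb : 6 * `|bdef0 m S (sqdist z x) - bdef m S D (sqdist z x)| <= B * I.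
    by split; [exact: le_trans h1 hb|exact: le_trans h2 hb].
  have [Dt|tD] := leP D (sqdist z x).
    by rewrite (bdef_out m S D0 Dt) subrr normr0 mulr0 mulr_ge0.
  have xI : I = 1.
    rewrite /I indicE mem_set//.
    have : `|x - z| <= Num.sqrt D.
      apply: le_trans (norm_le_enorm _) _; rewrite enorm_le ?sqrtr_ge0// sqr_sqrtr; exact: ltW.
    rewrite normp_le /= !ler_norml /cbox /=; lra.
  rewrite xI mulr1 distrC; have := bdef_bound m0 m1 S0 (sqdist_ge0 z x) tD DS.
  rewrite /B; lra.
have dA : `|(mx_app (coef m z x) d).1| <= 2 * e /\ `|(mx_app (coef m z x) d).2| <= 2 * e.
  have d1 : `|d.1| <= e by rewrite /d /= distrC.
  have d2 : `|d.2| <= e by rewrite /d /= distrC.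
  have a i (y1 y2 : R) : `|y1| <= e -> `|y2| <= e ->
    `|coef m z x i ord0 * y1 + coef m z x i ord_max * y2| <= 2 * e.
    move=> k1 k2; apply: le_trans (ler_normD _ _) _; rewrite !normrM mulrDl !mul1r.
    by apply: lerD; rewrite -[leRHS]mul1r; apply: ler_pM => //; apply: coef_le1 S0.
  by split; rewrite /mx_app /=; apply: a.
have sq (a b : R) : `|a| <= B * I -> `|b| <= 2 * e -> (a + b) * (a + b) <= 2 * B ^+ 2 * I + 8 * e ^+ 2.
  move=> ha hb; have II : I * I = I.
    by rewrite /I indicE; case: (_ \in _); rewrite ?mulr1 ?mulr0.
  have a2 : a * a <= B ^+ 2 * I.
    rewrite -expr2 -(real_normK (num_real a)) -II.
    rewrite (_ : B ^+ 2 * (I * I) = (B * I) ^+ 2); last by ring.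
    by apply: lerXn2r; rewrite ?nnegrE //; exact: mulr_ge0.
  have b2 : b * b <= 4 * e ^+ 2.
    rewrite -expr2 -(real_normK (num_real b)) (_ : 4 * e ^+ 2 = (2 * e) ^+ 2); last by ring.
    by apply: lerXn2r; rewrite ?nnegrE //; exact: mulr_ge0.
  have : 0 <= (a - b) * (a - b) by rewrite -expr2 sqr_ge0.
  lra.
rewrite XE; have [f1 f2] := dF; have [a1 a2] := dA.
by apply: le_trans (lerD (sq _ _ f1 a1) (sq _ _ f2 a2)) _; lra.
Qed.

End BlowUp.

(** * Distance from the discrete solution to the interpolant *)

Section Approx.
Variable R : realType.
Implicit Types (Omega : set (plane R)) (x z : plane R) (u v w f : plane R -> R)
  (G g k gu gv : plane R -> plane R) (p q m S D L M N C r s h : R) (A : plane R -> 'M[R]_2)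
  (Tau : set (set (plane R))).
Let mu := leb2 R.
Local Notation "'\I_' O f" := (Rintegral mu O f) (at level 10, O at level 2).

(** The exponent 4 is the square of the ellipticity constant lam^2. On the right,
    [strong_residual_bound] is integrated, the box having area 4 D. *)
Lemma approx_error Omega Tau m S z D s h M u gu :
  open Omega -> bounded_set Omega -> triangulation Omega Tau -> admissible Tau -> 0 < s ->
  (forall T, Tau T -> diam T / indiam T <= s) -> (forall T, Tau T -> diam T <= h) ->
  0 <= h -> h ^+ 2 <= S -> (forall x, sqdist z x < 4 * S -> Omega x) ->
  m < 0 -> - 2^-1 < m -> 0 < S -> 0 < D -> D <= S ->
  0 <= M -> quad (sol m S z D) (gsol m S z D) M ->
  galerkin Omega Tau (coef m z) (gform Omega (field0 m S z)) u -> bdd_wgrad Omega u gu ->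
  exists gv, [/\ bm Omega (fun x => (gv x).1), bm Omega (fun x => (gv x).2),
    {ae mu, forall x, Omega x -> `|(gv x).1 - (gsol m S z D x).1| <= 4 * s * M * h}
  & (2 * m + 1) ^+ 4 * \I_Omega (fun x => dotp (gu x - gv x) (gu x - gv x)) <=
      16 * (42 * S ^+ 2 * (D / 2) `^ m) ^+ 2 * D
      + 16 * (4 * s * M * h) ^+ 2 * fine (mu Omega)].
Proof.
move=> oO bO tri adm s0 hs hd h0 hS zO m0 m1 S0 D0 DS M0 qM gal ru.
have bA i j := bm_coef z m0 m1 S0 i j oO; have [bG1 bG2] := bm_field0 z m0 m1 S0 oO.
(* If [sol] were not 0 at y then q y < S, and q x <= 2 q y + 2 h^2 < 4 S would place the frontier
   point x in [Omega]: this is what [h ^+ 2 <= S] is for. *)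
have vanish T x y : Tau T -> T x -> T y -> frontier Omega x -> sol m S z D y = 0.
  move=> TT Tx Ty [_ nx]; have [//|Sy] := leP S (sqdist z y).
    by move=> /(sol_out m D)[].
  exfalso; apply: nx; rewrite (interior_id Omega).1//; apply: zO.
  have [K K0 hK] := bounded_closure bO; have [_ _ cO] := tri.
  have dxy : enorm (x - y) <= h.
    apply: le_trans (hd T TT); apply: (le_diam (K := K)) => // t Tt.
    by apply: hK; rewrite cO; exists T.
  rewrite enorm_le// in dxy.
  have : sqdist z x <= 2 * sqdist z y + 2 * dotp (x - y) (x - y).
    rewrite /sqdist /dotp /=.
    have a1 : 0 <= (y.1 - z.1 - (x.1 - y.1)) ^+ 2 := sqr_ge0 _.
    have a2 : 0 <= (y.2 - z.2 - (x.2 - y.2)) ^+ 2 := sqr_ge0 _.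
    rewrite !expr2 in a1 a2; lra.
  lra.
have [v Vv hv] := interpolation bO tri adm s0 hs hd M0 qM vanish.
have [gv [hgv gvT]] := V10_aegrad bO tri Vv.
have rv := aegrad_rep oO hgv; have [_ gv1 gv2] := rv.
set e := 4 * s * M * h.
have e0 : 0 <= e by rewrite /e !mulr_ge0// ltW.
have near : {ae mu, forall x, Omega x -> `|(gv x).1 - (gsol m S z D x).1| <= e /\
    `|(gv x).2 - (gsol m S z D x).2| <= e}.
  apply: ae_imply (triangulation_ae tri) => x hx /subset_closure/hx[T TT Tx].
  have [q vq hq] := hv T TT; rewrite (gvT T q x TT vq Tx); apply: hq.
  exact: interior_subset Tx.
exists gv; split => //; first by apply: ae_imply near => x hx /hx[].
have k0 x : ~ Omega x -> gstream m S z D x = 0.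
  move=> nx; have [/(stream_out m D)[]//|Sx] := leP S (sqdist z x).
  by case: nx; apply: zO; lra.
have c0 : 0 < (2 * m + 1) ^+ 2 by apply: exprn_gt0; lra.
have ell x : Omega x -> forall p : plane R, (2 * m + 1) ^+ 2 * dotp p p <= dotp (mx_app (coef m z x) p) p.
  by move=> _ p; exact: (coef_elliptic z m0 m1 S0).
have := galerkin_error oO bO tri bA bG1 bG2 c0 ell gal Vv ru rv (stream_aegrad z m0 m1 S0 D0) k0.
rewrite -exprM => /le_trans; apply.
set B := 42 * S ^+ 2 * (D / 2) `^ m.
pose Q := ((z.1 - Num.sqrt D, z.2 - Num.sqrt D), (z.1 + Num.sqrt D, z.2 + Num.sqrt D)).
have bQ := bm_indic_box Q oO.
have d0 : 0 <= Num.sqrt D by exact: sqrtr_ge0.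
have [Q1 Q2] : Q.1.1 <= Q.2.1 /\ Q.1.2 <= Q.2.2 by rewrite /Q /=; split; clear -d0; lra.
have [IQ _] := Rintegral_box oO bO Q1 Q2.
have [mk1 mk2] : bm Omega (fun x => (gstream m S z D x).1) /\ bm Omega (fun x => (gstream m S z D x).2).
  have [[N [_ b1 b2 _]] _] := stream_aegrad z m0 m1 S0 D0.
  by split; [exact: bounded_supp_bm b1|exact: bounded_supp_bm b2].
have [av1 av2] := bm_mx_app bA gv1 gv2.
apply: (@le_trans _ _ (\I_Omega (fun x => 4 * B ^+ 2 * \1_(cbox Q) x + 16 * e ^+ 2))).
  apply: ae_bm_le_Rintegral => //.
  - by apply: bm_dotp; apply: bmB => //; [apply: bmD|apply: bmB|apply: bmD|apply: bmB].
  - by apply: bmD (bm_cst _ _); apply: bmM => //; exact: bm_cst.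
  - by move=> x _; exact: dotp_ge0.
  - move=> x _; have i0 : 0 <= \1_(cbox Q) x :> R by rewrite indicE.
    by apply: addr_ge0; last (by apply: mulr_ge0 => //; exact: sqr_ge0);
      apply: mulr_ge0 => //; apply: mulr_ge0 => //; exact: sqr_ge0.
  apply: ae_imply near => x hx /hx[h1 h2].
  exact: (strong_residual_bound m0 m1 S0 D0 DS h1 h2 e0 erefl).
rewrite bm_RintegralD//; last exact: bm_cst.
rewrite Rintegral_cst//; last exact: open_measurable_plane.
rewrite lerD2r.
have -> : 16 * B ^+ 2 * D = 4 * B ^+ 2 * (4 * D) by ring.
apply: ler_wpM2l; first by rewrite mulr_ge0 ?sqr_ge0.
apply: le_trans IQ _; rewrite /Q /=.
have := sqr_sqrtr (ltW D0); rewrite expr2; clear; lra.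
Qed.

End Approx.

(** * Choice of the parameters and contradiction *)

Section Final.
Variable R : realType.
Implicit Types (Omega : set (plane R)) (x z : plane R) (v w f : plane R -> R)
  (G g k gu gv : plane R -> plane R) (p q m S D L M N C r s h : R) (A : plane R -> 'M[R]_2)
  (Tau : R -> set (set (plane R))).
Let mu := leb2 R.
Local Notation "'\I_' O f" := (Rintegral mu O f) (at level 10, O at level 2).

Lemma powR_small (a b c : R) : 0 < a -> 0 < b -> 0 < c -> exists x : R, [/\ 0 < x, x <= c & x `^ a <= b].
Proof.
move=> a0 b0 c0; exists (Num.min c (b `^ a^-1)); split.
- by rewrite lt_min c0 powR_gt0.
- by rewrite ge_min lexx.
have bE : b = (b `^ a^-1) `^ a by rewrite -powRrM mulVf ?gt_eqF// powRr1// ltW.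
rewrite [leRHS]bE.
apply: ge0_ler_powR; rewrite ?nnegrE; first exact: ltW.
- by rewrite le_min powR_ge0 ltW.
- exact: powR_ge0.
- by rewrite ge_min lexx orbT.
Qed.

Lemma linear_small (a b c d : R) : 0 <= a -> 0 < b -> 0 < c -> 0 < d ->
  exists h, [/\ 0 < h, h <= c, h ^+ 2 <= d & a * h <= b].
Proof.
move=> a0 b0 c0 d0; have a1 : 0 < a + 1 by lra.
exists (Num.min c (Num.min 1 (Num.min d (b / (a + 1))))); set h := Num.min _ _.
have ba : 0 < b / (a + 1) by exact: divr_gt0.
have h0 : 0 < h by rewrite !lt_min c0 d0 ba ltr01.
have : h <= h := lexx _; rewrite {2}/h !le_min => /and4P[h1 h2 h3 h4].
split => //.
  by apply: le_trans h3; rewrite expr2 ger_pMl.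
have := h4; rewrite ler_pdivlMr// mulrDr mulr1; lra.
Qed.

(** The quantity is a constant times (D/2)^(2m + 1), with a positive exponent. *)
Lemma defect_small m S (a b : R) : - 2^-1 < m -> 0 < S -> 0 < a -> 0 < b ->
  exists D, [/\ 0 < D, D <= b & 16 * (42 * S ^+ 2 * (D / 2) `^ m) ^+ 2 * D <= a].
Proof.
move=> m1 S0 a0 b0; have l0 : 0 < 2 * m + 1 by lra.
have K0 : 0 < 16 * (42 * S ^+ 2) ^+ 2 * 2.
  by rewrite !mulr_gt0// exprn_gt0// mulr_gt0// exprn_gt0.
have c0 : 0 < b / 2 by lra.
have [x [x0 xb xa]] := powR_small l0 (divr_gt0 a0 K0) c0.
exists (2 * x); split; [lra|lra|].
have -> : 2 * x / 2 = x by field.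
have e : x `^ (2 * m + 1) = x `^ m ^+ 2 * x.
  rewrite (_ : 2 * m + 1 = m + m + 1); last by ring.
  by rewrite !powRD ?(gt_eqF x0) ?implybT// powRr1 ?ltW// expr2.
move: xa; rewrite e ler_pdivlMr//; lra.
Qed.

Lemma diam_le_sup Omega (T : set (plane R)) (Tau1 : set (set (plane R))) h :
  triangulation Omega Tau1 -> sup [set diam T | T in Tau1] = h -> Tau1 T -> diam T <= h.
Proof.
move=> [fT _ _] <- TT; apply: ub_le_sup; last by exists T.
have [M _ hM] := finite_bound (@diam R) fT.
by exists M => _ [T' /hM h' <-].
Qed.

Lemma box_sqdist z x r : 0 < r ->
  cbox ((z.1 + r, z.2 + r), (z.1 + 2 * r, z.2 + 2 * r)) x -> 2 * r ^+ 2 <= sqdist z x <= 8 * r ^+ 2.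
Proof.
move=> r0 [/andP[/= k1 k2] /andP[/= k3 k4]].
have sq (a : R) : r <= a -> a <= 2 * r -> r * r <= a * a /\ a * a <= 2 * r * (2 * r).
  by move=> b1 b2; have a0 := le_trans (ltW r0) b1; split; apply: ler_pM => //; exact: ltW.
have [||j1 j2] := sq (x.1 - z.1); [lra|lra|].
have [||j3 j4] := sq (x.2 - z.2); [lra|lra|].
by rewrite /sqdist /dotp /= expr2; apply/andP; split; lra.
Qed.

(** The case of exponent 2 in [powR_young]; the slack b receives the square of the other component
    of the error. *)
Lemma young_inv (a b N : R) : 0 < N -> 0 <= b -> `|a| <= N + N^-1 * (a * a + b).
Proof.
move=> N0 b0; rewrite -(ler_pM2l N0) [leRHS]mulrDr mulVKf ?gt_eqF//.
have -> : a * a = `|a| * `|a| by rewrite -!expr2 real_normK// num_real.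
have := sqr_ge0 (`|a| - N / 2); have := sqr_ge0 N; rewrite !expr2; lra.
Qed.

(** Here a, b and c are the first components of the gradients of the regularized solution, of the
    interpolant and of u_h; each passage costs L / 8. *)
Lemma triangle_lower (L e a b c X Y : R) : L <= a -> `|b - a| <= e -> e <= L / 8 ->
  `|c| <= L / 8 + X -> `|c - b| <= L / 8 + Y -> L <= 3 * L / 8 + (X + (Y + 0)).
Proof.
move=> La; rewrite !ler_norml => /andP[? ?] ? /andP[? ?] /andP[? ?]; lra.
Qed.

(* D is fixed first, in terms of r; then h, in terms of D. *)
Lemma gradient_lower_bound Omega Tau (h0 sigma : R) m S z p C (u : R -> plane R -> R) r :
  open Omega -> bounded_set Omega -> 0 < h0 ->
  (forall h, 0 < h <= h0 -> [/\ triangulation Omega (Tau h), admissible (Tau h)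
     & sup [set diam T | T in Tau h] = h]) ->
  0 < sigma -> (forall h, 0 < h <= h0 -> forall T, Tau h T -> diam T / indiam T <= sigma) ->
  (forall x, sqdist z x < 4 * S -> Omega x) -> m < 0 -> - 2^-1 < m -> 0 < S -> 1 < p ->
  (forall h, 0 < h <= h0 -> galerkin Omega (Tau h) (coef m z) (gform Omega (field0 m S z)) (u h)) ->
  (forall h, 0 < h <= h0 -> (W1_norm Omega p%:E (u h) <= C%:E)%E) ->
  0 < r -> 128 * r ^+ 2 <= (2 * m + 1) * S ->
  (8 * r ^+ 2) `^ m * ((2 * m + 1) * S ^+ 2 / 8) / 2 * r ^+ 2 <=
  ((8 * r ^+ 2) `^ m * ((2 * m + 1) * S ^+ 2 / 8) / 8) `^ (1 - p) * C `^ p.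
Proof.
move=> oO bO h00 HT s0 hreg zO m0 m1 S0 p1 gal W1 r0 rS.
set L := (8 * r ^+ 2) `^ m * _.
have /andP[l0 l1] := lam01 m0 m1 S0.
have r20 : 0 < r ^+ 2 by exact: exprn_gt0.
have L0 : 0 < L.
  by rewrite /L mulr_gt0 ?powR_gt0//; [lra|rewrite divr_gt0// mulr_gt0// exprn_gt0].
(* The three losses of [triangle_lower] amount to 3 L / 8 and [EN] costs another L / 8: half of L is
   left. *)
set N := L / 8; have N0 : 0 < N by rewrite /N; lra.
set V := fine (mu Omega).
have V0 : 0 <= V by rewrite /V fine_ge0.
have l40 : 0 < (2 * m + 1) ^+ 4 by exact: exprn_gt0.
(* The bound on lam^4 E that yields [EN]; the choice of D uses one half of it and that of h the
   other. *)
set eta := (2 * m + 1) ^+ 4 * (N * (L * r ^+ 2 / 8)).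
have eta0 : 0 < eta.
  rewrite /eta; apply: mulr_gt0 => //; apply: mulr_gt0 => //.
  by apply: divr_gt0 => //; exact: mulr_gt0.
have eta20 : 0 < eta / 2 by lra.
(* [2 * r ^+ 2] bounds [sqdist] from below on the box, so the regularization is inactive there. *)
have D1 : 0 < Num.min S (2 * r ^+ 2) by rewrite lt_min S0 mulr_gt0.
have [D [D0 +  hD]] := defect_small m1 S0 eta20 D1; rewrite le_min => /andP[DS Dr].
have [M [M0 qM _]] := sol_quad z m0 m1 S0 D0.
have V1 : 0 < 32 * (V + 1) by lra.
(* The bound 1 gives e^2 <= e, N serves the pointwise comparison, and the last one makes 16 e^2 V at
   most eta / 2; V + 1 guards against V = 0. *)
have t0 : 0 < Num.min 1 (Num.min N (eta / (32 * (V + 1)))).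
  by rewrite !lt_min ltr01 N0 divr_gt0.
have a0 : 0 <= 4 * sigma * M by rewrite !mulr_ge0// ltW.
have [h [hp hh0 hS]] := linear_small a0 t0 h00 S0.
rewrite !le_min => /and3P[e1 eN eV]; set e := 4 * sigma * M * h in e1 eN eV.
have e0 : 0 <= e by rewrite mulr_ge0// ltW.
have hh : 0 < h <= h0 by rewrite hp.
have [tri adm suph] := HT h hh.
have [gu ru] := V10_rep oO bO tri (gal h hh).1.
have hd T : Tau h T -> diam T <= h by move=> TT; exact: diam_le_sup tri suph TT.
have [gv [gv1 gv2 near err]] := approx_error oO bO tri adm s0 (hreg h hh) hd (ltW hp) hS zO
  m0 m1 S0 D0 DS M0 qM (gal h hh) ru.
set E := Rintegral _ _ _ in err.
have eta_e : 16 * e ^+ 2 * V <= eta / 2.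
  have k0 : e * e <= e by exact: ler_piMl.
  move: eV; rewrite ler_pdivlMr// => k2.
  have k3 : e * e * V <= e * V by exact: ler_wpM2r.
  by rewrite expr2; clear -k2 k3 k0 e0 V0 eta0; lra.
have EN : E / N <= L * r ^+ 2 / 8.
  rewrite ler_pdivrMr// mulrC -(ler_pM2l l40) -/eta.
  by apply: le_trans err _; rewrite -/e -/V; clear -hD eta_e; lra.
have [_ gu1 gu2] := ru.
have bE : bm Omega (fun x => dotp (gu x - gv x) (gu x - gv x)).
  by apply: bm_dotp; exact: bmB.
pose Q := ((z.1 + r, z.2 + r), (z.1 + 2 * r, z.2 + 2 * r)).
have bQ := bm_indic_box Q oO.
have [Q1 Q2] : Q.1.1 <= Q.2.1 /\ Q.1.2 <= Q.2.2.
  by rewrite /Q /=; split; rewrite lerD2l ler_peMl ?ler1n// ltW.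
have Qq x : cbox Q x -> 2 * r ^+ 2 <= sqdist z x <= 8 * r ^+ 2 by exact: box_sqdist.
have r8 : 8 * r ^+ 2 < 4 * S.
  have : (2 * m + 1) * S <= S by rewrite ler_piMl// ltW.
  by clear -S0 rS; lra.
have QO : cbox Q `<=` Omega by move=> x /Qq/andP[_ k]; apply: zO; exact: le_lt_trans k r8.
have IQ := (Rintegral_box oO bO Q1 Q2).2 QO.
have bp := bm_powR (ltW (lt_trans ltr01 p1)) gu1.
have Wp := W1_norm_energy oO bO (lt_trans ltr01 p1) ru (W1 h hh).
have key : \I_Omega (fun x => L * \1_(cbox Q) x + 0) <=
  \I_Omega (fun x => 3 * L / 8 * \1_(cbox Q) x + (N `^ (1 - p) * `|(gu x).1| `^ p +
     (N^-1 * dotp (gu x - gv x) (gu x - gv x) + 0))).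
  have i0 x : 0 <= \1_(cbox Q) x :> R by rewrite indicE.
  apply: ae_bm_le_Rintegral => //.
  - by apply: bmD (bm_cst _ _); apply: bmM => //; exact: bm_cst.
  - apply: bmD; first by apply: bmM => //; exact: bm_cst.
    apply: bmD; first by apply: bmM => //; exact: bm_cst.
    by apply: bmD (bm_cst _ _); apply: bmM => //; exact: bm_cst.
  - by move=> x _; rewrite addr0; apply: mulr_ge0 => //; exact: ltW.
  - move=> x _; rewrite addr0; apply: addr_ge0; first by apply: mulr_ge0 => //; clear -L0; lra.
    apply: addr_ge0; first by apply: mulr_ge0; exact: powR_ge0.
    by apply: mulr_ge0; [rewrite invr_ge0; exact: ltW|exact: dotp_ge0].
  apply: ae_imply near => x hx /hx nx.
  have t1 : 0 <= N `^ (1 - p) * `|(gu x).1| `^ p by rewrite mulr_ge0 ?powR_ge0.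
  have t2 : 0 <= N^-1 * dotp (gu x - gv x) (gu x - gv x).
    by rewrite mulr_ge0 ?dotp_ge0 ?invr_ge0 ?(ltW N0).
  rewrite indicE; case: (boolP (x \in cbox Q)) => xQ; last first.
    by rewrite !mulr0 !add0r addr0; exact: addr_ge0.
  rewrite inE in xQ; rewrite !mulr1.
  have /andP[k1 k2] := Qq x xQ.
  have qp := lt_le_trans D0 (le_trans Dr k1).
  (* On the box [sqdist] is at most [8 * r ^+ 2], so [rS] supplies the condition of [gsol_lower],
     and the negative power is smallest at the far corner. *)
  have lo : L <= (gsol m S z D x).1.
    apply: le_trans (gsol_lower m0 m1 S0 D0 (le_trans Dr k1) _); last first.
      by apply: le_trans rS; clear -k2; lra.
    apply: ler_wpM2r; first by rewrite ltW// divr_gt0// mulr_gt0// exprn_gt0.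
    exact: powR_le_neg (ltW m0) qp k2.
  have y1 := powR_young (normr_ge0 (gu x).1) N0 p1.
  have y2 := young_inv ((gu x).1 - (gv x).1) N0 (_ : 0 <= ((gu x).2 - (gv x).2) * ((gu x).2 - (gv x).2)).
  rewrite [leLHS]addr0; apply: (triangle_lower lo nx eN y1); apply: y2; rewrite -expr2; exact: sqr_ge0.
have b1 : bm Omega (fun x => N^-1 * dotp (gu x - gv x) (gu x - gv x) + 0).
  by apply: bmD (bm_cst _ _); apply: bmM => //; exact: bm_cst.
have b2 : bm Omega (fun x => N `^ (1 - p) * `|(gu x).1| `^ p +
     (N^-1 * dotp (gu x - gv x) (gu x - gv x) + 0)).
  by apply: bmD => //; apply: bmM => //; exact: bm_cst.
have z0 : \I_Omega (fun=> 0) = 0 :> R by rewrite /Rintegral integral0_eq.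
move: key; rewrite !bm_RintegralD// ?z0; try exact: bm_cst.
rewrite IQ -/E !addr0 /Q /=.
have -> : (z.1 + 2 * r - (z.1 + r)) * (z.2 + 2 * r - (z.2 + r)) = r ^+ 2 by ring.
have := ler_wpM2l (powR_ge0 N (1 - p)) Wp; rewrite [N^-1 * E]mulrC; clear -EN; lra.
Qed.

End Final.

(** Here s stands for 8 r^2. Multiplied by s^(m (p - 1)), the inequality bounds s^(m p + 1) by a
    constant, although its exponent is negative and s is arbitrarily small. *)
Lemma powR_blowup (R : realType) (m p k b C : R) : m * p + 1 < 0 -> 0 < k -> 0 < b ->
  (forall s : R, 0 < s -> s <= b -> s `^ m * k / 2 * (s / 8) <= (s `^ m * k / 8) `^ (1 - p) * C) ->
  False.
Proof.
move=> mp k0 b0 H; set K := (k / 8) `^ (1 - p) * C.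
(* Chosen so that k / 16 * a = |K| + k / 16 exceeds K. *)
set a := `|K| * 16 / k + 1.
have K0 : 0 <= `|K| * 16 / k by rewrite divr_ge0 ?mulr_ge0// ltW.
have a0 : 0 < a by rewrite /a; lra.
set s := Num.min b (a `^ (m * p + 1)^-1).
have s0 : 0 < s by rewrite lt_min b0 powR_gt0.
have sb : s <= b by rewrite ge_min lexx.
have sa : a <= s `^ (m * p + 1).
  have aE : a = (a `^ (m * p + 1)^-1) `^ (m * p + 1).
    by rewrite -powRrM mulVf ?lt_eqF// powRr1// ltW.
  rewrite [leLHS]aE; apply: powR_le_neg (ltW mp) s0 _.
  by rewrite ge_min lexx orbT.
have t0 : 0 < s `^ (m * (p - 1)) by rewrite powR_gt0.
have := H s s0 sb; rewrite -(ler_pM2r t0).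
have k8 : 0 <= k / 8 by rewrite divr_ge0// ltW.
have -> : s `^ m * k / 8 = k / 8 * s `^ m by ring.
rewrite powRM ?powR_ge0// -powRrM.
have D x y : s `^ (x + y) = s `^ x * s `^ y by rewrite powRD// (gt_eqF s0) implybT.
have -> : (k / 8) `^ (1 - p) * s `^ (m * (1 - p)) * C * s `^ (m * (p - 1)) = K.
  have e1 : s `^ (m * (1 - p)) * s `^ (m * (p - 1)) = 1.
    by rewrite -D (_ : m * (1 - p) + m * (p - 1) = 0) ?powRr0//; ring.
  by rewrite /K -[RHS]mulr1 -[X in _ = _ * X]e1; ring.
have -> : s `^ m * k / 2 * (s / 8) * s `^ (m * (p - 1)) = k / 16 * s `^ (m * p + 1).
  rewrite (_ : m * p + 1 = m + m * (p - 1) + 1); last by ring.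
  by rewrite !D powRr1 ?ltW//; field.
have := ler_norm K.
have : k / 16 * a <= k / 16 * s `^ (m * p + 1) by rewrite ler_pM2l// divr_gt0.
have -> : k / 16 * a = `|K| + k / 16 by rewrite /a; field; rewrite gt_eqF.
lra.
Qed.

Theorem proposition1p2 (R : realType) (Omega : set (plane R))
    (Omega_poly : polygonal_domain Omega) (Omega_convex : convex_set Omega)
    (h0 : R) (h0_gt0 : 0 < h0) (Tau : R -> set (set (plane R)))
    (Tau_adm : forall h : R, 0 < h <= h0 ->
       [/\ triangulation Omega (Tau h), admissible (Tau h)
         & sup [set diam T | T in Tau h] = h])
    (Tau_reg : regular_family h0 Tau)
    (eps : R) (eps_gt0 : 0 < eps) :
  exists A : plane R -> 'M[R]_2,
    [/\ Linfty_mx Omega A, uniformly_elliptic Omega A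
      & forall p : R, 2 + eps < p ->
        exists2 f : (plane R -> R) -> R, Wm1 Omega p%:E f &
        exists u : R -> plane R -> R,
          (forall h : R, 0 < h <= h0 ->
             galerkin Omega (Tau h) A f (u h) /\
             forall w, galerkin Omega (Tau h) A f w ->
               forall x, closure Omega x -> w x = u h x) /\
          ~ exists C : R, forall h : R, 0 < h <= h0 ->
              (W1_norm Omega p%:E (u h) <= C%:E)%E].
Proof.
have [oO _ [z Oz] bO _] := Omega_poly.
have [e e0 he] := openP oO Oz.
(* The disc of squared radius 4 S around z then has radius e and lies in [Omega]. *)
pose S : R := e ^+ 2 / 4.
have S0 : 0 < S by rewrite divr_gt0// exprn_gt0.
have zO x : sqdist z x < 4 * S -> Omega x.
  move=> qx; apply: he; apply: le_lt_trans (norm_le_enorm _) _.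
  rewrite -(ltr_pXn2r (n := 2)) ?nnegrE ?enorm_ge0 ?(ltW e0)//.
  by rewrite enorm_sqr; move: qx; rewrite /S /sqdist; lra.
have e2 : 0 < 2 + eps by lra.
pose m : R := - (2 + eps)^-1.
have m0 : m < 0 by rewrite oppr_lt0 invr_gt0.
have m1 : - 2^-1 < m by rewrite ltrN2 ltf_pV2 ?posrE//; lra.
have /andP[l0 l1] := lam01 m0 m1 S0.
have c0 : 0 < (2 * m + 1) ^+ 2 by exact: exprn_gt0.
have bA i j := bm_coef z m0 m1 S0 i j oO; have [bG1 bG2] := bm_field0 z m0 m1 S0 oO.
have ell x : Omega x -> forall q : plane R,
    (2 * m + 1) ^+ 2 * dotp q q <= dotp (mx_app (coef m z x) q) q.
  by move=> _ q; exact: (coef_elliptic z m0 m1 S0).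
exists (coef m z); split.
- exact: bm_Linfty.
- exists ((2 * m + 1) ^+ 2) => //; apply: aeW => x Ox xi.
  by rewrite enorm_sqr; exact: ell.
move=> p pe; have p1 : 1 < p by lra.
exists (gform Omega (field0 m S z)); first exact: gform_Wm1.
have [u hu] : exists u : R -> plane R -> R, forall h, 0 < h <= h0 ->
    galerkin Omega (Tau h) (coef m z) (gform Omega (field0 m S z)) (u h).
  suff h1 h : exists uh, 0 < h <= h0 ->
      galerkin Omega (Tau h) (coef m z) (gform Omega (field0 m S z)) uh.
    by have [u hu] := boolp.choice h1; exists u.
  have [hh|hh] := boolP (0 < h <= h0); last by exists (fun=> 0).
  have [tri _ _] := Tau_adm h hh.
  by have [uh ?] := galerkin_exists oO bO tri bA bG1 bG2 c0 ell; exists uh.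
exists u; split.
  move=> h hh; split; first exact: hu.
  have [tri _ _] := Tau_adm h hh.
  by move=> w gw x Ox; exact: (galerkin_unique oO bO tri bA c0 ell (hu h hh) gw Ox).
move=> [C hC]; have [sigma [s0 hs]] := Tau_reg.
(* This is p > 2 + eps, and the only place where p enters beyond p > 1. *)
have mp : m * p + 1 < 0.
  have : 1 < (2 + eps)^-1 * p by rewrite mulrC ltr_pdivlMr// mul1r.
  by rewrite /m mulNr; lra.
have k0 : 0 < (2 * m + 1) * S ^+ 2 / 8 by rewrite divr_gt0// mulr_gt0// exprn_gt0.
have b0 : 0 < (2 * m + 1) * S / 16 by rewrite divr_gt0// mulr_gt0.
apply: (powR_blowup mp k0 b0 (C := C `^ p)) => s sp sb.
(* With this r, the largest squared distance from z to the box is s. *)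
have r0 : 0 < Num.sqrt (s / 8) by rewrite sqrtr_gt0 divr_gt0.
have rE : Num.sqrt (s / 8) ^+ 2 = s / 8 by rewrite sqr_sqrtr// divr_ge0// ltW.
have := gradient_lower_bound oO bO h0_gt0 Tau_adm s0 hs zO m0 m1 S0 p1 hu hC r0.
rewrite rE (_ : 8 * (s / 8) = s); last by field.
by apply; lra.
Qed.
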